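(* Let $(a,b)\in\{(2,12),(-7,36),(-22,84)\}$. Let $g(u)=-ab(u^2+1)\bigl(b^2(u^4+u^2+1)^3+a^3u^4(u^2+1)^2\bigr)$ and let $E_g^{a,b}: y^2=x^3+ag(u)^2x+bg(u)^3$ over $\mathbb{Q}(u)$. Then $E_g^{a,b}$ has rank two over $\mathbb{Q}(u)$, with free generators the two points $P_g^{a,b}=\left(-\frac{b(u^2+u+1)(u^2-u+1)}{a(u^2+1)}g(u),\ \frac{1}{a^2(u^2+1)^2}g(u)^2\right)$ and $Q_g^{a,b}=\left(-\frac{b(u^2+u+1)(u^2-u+1)}{au^2(u^2+1)}g(u),\ \frac{1}{a^2u^3(u^2+1)^2}g(u)^2\right)$.
   Context: $E_g^{a,b}$ is the quadratic twist by $g$ of the elliptic curve $E^{a,b}: y^2=x^3+ax+b$ over $\mathbb{Q}$. ''Free generators'' means that $P_g^{a,b},Q_g^{a,b}$ are independent and every point of $E_g^{a,b}(\mathbb{Q}(u))$ is a $\mathbb{Z}$-linear combination of them and torsion points. *)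

(* Defs.v *)
From HB Require Import structures.
From mathcomp Require Import all_boot all_order all_algebra.
From mathcomp Require Import fraction.
Set Implicit Arguments. Unset Strict Implicit. Unset Printing Implicit Defensive.
Import Order.TTheory GRing.Theory Num.Theory.
Local Open Scope ring_scope.

(* Points of the Weierstrass curve y^2 = x^3 + A x + B over a field K:
   None is the point at infinity O, Some (x, y) an affine point. *)

Definition ec_point (K : fieldType) := option (K * K).

Definition on_curve (K : fieldType) (A B : K) (P : ec_point K) : bool :=
  match P with
  | None => true
  | Some (x, y) => y ^+ 2 == x ^+ 3 + A * x + B
  end.

Definition ec_neg (K : fieldType) (P : ec_point K) : ec_point K :=
  match P with
  | None => None
  | Some (x, y) => Some (x, - y)
  end.

Definition ec_add (K : fieldType) (A B : K) (P Q : ec_point K) : ec_point K :=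
  match P, Q with
  | None, _ => Q
  | _, None => P
  | Some (x1, y1), Some (x2, y2) =>
      if x1 == x2 then
        if y1 == - y2 then None
        else
          let l := (3%:R * x1 ^+ 2 + A) / (2%:R * y1) in
          let x3 := l ^+ 2 - x1 - x2 in
          Some (x3, l * (x1 - x3) - y1)
      else
        let l := (y2 - y1) / (x2 - x1) in
        let x3 := l ^+ 2 - x1 - x2 in
        Some (x3, l * (x1 - x3) - y1)
  end.

Definition ec_mul (K : fieldType) (A B : K) (n : int) (P : ec_point K) : ec_point K :=
  match n with
  | Posz m => iter m (ec_add A B P) None
  | Negz m => ec_neg (iter m.+1 (ec_add A B P) None)
  end.

Definition ec_torsion (K : fieldType) (A B : K) (P : ec_point K) : Prop :=
  exists2 n : nat, (0 < n)%N & ec_mul A B (Posz n) P = None.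


Definition Qu : fieldType := {fraction {poly rat}}.
Definition uQ : Qu := @FracField.tofrac {poly rat} 'X.

Section Thm63.
Variables (a b : int).
Local Notation u := uQ.
Local Notation aK := (a%:~R : Qu).
Local Notation bK := (b%:~R : Qu).

Definition g_ab : Qu :=
  - aK * bK * (u ^+ 2 + 1) *
    (bK ^+ 2 * (u ^+ 4 + u ^+ 2 + 1) ^+ 3 + aK ^+ 3 * u ^+ 4 * (u ^+ 2 + 1) ^+ 2).

Definition A_ab : Qu := aK * g_ab ^+ 2.
Definition B_ab : Qu := bK * g_ab ^+ 3.

Definition P_ab : ec_point Qu :=
  Some (- (bK * (u ^+ 2 + u + 1) * (u ^+ 2 - u + 1)) / (aK * (u ^+ 2 + 1)) * g_ab,
        g_ab ^+ 2 / (aK ^+ 2 * (u ^+ 2 + 1) ^+ 2)).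

Definition Q_ab : ec_point Qu :=
  Some (- (bK * (u ^+ 2 + u + 1) * (u ^+ 2 - u + 1)) / (aK * u ^+ 2 * (u ^+ 2 + 1)) * g_ab,
        g_ab ^+ 2 / (aK ^+ 2 * u ^+ 3 * (u ^+ 2 + 1) ^+ 2)).
End Thm63.

(* Main.v *)
(** The three curves are the cases [t = 1, 2, 3] of [a = 5 - 3 t^2], [b = 2 t (t^2 + 5)],
    where [X^3 + a X + b = W (W^2 - 6 t W + beta)] with [W = X + 2 t], [beta = 9 t^2 + 5].
    The rational 2-torsion point [T] (where [W = 0]) makes a 2-descent over [Q(u)] elementary.

    Since the curve is a twist of a constant one, [h = deg W(u)] is an exact quadratic
    height: it satisfies the parallelogram inequality and [h(2R) = 4 h(R)].  A point with
    [h <= 3] is [O] or [T], because the squarefree polynomial [g], of degree 14, must divide a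
    form of degree [4 h].  As [h(P) = h(Q) = 4], infinite descent shows that [P, Q, T] generate
    as soon as they generate modulo [2], and independence follows from independence modulo [2].

    Write [g = - a b q H1 H2 H3] with [q = u^2 + 1] and [H1, H2, H3] of degree 4.  The class of
    [kappa = W^2 - 6 t W + beta] modulo squares is a homomorphism, with
    [kappa(P) = d H2 H3] and [kappa(Q) = d H1 H3], where [d = t^2 + 5], and [kappa(T) = beta].
    A local analysis at the places dividing [g] shows that these classes exhaust the image and
    that the kernel consists of the doubles: the residue field at [q] is [Q(i)], those
    at the [Hi] are of the form [Q(sqrt(-5), theta)] with [theta^2] in [Q(sqrt(-5))], and all
    obstructions reduce to certain rationals not being squares.  For [t = 2] the factor [H3]
    splits into two quadratics. *)
Require Import Defs.
From HB Require Import structures.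
From mathcomp Require Import all_boot all_order all_algebra.
From mathcomp Require Import all_fingroup all_solvable all_field.
From mathcomp Require Import fraction generic_quotient ring lra zify.
Set Implicit Arguments. Unset Strict Implicit. Unset Printing Implicit Defensive.
Import Order.TTheory GRing.Theory Num.Theory.
Local Open Scope ring_scope.

(** With f(X) = X^3 + aX + b, the abscissas of [P] and [Q] divided by g are X and X/u^2, where X
    solves f(X) = u^6 f(X/u^2), an equation linear in X; then g = a^4 (u^2+1)^4 f(X). The
    substitution u -> 1/u exchanges X with X/u^2, and [H1] with its reciprocal polynomial [H2]. The
    obstacle is the constants. Divisibility in Q[u] determines a class modulo squares only up to a
    rational factor, and the residue fields must show that this factor is trivial. A descent through
    the two 2-isogenies has two classes. Once kappa(R) is a square, the second one is a rational
    constant for either sign of its root, and the two constants multiply to -5 times a square. The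
    place q makes one of them plus or minus a square, and H1 excludes the minus sign. Whether a
    rational number is theta^2 times a square of Q(sqrt(-5)), for a root theta of H1, is decided by
    the norm 4t^2/d of theta^2 as long as d is not a square. For t = 2 one has d = 9 and this norm
    says nothing; coordinates in Q(sqrt(-5)) are used instead. *)

Local Notation pQ := {poly rat}.

(** * The group law *)

Section GroupLaw.
Variables (K : fieldType) (A B : K).
Hypothesis two_neq0 : (2%:R : K) != 0.
Hypothesis nonsing : forall x : K, x ^+ 3 + A * x + B = 0 -> 3%:R * x ^+ 2 + A != 0.

Local Notation on := (on_curve A B).
Local Notation "P +e Q" := (ec_add A B P Q) (at level 50, left associativity).

(* [l] is the slope of the chord or tangent through the two points: when the
   points are not opposite these two equations determine [l] in both cases. *)
Definition slope (x1 y1 x2 y2 l : K) : Prop :=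
  y2 - y1 = l * (x2 - x1) /\ l * (y1 + y2) = x1 ^+ 2 + x1 * x2 + x2 ^+ 2 + A.

Definition third (x1 y1 x2 l : K) : ec_point K :=
  Some (l ^+ 2 - x1 - x2, l * (x1 - (l ^+ 2 - x1 - x2)) - y1).

Lemma onE x y : on (Some (x, y)) -> y ^+ 2 = x ^+ 3 + A * x + B.
Proof. by move/eqP. Qed.

Lemma same_x x y1 y2 : on (Some (x, y1)) -> on (Some (x, y2)) ->
  y1 != - y2 -> y1 = y2.
Proof.
move=> /onE e1 /onE e2 ne; apply/eqP.
have /eqP : (y1 - y2) * (y1 + y2) = 0 by rewrite -subr_sqr e1 e2 subrr.
by rewrite mulf_eq0 subr_eq0 addr_eq0 (negPf ne) orbF.
Qed.

Lemma dbl_neq0 (y : K) : y != - y -> y != 0.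
Proof. by apply: contraNneq => ->; rewrite oppr0. Qed.

Lemma opp_eq0 (y : K) : y = - y -> y = 0.
Proof.
move=> h; have : 2%:R * y = 0 by rewrite mulr_natl mulr2n {2}h subrr.
by move/eqP; rewrite mulf_eq0 (negPf two_neq0) /= => /eqP.
Qed.

Lemma slope_exists x1 y1 x2 y2 :
  on (Some (x1, y1)) -> on (Some (x2, y2)) -> ~~ ((x1 == x2) && (y1 == - y2)) ->
  exists2 l, slope x1 y1 x2 y2 l & Some (x1, y1) +e Some (x2, y2) = third x1 y1 x2 l.
Proof.
move=> o1 o2; rewrite /ec_add; case: eqP => [ex | /eqP nx] /=.
  subst x2 => ny; rewrite (negPf ny); have ey := same_x o1 o2 ny; subst y2.
  have y0 := dbl_neq0 ny; exists ((3%:R * x1 ^+ 2 + A) / (2%:R * y1)); last by [].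
  by split; [rewrite !subrr mulr0 | field; rewrite y0 two_neq0].
move=> _; have dx : x2 - x1 != 0 by rewrite subr_eq0 eq_sym.
exists ((y2 - y1) / (x2 - x1)); last by []; split; first by rewrite divfK.
have e : y2 ^+ 2 - y1 ^+ 2 = (x2 - x1) * (x1 ^+ 2 + x1 * x2 + x2 ^+ 2 + A).
  by rewrite (onE o1) (onE o2); ring.
apply: (mulfI dx); rewrite -e; field; exact: dx.
Qed.

Lemma slope_uniq x1 y1 x2 y2 l m :
  ~~ ((x1 == x2) && (y1 == - y2)) ->
  slope x1 y1 x2 y2 l -> slope x1 y1 x2 y2 m -> l = m.
Proof.
move=> ne [a1 b1] [a2 b2].
have [ex|nx] := eqVneq x1 x2.
  move: ne; rewrite ex eqxx /= -addr_eq0 => ny.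
  by apply: (mulIf ny); rewrite b1 b2.
have dx : x2 - x1 != 0 by rewrite subr_eq0 eq_sym.
by apply: (mulIf dx); rewrite -a1 -a2.
Qed.

Lemma addE x1 y1 x2 y2 l :
  on (Some (x1, y1)) -> on (Some (x2, y2)) -> ~~ ((x1 == x2) && (y1 == - y2)) ->
  slope x1 y1 x2 y2 l -> Some (x1, y1) +e Some (x2, y2) = third x1 y1 x2 l.
Proof.
move=> o1 o2 ne s; have [m sm ->] := slope_exists o1 o2 ne.
by rewrite (slope_uniq ne s sm).
Qed.

Lemma add_opp x y : Some (x, y) +e Some (x, - y) = None.
Proof. by rewrite /ec_add eqxx opprK eqxx. Qed.

Lemma add_oppb x1 y1 x2 y2 : (x1 == x2) && (y1 == - y2) ->
  Some (x1, y1) +e Some (x2, y2) = None.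
Proof. by case/andP=> /eqP -> /eqP ->; rewrite /ec_add !eqxx. Qed.

Lemma oppb_sym (x1 y1 x2 y2 : K) :
  (x2 == x1) && (y2 == - y1) = (x1 == x2) && (y1 == - y2).
Proof. by rewrite eq_sym -eqr_oppLR [- y2 == _]eq_sym. Qed.

Lemma on_neg P : on P -> on (ec_neg P).
Proof. by case: P => [[x y]|] //=; rewrite sqrrN. Qed.

(** Eliminating [y2] and [A] in favour of the slope turns statements about chords and tangents alike
    into polynomial identities. *)
Lemma slopeA x1 y1 x2 y2 l : slope x1 y1 x2 y2 l ->
  y2 = y1 + l * (x2 - x1) /\
  A = l * (2%:R * y1 + l * (x2 - x1)) - (x1 ^+ 2 + x1 * x2 + x2 ^+ 2).
Proof.
case=> a1 b1; have ey : y2 = y1 + l * (x2 - x1) by rewrite -a1; ring.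
split=> //; have -> : 2%:R * y1 + l * (x2 - x1) = y1 + y2 by rewrite ey; ring.
by rewrite b1; ring.
Qed.

Lemma on_third x1 y1 x2 y2 l : on (Some (x1, y1)) ->
  slope x1 y1 x2 y2 l -> on (third x1 y1 x2 l).
Proof.
move=> /onE o1 /slopeA [ey eA]; apply/eqP.
have -> : B = y1 ^+ 2 - x1 ^+ 3 - A * x1 by rewrite o1; ring.
by rewrite eA; ring.
Qed.

Lemma on_add P Q : on P -> on Q -> on (P +e Q).
Proof.
case: P => [[x1 y1]|] //; case: Q => [[x2 y2]|] // o1 o2.
have [h|h] := boolP ((x1 == x2) && (y1 == - y2)); first by rewrite add_oppb.
have [l s ->] := slope_exists o1 o2 h; exact: on_third o1 s.
Qed.

Lemma slope_sym x1 y1 x2 y2 l : slope x1 y1 x2 y2 l -> slope x2 y2 x1 y1 l.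
Proof.
case=> a1 b1; split; last by rewrite addrC b1; ring.
by rewrite -[y1 - y2]opprB a1; ring.
Qed.

Lemma add_comm P Q : on P -> on Q -> P +e Q = Q +e P.
Proof.
case: P => [[x1 y1]|]; case: Q => [[x2 y2]|] // o1 o2.
have [h|h] := boolP ((x1 == x2) && (y1 == - y2)).
  by rewrite !add_oppb // oppb_sym.
have [l s ->] := slope_exists o1 o2 h.
rewrite (addE o2 o1 _ (slope_sym s)) 1?oppb_sym //.
have [-> _] := slopeA s.
by congr (Some (_, _)); ring.
Qed.

Lemma negK (P : ec_point K) : ec_neg (ec_neg P) = P.
Proof. by case: P => [[x y]|] //=; rewrite opprK. Qed.

Lemma slope_neg x1 y1 x2 y2 l : slope x1 y1 x2 y2 l ->
  slope x1 (- y1) x2 (- y2) (- l).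
Proof.
case=> a1 b1; split; first by rewrite -opprD a1 mulNr.
by rewrite -opprD mulrNN.
Qed.

Lemma neg_add P Q : on P -> on Q -> ec_neg (P +e Q) = ec_neg P +e ec_neg Q.
Proof.
case: P => [[x1 y1]|]; case: Q => [[x2 y2]|] // o1 o2.
have [h|h] := boolP ((x1 == x2) && (y1 == - y2)).
  by rewrite !add_oppb // eqr_opp.
have [l s ->] := slope_exists o1 o2 h.
rewrite [RHS](addE (on_neg o1) (on_neg o2) _ (slope_neg s)) ?eqr_opp //=.
by congr (Some (_, _)); ring.
Qed.

Lemma neg_addl P : ec_neg P +e P = None.
Proof. by case: P => [[x y]|] //; apply: add_oppb; rewrite !eqxx. Qed.

(** An affine [Q] would force [y1 = 0] and make [x1] a double root of the cubic, against
    [nonsing]. *)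
Lemma add_idl_none P Q : on P -> on Q -> P <> None -> P +e Q = P -> Q = None.
Proof.
case: P => [[x1 y1]|] //; case: Q => [[x2 y2]|] // o1 o2 _.
have [h|h] := boolP ((x1 == x2) && (y1 == - y2)); first by rewrite add_oppb.
have [l s ->] := slope_exists o1 o2 h.
case=> ex; rewrite ex subrr mulr0 add0r => /esym/opp_eq0 y0; subst y1.
case/slopeA: s => _ eA.
have e0 : x1 ^+ 3 + A * x1 + B = 0 by rewrite -(onE o1) expr0n.
case/eqP: (nonsing e0).
have e2 : x2 = l ^+ 2 - x1 - (l ^+ 2 - x1 - x2) by ring.
rewrite ex in e2.
by rewrite eA e2; ring.
Qed.

(** The reflected chord, of slope [- l], passes through [- P], [- Q] and [P + Q], so the sum can be
    read off. This cancellation law is what settles the degenerate cases of associativity. *)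
Lemma ec_addNK P Q : on P -> on Q -> ec_neg P +e (P +e Q) = Q.
Proof.
case: P => [[x1 y1]|] //; case: Q => [[x2 y2]|] // o1 o2; last by rewrite [LHS]neg_addl.
have [h|h] := boolP ((x1 == x2) && (y1 == - y2)).
  by rewrite add_oppb //; case/andP: h => /eqP -> /eqP ->; rewrite /= opprK.
have [l s e] := slope_exists o1 o2 h; rewrite e.
have o3 := on_third o1 s.
have [h3|h3] := boolP ((x1 == l ^+ 2 - x1 - x2) &&
   (- y1 == - (l * (x1 - (l ^+ 2 - x1 - x2)) - y1))).
  suff : Some (x2, y2) = None :> ec_point K by [].
  apply: (add_idl_none o1 o2) => //; rewrite e /third.
  by case/andP: h3; rewrite eqr_opp => /eqP <- /eqP <-.
have s3 : slope x1 (- y1) (l ^+ 2 - x1 - x2)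
   (l * (x1 - (l ^+ 2 - x1 - x2)) - y1) (- l).
  by case/slopeA: s => _ eA; split; [ring | rewrite eA; ring].
rewrite [LHS](addE (on_neg o1) o3 h3 s3).
have [-> _] := slopeA s.
by congr (Some (_, _)); ring.
Qed.

(** All four additions are chords. The difference of the two slope equations is linear in [y2] with
    coefficient [2 (l - m)]; after eliminating [y2], the claim is an identity in the free variables
    [x1], [x2], [x3], [l], [m]. *)
Lemma assoc_chord (x1 x2 x3 y1 y2 y3 l m l6 l7 : K) :
  y1 = y2 + l * (x1 - x2) -> y3 = y2 + m * (x3 - x2) ->
  l * (2%:R * y2 + l * (x1 - x2)) = x1 ^+ 2 + x1 * x2 + x2 ^+ 2 + A ->
  m * (2%:R * y2 + m * (x3 - x2)) = x3 ^+ 2 + x3 * x2 + x2 ^+ 2 + A ->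
  l - m != 0 ->
  let x4 := l ^+ 2 - x1 - x2 in let y4 := l * (x1 - x4) - y1 in
  let x5 := m ^+ 2 - x2 - x3 in let y5 := m * (x2 - x5) - y2 in
  x3 - x4 != 0 -> x5 - x1 != 0 ->
  l6 = (y3 - y4) / (x3 - x4) -> l7 = (y5 - y1) / (x5 - x1) ->
  third x4 y4 x3 l6 = third x1 y1 x5 l7.
Proof.
move=> -> -> e1 e2 lm x4 y4 x5 y5 h34 h15 -> ->.
have hy : y2 = (x1 ^+ 2 + x1 * x2 - x3 ^+ 2 - x3 * x2 - l ^+ 2 * (x1 - x2)
                 + m ^+ 2 * (x3 - x2)) / (2%:R * (l - m)).
  apply/(mulIf (_ : 2%:R * (l - m) != 0)); first by rewrite mulf_neq0.
  rewrite mulfVK ?mulf_neq0 //.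
  have e3 : l * (2%:R * y2 + l * (x1 - x2)) - m * (2%:R * y2 + m * (x3 - x2))
     = x1 ^+ 2 + x1 * x2 + x2 ^+ 2 + A - (x3 ^+ 2 + x3 * x2 + x2 ^+ 2 + A).
    by rewrite e1 e2.
  have -> : y2 * (2%:R * (l - m)) =
     (l * (2%:R * y2 + l * (x1 - x2)) - m * (2%:R * y2 + m * (x3 - x2)))
     - l ^+ 2 * (x1 - x2) + m ^+ 2 * (x3 - x2) by ring.
  by rewrite e3; ring.
move: h34 h15; rewrite /third /y4 /y5 /x4 /x5 hy => h34 h15.
by congr (Some (_, _)); field; rewrite ?two_neq0 ?lm ?h34 ?h15.
Qed.

(** The triple [P], [Q], [P + Q]: the left sum is a tangent, the right one a chord. The slopes [l]
    and [m] serve as parameters in place of the ordinates. *)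
Lemma assoc_tangent (x1 x2 y1 y2 l m l6 l7 : K) :
  y1 = y2 + l * (x1 - x2) ->
  A = l * (2%:R * y2 + l * (x1 - x2)) - (x1 ^+ 2 + x1 * x2 + x2 ^+ 2) ->
  let x3 := l ^+ 2 - x1 - x2 in let y3 := l * (x1 - x3) - y1 in
  x3 - x2 != 0 -> y3 != 0 -> m = (y3 - y2) / (x3 - x2) ->
  let x5 := m ^+ 2 - x2 - x3 in let y5 := m * (x2 - x5) - y2 in
  x5 - x1 != 0 ->
  l6 = (3%:R * x3 ^+ 2 + A) / (2%:R * y3) -> l7 = (y5 - y1) / (x5 - x1) ->
  third x3 y3 x3 l6 = third x1 y1 x5 l7.
Proof.
move=> ey1 eA x3 y3 h32 hy3 em x5 y5 h15 -> ->.
have ey2 : y2 = - (m + l) * (x3 - x2) / 2%:R.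
  have -> : m + l = (- 2%:R * y2) / (x3 - x2).
    by rewrite em /y3 ey1; field; exact: h32.
  by field; rewrite h32 two_neq0.
have ey3 : 2%:R * y3 = (x3 - x2) * (m - l).
  by rewrite /y3 ey1 ey2; field; exact: two_neq0.
have hml : m - l != 0.
  by apply: contraNneq (mulf_neq0 two_neq0 hy3) => h; rewrite ey3 h mulr0.
rewrite ey3 eA /third /y5 /y3 ey1 ey2; move: h32 h15; rewrite /x5 /x3 => h32 h15.
by congr (Some (_, _)); field; rewrite ?two_neq0 ?h15 ?h32 ?hml.
Qed.

(** Here [Q] has order 2, so that both sides are doublings, one of [P + Q] and one of [P]. The first
    hypothesis is the curve equation with [y2 = 0]. *)
Lemma assoc_two_torsion (x1 x2 y1 l l6 l7 : K) :
  A * (x1 - x2) = y1 ^+ 2 - x1 ^+ 3 + x2 ^+ 3 -> x1 - x2 != 0 -> l = y1 / (x1 - x2) ->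
  let x3 := l ^+ 2 - x1 - x2 in let y3 := l * (x1 - x3) - y1 in
  y1 != 0 -> y3 != 0 ->
  l6 = (3%:R * x3 ^+ 2 + A) / (2%:R * y3) -> l7 = (3%:R * x1 ^+ 2 + A) / (2%:R * y1) ->
  third x3 y3 x3 l6 = third x1 y1 x1 l7.
Proof.
move=> eA h12 el x3 y3 h1 h3 -> ->.
have ey1 : y1 = l * (x1 - x2) by rewrite el divfK.
have eA' : A = (y1 ^+ 2 - x1 ^+ 3 + x2 ^+ 3) / (x1 - x2) by rewrite -eA mulfK.
have ey3 : y3 = l * (x2 - x3) by rewrite /y3 ey1; ring.
have l0 : l != 0 by apply: contraNneq h1 => l0; rewrite ey1 l0 mul0r.
have h23 : x2 - x3 != 0 by apply: contraNneq h3 => h; rewrite ey3 h mulr0.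
rewrite ey3 eA' /third ey1; move: h23; rewrite /x3 => h23.
by congr (Some (_, _)); field; rewrite ?two_neq0 ?l0 ?h12 ?h23.
Qed.

Lemma add_none P : P +e None = P.
Proof. by case: P => [[]|]. Qed.

Lemma slope_chord x1 y1 x2 y2 l : x2 - x1 != 0 -> slope x1 y1 x2 y2 l ->
  l = (y2 - y1) / (x2 - x1).
Proof. by move=> dx [-> _]; rewrite mulfK. Qed.

Lemma slope_tangent x1 y1 l : y1 != 0 -> slope x1 y1 x1 y1 l ->
  l = (3%:R * x1 ^+ 2 + A) / (2%:R * y1).
Proof.
move=> y0 [_ e]; apply: (mulIf (_ : 2%:R * y1 != 0)); first by rewrite mulf_neq0.
rewrite divfK ?mulf_neq0 //; have -> : l * (2%:R * y1) = l * (y1 + y1) by ring.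
by rewrite e; ring.
Qed.

Lemma add_none_neg P Q : on P -> on Q -> P +e Q = None -> Q = ec_neg P.
Proof. by move=> oP oQ e; rewrite -(ec_addNK oP oQ) e add_none. Qed.

Lemma add_idr_none P Q : on P -> on Q -> Q <> None -> P +e Q = Q -> P = None.
Proof. by move=> oP oQ nQ; rewrite add_comm //; apply: add_idl_none. Qed.

(** Associativity for the triple [P], [Q], [P + Q], the only one that cancellation does not settle
    and for which an outer sum fails to be a chord. *)
Lemma assoc_sum P Q : on P -> on Q -> P != None -> Q != None ->
  let R := P +e Q in R != None -> Q +e R != None -> R != ec_neg R ->
  P != ec_neg (Q +e R) -> R +e R = P +e (Q +e R).
Proof.
move=> oP oQ nP nQ R nR nQR nRR nPQR; have oR : on R := on_add oP oQ.
have oQR := on_add oQ oR.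
case: P @R oP nP nPQR nR nQR nRR oR oQR
  => [[x1 y1]|] // R oP nP nPQR nR nQR nRR oR oQR.
case: Q @R oQ nQ nPQR nR nQR nRR oR oQR
  => [[x2 y2]|] // R oQ nQ nPQR nR nQR nRR oR oQR.
have h12 : ~~ ((x1 == x2) && (y1 == - y2)).
  by apply: contra nR => h; rewrite /R add_oppb.
have [l sl el] := slope_exists oP oQ h12; have [ey1 eA1] := slopeA (slope_sym sl).
set x3 := l ^+ 2 - x1 - x2; set y3 := l * (x1 - x3) - y1.
have eR : R = Some (x3, y3) by [].
have y30 : y3 != 0.
  by apply: contraNneq nRR => y30; rewrite eR y30 /= oppr0.
have x32 : x3 - x2 != 0.
  rewrite subr_eq0; apply: contraNneq nQR => e.
  have [ey|ny] := eqVneq y3 (- y2).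
    by rewrite eR e ey add_opp.
  move: oR; rewrite eR e => oR; move: (same_x oR oQ ny) => ey.
  suff : Some (x1, y1) = None :> ec_point K by [].
  by apply: (add_idr_none oP oQ) => //; rewrite -/R eR e ey.
have h23 : ~~ ((x2 == x3) && (y2 == - y3)).
  by apply: contra nQR => h; rewrite eR add_oppb.
rewrite eR in oR oQR nRR nPQR nQR *.
have [m sm em] := slope_exists oQ oR h23.
have h33 : ~~ ((x3 == x3) && (y3 == - y3)).
  by rewrite eqxx /=; apply: contraNneq y30 => /opp_eq0 ->.
have [l6 s6 e6] := slope_exists oR oR h33.
set x5 := m ^+ 2 - x2 - x3; set y5 := m * (x2 - x5) - y2.
have e5 : Some (x2, y2) +e Some (x3, y3) = Some (x5, y5) by [].
have h15 : ~~ ((x1 == x5) && (y1 == - y5)).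
  by apply: contra nPQR => /andP [/eqP ex /eqP ey]; rewrite e5 ex ey.
rewrite e5 in oQR *; have [l7 s7 e7] := slope_exists oP oQR h15; rewrite e6 e7.
have [e15|n15] := eqVneq x1 x5; last first.
  have dx51 : x5 - x1 != 0 by rewrite subr_eq0 eq_sym.
  apply: (assoc_tangent ey1 _ x32 y30 (slope_chord x32 sm) dx51
           (slope_tangent y30 s6) (slope_chord dx51 s7)).
  by rewrite eA1; ring.
have ey15 : y1 = y5.
  by move: h15 oP oQR; rewrite e15 eqxx /= => h15 oP oQR; apply: same_x oP oQR h15.
(* Now [P = Q + R] as well as [R = P + Q]; cancelling gives [- Q = Q]. *)
have y20 : y2 = 0.
  apply: opp_eq0.
  have := ec_addNK oP oQ; rewrite -/R eR => c1.
  have := ec_addNK oR oQ; rewrite [Some (x3, y3) +e _]add_comm // e5.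
  rewrite -e15 -ey15 add_comm ?on_neg // => c2.
  have : ec_neg (Some (x2, y2)) = Some (x2, y2).
    rewrite -[in LHS]c1 neg_add ?on_neg // negK.
    by rewrite -[in RHS]c2.
  by case=> e; rewrite {1}e.
move: s7; rewrite -e15 -ey15 => s7.
have x12 : x1 - x2 != 0.
  rewrite subr_eq0; apply: contra h12 => /eqP ex; rewrite ex eqxx y20 oppr0 /=.
  by move: (onE oP); rewrite ex -(onE oQ) y20 expr0n /= => /eqP; rewrite sqrf_eq0.
have y10 : y1 != 0.
  apply: contraNneq y30 => y10; case: sl => [].
  rewrite y10 y20 subrr => /esym/eqP; rewrite mulf_eq0 -[x2 - x1]opprB oppr_eq0.
  by rewrite (negPf x12) orbF => /eqP l0 _; rewrite /y3 y10 l0 mul0r subrr.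
have el' : l = y1 / (x1 - x2).
  by apply: (mulIf x12); rewrite divfK // ey1 y20; ring.
have := slope_tangent y30 s6; have := slope_tangent y10 s7.
move: y30; rewrite /y3 /x3 => *; apply: (assoc_two_torsion _ x12 el') => //.
have := onE oQ; rewrite y20 (onE oP) expr0n /= => eB.
have -> : B = - (x2 ^+ 3 + A * x2).
  by apply/eqP; rewrite -addr_eq0 addrC -eB.
by ring.
Qed.

Lemma add_assoc P Q R : on P -> on Q -> on R -> (P +e Q) +e R = P +e (Q +e R).
Proof.
move=> oP oQ oR; have oPQ := on_add oP oQ; have oQR := on_add oQ oR.
have [-> //|nP] := eqVneq P None.
have [eQ|nQ] := eqVneq Q None; first by rewrite eQ add_none.
have [eR|nR] := eqVneq R None; first by rewrite eR !add_none.
have [e|nPR] := eqVneq P R.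
  by rewrite -e [RHS]add_comm ?on_add // [Q +e P]add_comm.
have [e|nPQ0] := eqVneq (P +e Q) None.
  by rewrite e (add_none_neg oP oQ e) -{1}[P]negK ec_addNK ?on_neg.
have [e|nQR0] := eqVneq (Q +e R) None.
  rewrite e add_none (add_none_neg oQ oR e) [P +e Q]add_comm //.
  by rewrite add_comm ?ec_addNK ?on_add ?on_neg.
have [e|nPQR] := eqVneq (P +e Q) (ec_neg R).
  have oR' := on_neg oR.
  have eQ : Q = ec_neg P +e ec_neg R by rewrite -e ec_addNK.
  rewrite e neg_addl eQ -neg_add // [P +e R]add_comm // neg_add //.
  have -> : ec_neg R +e ec_neg P +e R = ec_neg P.
    by rewrite add_comm ?on_add ?on_neg // -{1}[R]negK ec_addNK ?on_neg.
  by rewrite add_comm ?on_neg // neg_addl.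
have [e|nPQR'] := eqVneq P (ec_neg (Q +e R)).
  have eR : R = ec_neg Q +e ec_neg P by rewrite e negK ec_addNK.
  rewrite [in RHS]e neg_addl [in LHS]eR -neg_add // [P +e Q]add_comm //.
  by rewrite add_comm ?on_neg ?on_add // neg_addl.
case: P oP nP nPR oPQ nPQ0 nPQR nPQR' => [[x1 y1]|] // oP _ nPR oPQ nPQ0 nPQR nPQR'.
case: Q oQ nQ oPQ oQR nPQ0 nQR0 nPQR nPQR' => [[x2 y2]|] // oQ _ oPQ oQR nPQ0 nQR0 nPQR nPQR'.
case: R oR nR oQR nPR nQR0 nPQR nPQR' => [[x3 y3]|] // oR _ oQR nPR nQR0 nPQR nPQR'.
have h12 : ~~ ((x1 == x2) && (y1 == - y2)).
  by apply: contra nPQ0 => h; rewrite add_oppb.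
have h23 : ~~ ((x2 == x3) && (y2 == - y3)).
  by apply: contra nQR0 => h; rewrite add_oppb.
have [l sl el] := slope_exists oP oQ h12; have [m sm em] := slope_exists oQ oR h23.
rewrite el in oPQ nPQ0 nPQR *; rewrite em in oQR nQR0 nPQR' *.
have [ey3 eA3] := slopeA sm; have [ey1 eA1] := slopeA (slope_sym sl).
have [_ eA1'] := slopeA sl.
set x4 := l ^+ 2 - x1 - x2; set y4 := l * (x1 - x4) - y1.
set x5 := m ^+ 2 - x2 - x3; set y5 := m * (x2 - x5) - y2.
rewrite /third -/x4 -/x5 -/y4 -/y5 in oPQ nPQ0 nPQR oQR nQR0 nPQR' el em *.
have h43 : ~~ ((x4 == x3) && (y4 == - y3)).
  by apply: contra nPQR => /andP [/eqP -> /eqP ->].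
have h15 : ~~ ((x1 == x5) && (y1 == - y5)).
  by apply: contra nPQR' => /andP [/eqP -> /eqP ->].
have [l6 s6 e6] := slope_exists oPQ oR h43; have [l7 s7 e7] := slope_exists oP oQR h15.
(* As opposite points have been dealt with, equal abscissas mean [R = P + Q] or [P = Q + R], both
   covered by [assoc_sum]. *)
have [e34|n34] := eqVneq x3 x4; last first.
  have [e15|n15] := eqVneq x1 x5; last first.
    rewrite e6 e7; have dx34 : x3 - x4 != 0 by rewrite subr_eq0.
    have dx51 : x5 - x1 != 0 by rewrite subr_eq0 eq_sym.
    (* Equal slopes would put the three points on one line, so that [x3] is [x1] or the third
       abscissa [x4]. *)
    have lm : l - m != 0.
      rewrite subr_eq0; apply: contraNneq n34 => elm.
      have /eqP : (x1 - x3) * (x4 - x3) = 0.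
        have : A - A = 0 by rewrite subrr.
        by rewrite {1}eA1 eA3 -elm => <-; rewrite /x4; ring.
      rewrite mulf_eq0 !subr_eq0 => /orP [/eqP e13|/eqP -> //].
      by case/eqP: nPR; rewrite ey3 ey1 -elm e13.
    apply: (assoc_chord ey1 ey3 _ _ lm dx34 dx51
             (slope_chord dx34 s6) (slope_chord dx51 s7)).
      by rewrite eA1; ring.
    by rewrite eA3; ring.
  have e5 : Some (x5, y5) = Some (x1, y1) :> ec_point K.
    rewrite e15; congr (Some (_, _)); apply/esym.
    by move: h15 oP oQR; rewrite e15 eqxx /= => h15 oP oQR; apply: same_x oP oQR h15.
  have eP : Some (x3, y3) +e Some (x2, y2) = Some (x1, y1) by rewrite add_comm // em.
  have eQP : Some (x2, y2) +e Some (x1, y1) = Some (x4, y4) by rewrite add_comm.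
  have := assoc_sum oR oQ isT isT; cbv zeta; rewrite eP eQP e5 => -> //.
  - exact: add_comm.
  - by rewrite -{2}e5.
  - by apply: contraNneq nPQR => ->; rewrite negK.
have e4 : Some (x4, y4) = Some (x3, y3) :> ec_point K.
  rewrite e34; congr (Some (_, _)).
  by move: h43 oR oPQ; rewrite e34 eqxx /= => h43 oR oPQ; apply: same_x oPQ oR h43.
have := assoc_sum oP oQ isT isT; cbv zeta; rewrite el e4 em => -> //.
by rewrite -{1}e4.
Qed.
End GroupLaw.

(** * The points of a smooth curve as an abelian group *)

Record smooth_curve (K : fieldType) := SmoothCurve {
  cA : K;
  cB : K;
  curve_two : (2%:R : K) != 0;
  curve_smooth : forall x : K, x ^+ 3 + cA * x + cB = 0 -> 3%:R * x ^+ 2 + cA != 0 }.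

Definition cpoint (K : fieldType) (E : smooth_curve K) :=
  {P : ec_point K | on_curve (cA E) (cB E) P}.

Section CurveGroup.
Variables (K : fieldType) (E : smooth_curve K).
Local Notation A := (cA E).
Local Notation B := (cB E).

HB.instance Definition _ := [Choice of cpoint E by <:].

Definition cp_add (P Q : cpoint E) : cpoint E :=
  exist _ (ec_add A B (val P) (val Q)) (on_add (curve_two E) (valP P) (valP Q)).
Definition cp_opp (P : cpoint E) : cpoint E :=
  exist _ (ec_neg (val P)) (on_neg (valP P)).
Definition cp_zero : cpoint E := exist _ None isT.

Fact cp_addA : associative cp_add.
Proof.
move=> P Q R; apply/val_inj/esym.
exact: (add_assoc (curve_two E) (@curve_smooth _ E) (valP P) (valP Q) (valP R)).
Qed.
Fact cp_addC : commutative cp_add.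
Proof. by move=> P Q; apply/val_inj/(add_comm (curve_two E) (valP P) (valP Q)). Qed.
Fact cp_add0 : left_id cp_zero cp_add.
Proof. by move=> P; apply: val_inj. Qed.
Fact cp_addN : left_inverse cp_zero cp_opp cp_add.
Proof. by move=> P; apply/val_inj/neg_addl. Qed.

HB.instance Definition _ :=
  GRing.isZmodule.Build (cpoint E) cp_addA cp_addC cp_add0 cp_addN.

Lemma val_mulrz (P : cpoint E) (m : int) : val (P *~ m) = ec_mul A B m (val P).
Proof.
have H n : val (P *+ n) = iter n (ec_add A B (val P)) None.
  by elim: n => [|n IH] //; rewrite mulrS /= IH.
case: m => n; first by rewrite -pmulrn H.
by rewrite NegzE mulrNz -pmulrn; congr ec_neg; exact: (H n.+1).
Qed.

Lemma val_add (P Q : cpoint E) : val (P + Q) = ec_add A B (val P) (val Q).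
Proof. by []. Qed.

Lemma torsion_mulrn (P : cpoint E) : ec_torsion A B (val P) <->
  exists2 n, (0 < n)%N & P *+ n = 0.
Proof.
split=> -[n n0 e]; exists n => //; last by rewrite -val_mulrz -pmulrn e.
by apply: val_inj; rewrite pmulrn val_mulrz e.
Qed.
End CurveGroup.

(** * Descent in an abelian group with a height *)

Section Descent.
Variables (V : zmodType) (h : V -> nat) (P Q T : V).
Hypothesis h0 : h 0 = 0%N.
Hypothesis hT : h T = 0%N.
Hypothesis h_dbl : forall x, (4 * h x <= h (x *+ 2))%N.
Hypothesis h_small : forall x, (h x <= 3)%N -> x = 0 \/ x = T.
Hypothesis indep2 : forall (e1 e2 e3 : bool) X,
  P *+ e1 + Q *+ e2 + T *+ e3 = X *+ 2 -> [/\ e1 = false, e2 = false & e3 = false].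

Lemma dbl_grows x : x <> 0 -> x <> T ->
  [/\ x *+ 2 <> 0, x *+ 2 <> T & (h x < h (x *+ 2))%N].
Proof.
move=> x0 xT; have hx : (3 < h x)%N.
  by rewrite ltnNge; apply/negP => /h_small [].
have hd := h_dbl x.
by split; [move=> e; rewrite e h0 in hd; lia | move=> e; rewrite e hT in hd; lia | lia].
Qed.

Lemma pow2_grows x k : x <> 0 -> x <> T ->
  [/\ x *+ 2 ^ k <> 0, x *+ 2 ^ k <> T & (h x + k <= h (x *+ 2 ^ k))%N].
Proof.
move=> x0 xT; elim: k => [|k [a b c]]; first by rewrite expn0 mulr1n addn0.
have [a' b' c'] := dbl_grows a b.
by rewrite expnSr mulrnA; split=> //; rewrite addnS; apply: leq_ltn_trans c'.
Qed.

(** Multiplying [x] by the 2-part of [n] gives a point [y] killed by an odd [m]. By Euler,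
    [totient m] further doublings return to [y], whereas doubling strictly increases the height away
    from [0] and [T]. *)
Lemma torsion_small x n : (0 < n)%N -> x *+ n = 0 -> x = 0 \/ x = T.
Proof.
move=> n0 xn.
have [->|/eqP x0] := eqVneq x 0; first by left.
have [->|/eqP xT] := eqVneq x T; first by right.
have [y0 yT _] := pow2_grows (logn 2 n) x0 xT.
set y := x *+ _ in y0 yT.
pose m := (n`_2^')%N.
have ym : y *+ m = 0 by rewrite -mulrnA -p_part partnC // xn.
have m0 : (0 < m)%N by apply: part_gt0.
have co : coprime 2 m.
  by rewrite prime_coprime //; have := part_pnat (2^')%N n; rewrite -p'natE.
have /eqP := Euler_exp_totient co.
have [_ _] := pow2_grows (totient m) y0 yT.
have : (0 < totient m)%N by rewrite totient_gt0.
set k := totient _ => k0 hk ek.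
have le1 : (1 <= 2 ^ k)%N by rewrite expn_gt0.
have /dvdnP [q eq2] : (m %| 2 ^ k - 1)%N by rewrite -eqn_mod_dvd.
have e2 : (2 ^ k = 1 + m * q)%N by rewrite mulnC -eq2 subnKC.
move: hk; rewrite e2 mulrnDr mulr1n mulrnA ym mul0rn addr0.
by rewrite -[leqRHS]addn0 leq_add2l leqNgt k0.
Qed.

(** Infinite descent on [|m| + |n|]: the combination is [0] or [T], so independence modulo 2 makes
    [m] and [n] even, and the halved combination is killed by 2, hence torsion again. *)
Theorem descent_independence (m n : int) (N : nat) : (0 < N)%N ->
  (P *~ m + Q *~ n) *+ N = 0 -> m = 0 /\ n = 0.
Proof.
have [k] := ubnP (`|m| + `|n|)%N; elim: k m n N => // k IH m n N; rewrite ltnS => hk N0 tors.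
have [e eT] : exists e : bool, P *~ m + Q *~ n = T *+ e.
  by case: (torsion_small N0 tors) => ->; [exists false | exists true].
have half (z : int) : exists (z' : int) (b : bool), z = z' *+ 2 + b%:Z.
  exists (z %/ 2)%Z, (z %% 2 == 1)%Z; lia.
have [m' [r em]] := half m; have [n' [s en]] := half n.
have dist (X : V) (z : int) (b : bool) : X *~ (z *+ 2 + b%:Z) = X *~ z *+ 2 + X *+ b.
  by rewrite mulrzDr -pmulrn; congr (_ + _); rewrite !mulr2n mulrzDr.
rewrite em en !dist in eT.
have [] : [/\ r = false, s = false & e = false].
  apply: (@indep2 _ _ _ (T *+ e - (P *~ m' + Q *~ n'))).
  have -> : P *+ r + Q *+ s = T *+ e - (P *~ m' *+ 2 + Q *~ n' *+ 2).
    have aux (x y z w v : V) : x + z + (y + w) = v -> z + w = v - (x + y).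
      by move=> <-; rewrite addrACA [x + y + _]addrC addrK.
    exact: aux eT.
  by rewrite mulrnBl [in RHS]mulrnDl addrAC -mulr2n.
move=> r0 s0 e0; subst r s e.
have e2 : (P *~ m' + Q *~ n') *+ 2 = 0.
  by rewrite mulrnDl; move: eT; rewrite !mulr0n !addr0.
have [a0 b0] : m' = 0 /\ n' = 0.
  have [mn0|mn0] := eqVneq (`|m'| + `|n'|)%N 0%N; first by split; lia.
  by apply: (IH _ _ 2%N) => //; lia.
by rewrite em en a0 b0.
Qed.
Hypothesis T2 : T *+ 2 = 0.
Hypothesis hP : (h P <= 4)%N.
Hypothesis hQ : (h Q <= 4)%N.
Hypothesis h_par : forall x y, (h (x + y) + h (x - y) <= 2 * h x + 2 * h y)%N.
Hypothesis span2 : forall R, exists e1 e2 e3 : bool, exists X,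
  R + P *+ e1 + Q *+ e2 + T *+ e3 = X *+ 2.

Lemma oppT : - T = T.
Proof. by apply/eqP; rewrite eq_sym -addr_eq0 -mulr2n T2. Qed.

(** Since [- T = T], both sums in the parallelogram inequality are the same point. *)
Lemma h_addT x (e : bool) : (h (x + T *+ e) <= h x)%N.
Proof.
case: e; last by rewrite mulr0n addr0.
rewrite mulr1n.
by have := h_par x T; rewrite oppT hT addnn -mul2n muln0 addn0 leq_pmul2l.
Qed.

(** A change of sign alters a combination by a double only, and the parallelogram inequality bounds
    one of [h (P + Q)] and [h (P - Q)] by 8. *)
Lemma span2_small R : exists (s1 s2 : int) (e : bool) X,
  (h (P *~ s1 + Q *~ s2 + T *+ e) <= 8)%N /\
  R + (P *~ s1 + Q *~ s2 + T *+ e) = X *+ 2.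
Proof.
have [e1 [e2 [e3 [X eX]]]] := span2 R.
have key s1 s2 Y : (h (P *~ s1 + Q *~ s2) <= 8)%N ->
    P *~ s1 + Q *~ s2 = P *+ e1 + Q *+ e2 + Y *+ 2 ->
    exists (s1 s2 : int) (e : bool) X, (h (P *~ s1 + Q *~ s2 + T *+ e) <= 8)%N /\
    R + (P *~ s1 + Q *~ s2 + T *+ e) = X *+ 2.
  move=> hs eY; exists s1, s2, e3, (X + Y); split.
    exact: leq_trans (h_addT _ _) hs.
  by rewrite mulrnDl -eX eY; move: (Y *+ 2) => Z; rewrite !addrA addrAC.
have hpq := h_par P Q.
case: e1 e2 eX key => [] [] eX key.
- have [h8|h8] := leqP (h (P + Q)) 8.
    by apply: (key 1 1 0); rewrite ?mulr1z // mul0rn addr0.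
  apply: (key 1 (-1) (- Q)); rewrite ?mulrN1z ?mulr1z.
    by move: hP hQ hpq h8; move: (h (P - Q)) (h (P + Q)) => x y; lia.
  by rewrite mulNrn mulr2n opprD addrA addrK.
- by apply: (key 1 0 0); rewrite ?mulr1z ?mulr0z ?mul0rn ?addr0 //; lia.
- by apply: (key 0 1 0); rewrite ?mulr1z ?mulr0z ?mul0rn ?addr0 ?add0r //; lia.
- by apply: (key 0 0 0); rewrite ?mulr0z ?mul0rn ?addr0 // h0.
Qed.

(** From [R + S = 2 X] follows [R - S = 2 (X - S)], and one of these two points has height at most
    [h R + 8]. As doubling multiplies heights by at least 4, [X] or [X - S] is smaller than [R] once
    [h R > 8/3], in particular when [h R >= 4]. *)
Theorem descent_generation R : exists (m n : int) (e : bool),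
  R = P *~ m + Q *~ n + T *+ e.
Proof.
have [k] := ubnP (h R); elim: k R => // k IH R; rewrite ltnS => hk.
have [hs|hs] := leqP (h R) 3.
  by case: (h_small hs) => ->; [exists 0, 0, false | exists 0, 0, true];
     rewrite ?mulr0z ?add0r.
have [s1 [s2 [e [X [hS eX]]]]] := span2_small R.
set S := P *~ s1 + _ + _ in hS eX.
have eX' : R - S = (X - S) *+ 2.
  by rewrite mulrnBl -eX; apply: (addIr (S *+ 2)); rewrite subrK mulr2n addrA subrK.
have hp := h_par R S; rewrite eX eX' in hp.
have TT (b : bool) : T *+ b *+ 2 = 0 by case: b; rewrite ?mul0rn.
have TN (b : bool) : - (T *+ b) = T *+ b by case: b; rewrite ?mulr1n ?oppT ?oppr0.
have two (Y : V) (z : int) : Y *~ z *+ 2 = Y *~ (z *+ 2) by rewrite !mulr2n mulrzDr.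
have comb m n m' n' b : (P *~ m + Q *~ n) *+ 2 + (P *~ m' + Q *~ n' + T *+ b) =
    P *~ (m *+ 2 + m') + Q *~ (n *+ 2 + n') + T *+ b.
  by rewrite mulrnDl !two addrA addrACA !mulrzDr.
have [hX|hX] := leqP (h (X *+ 2)) (h R + 8).
  have hlt : (h X < k)%N by have := h_dbl X; lia.
  have [m [n [e' eXmn]]] := IH X hlt.
  exists (m *+ 2 - s1), (n *+ 2 - s2), e; apply: (addIr S); rewrite eX eXmn.
  rewrite -comb [in LHS]mulrnDl TT addr0 -addrA /S !mulrNz -{1}TN -!opprD addNr.
  by rewrite addr0.
have hlt : (h (X - S) < k)%N by have := h_dbl (X - S); lia.
have [m [n [e' eXmn]]] := IH (X - S) hlt.
exists (m *+ 2 + s1), (n *+ 2 + s2), e; rewrite -comb -/S.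
by apply: (addIr (- S)); rewrite addrK eX' eXmn [in LHS]mulrnDl TT addr0.
Qed.

End Descent.

(** * Quadratic twists with a rational 2-torsion point *)

Section Twist.
Variables (K : fieldType) (t g : K).
Local Notation tau := (3%:R * t).
Local Notation beta := (9%:R * t ^+ 2 + 5%:R).
Local Notation A := ((5%:R - 3%:R * t ^+ 2) * g ^+ 2).
Local Notation B := (2%:R * t * (t ^+ 2 + 5%:R) * g ^+ 3).
Hypothesis two0 : (2%:R : K) != 0.
Hypothesis g0 : g != 0.
Hypothesis m5 : forall s : K, s ^+ 2 != - 5%:R.
Hypothesis beta_nsq : forall s : K, s ^+ 2 != beta.

Lemma beta0 : beta != 0.
Proof. by have := beta_nsq 0; rewrite expr0n eq_sym. Qed.

(** The form [M^2 - 6 t M N + beta N^2] with the square completed, which shows that it is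
    anisotropic when -5 is not a square. *)
Definition quad (M N : K) := (M - tau * N) ^+ 2 + 5%:R * N ^+ 2.

Lemma quad_neq0 M N : (M != 0) || (N != 0) -> quad M N != 0.
Proof.
rewrite /quad; have [->|N0 _] := eqVneq N 0.
  by rewrite orbF mulr0 subr0 expr0n mulr0 addr0 sqrf_eq0.
rewrite addr_eq0; apply/eqP => e; case/eqP: (m5 ((M - tau * N) / N)).
by rewrite exprMn e exprVn; field.
Qed.

Lemma twist_smooth x : x ^+ 3 + A * x + B = 0 -> 3%:R * x ^+ 2 + A != 0.
Proof.
have -> : x ^+ 3 + A * x + B = (x + 2%:R * t * g) * quad (x + 2%:R * t * g) g.
  by rewrite /quad; ring.
move/eqP; rewrite mulf_eq0 (negPf (quad_neq0 _)) ?g0 ?orbT // orbF addr_eq0 => /eqP ->.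
have -> : 3%:R * (- (2%:R * t * g)) ^+ 2 + A = beta * g ^+ 2 by ring.
by rewrite mulf_neq0 ?beta0 // expf_neq0.
Qed.

Definition twist : smooth_curve K := SmoothCurve two0 twist_smooth.

Local Notation on := (on_curve A B).
(** The coordinate [W]: the twist is removed and the 2-torsion point is moved to 0. *)
Definition wc (x : K) := x / g + 2%:R * t.

Lemma wcE x : x = g * (wc x - 2%:R * t).
Proof. by rewrite /wc addrK mulrC divfK. Qed.

Lemma wc_inj : injective wc.
Proof. by move=> x y e; rewrite [x]wcE [y]wcE e. Qed.

Lemma on_wc x y : on (Some (x, y)) ->
  y ^+ 2 = g ^+ 3 * (wc x * quad (wc x) 1).
Proof. by move/eqP ->; rewrite /quad {1 2}[x]wcE; ring. Qed.

Lemma on_wcP w y : y ^+ 2 = g ^+ 3 * (w * quad w 1) ->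
  on (Some (g * (w - 2%:R * t), y)).
Proof. by move=> e; apply/eqP; rewrite e /quad; ring. Qed.

Definition pt_T : cpoint twist.
Proof.
exists (Some (- (2%:R * t * g), 0)); abstract (by apply/eqP; rewrite /=; ring).
Defined.

Lemma pt_y0 x : on (Some (x, 0)) -> x = - (2%:R * t * g).
Proof.
move/on_wc; rewrite expr0n /= => /esym/eqP.
rewrite mulf_eq0 (negPf (expf_neq0 3 g0)) /= mulf_eq0.
rewrite (negPf (quad_neq0 _)) ?oner_neq0 ?orbT // orbF => /eqP w0.
by rewrite [x]wcE w0; ring.
Qed.

(** The product [y1 * y2] cancels from the symmetric functions of the coordinates of sum and
    difference, which thus depend on [w1] and [w2] only. The parallelogram inequality rests on
    this. *)
Lemma chord_sum_diff x1 y1 x2 y2 l m :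
  on (Some (x1, y1)) -> on (Some (x2, y2)) -> x1 != x2 ->
  slope A x1 y1 x2 y2 l -> slope A x1 y1 x2 (- y2) m ->
  let w1 := wc x1 in let w2 := wc x2 in
  let w3 := wc (l ^+ 2 - x1 - x2) in let w4 := wc (m ^+ 2 - x1 - x2) in
  (w3 + w4) * (w1 - w2) ^+ 2 =
    2%:R * ((w1 + w2) * (w1 * w2 + beta) - 4%:R * tau * w1 * w2) /\
  w3 * w4 * (w1 - w2) ^+ 2 = (w1 * w2 - beta) ^+ 2.
Proof.
move=> o1 o2 nx sl sm w1 w2 w3 w4.
have dx : x2 - x1 != 0 by rewrite subr_eq0 eq_sym.
have el := slope_chord dx sl; have em := slope_chord dx sm.
have e1 := on_wc o1; have e2 := on_wc o2.
have nw : w2 - w1 != 0 by rewrite subr_eq0; apply: contra nx => /eqP/wc_inj ->.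
have ex : x2 - x1 = g * (w2 - w1) by rewrite [x2]wcE [x1]wcE -/w1 -/w2; ring.
have x12 : x1 + x2 = g * (w1 + w2 - 4%:R * t).
  by rewrite [x2]wcE [x1]wcE -/w1 -/w2; ring.
have E3 : w3 = (y2 - y1) ^+ 2 / (g ^+ 3 * (w2 - w1) ^+ 2) - w1 - w2 + 6%:R * t.
  rewrite /w3 {1}/wc -addrA -opprD x12 el ex; field; by rewrite g0 nw.
have E4 : w4 = (y2 + y1) ^+ 2 / (g ^+ 3 * (w2 - w1) ^+ 2) - w1 - w2 + 6%:R * t.
  rewrite /w4 {1}/wc -addrA -opprD x12 em ex; field; by rewrite g0 nw.
split.
  have -> : w3 + w4 = 2%:R * (y1 ^+ 2 + y2 ^+ 2) / (g ^+ 3 * (w2 - w1) ^+ 2)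
       - 2%:R * (w1 + w2) + 12%:R * t.
    by rewrite E3 E4; field; rewrite g0 nw.
  by rewrite e1 e2 /quad -/w1 -/w2; field; rewrite g0 nw.
pose D := g ^+ 3 * (w2 - w1) ^+ 2; pose s := 6%:R * t - w1 - w2.
have D0 : D != 0 by rewrite mulf_neq0 // expf_neq0.
have -> : w3 * w4 = (y1 ^+ 2 - y2 ^+ 2) ^+ 2 / D ^+ 2
     + s * 2%:R * (y1 ^+ 2 + y2 ^+ 2) / D + s ^+ 2.
  by rewrite E3 E4 -/D /s; field.
by rewrite e1 e2 /quad -/w1 -/w2 /D /s; field; rewrite g0 nw.
Qed.

Lemma dbl_wc x y l : on (Some (x, y)) -> y != 0 -> slope A x y x y l ->
  4%:R * wc x * quad (wc x) 1 != 0 /\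
  wc (l ^+ 2 - x - x) = (wc x ^+ 2 - beta) ^+ 2 / (4%:R * wc x * quad (wc x) 1).
Proof.
move=> o y0 s; have el := slope_tangent two0 y0 s; have e := on_wc o.
have nz : wc x * quad (wc x) 1 != 0.
  by apply: contraNneq y0 => h; rewrite -sqrf_eq0 e h mulr0.
have four0 : (4%:R : K) != 0.
  have -> : (4%:R : K) = 2%:R * 2%:R by ring.
  by rewrite mulf_neq0.
split; first by rewrite -mulrA mulf_neq0.
have el2 : l ^+ 2 = (3%:R * x ^+ 2 + A) ^+ 2 / (4%:R * y ^+ 2).
  by rewrite el; field; rewrite y0 two0 four0.
rewrite {1}/wc el2 e; move: nz; rewrite /quad; set w := wc x.
have -> : x = g * (w - 2%:R * t) by exact: wcE.
move=> nz; have [w0 q0] : w != 0 /\ (w - tau * 1) ^+ 2 + 5%:R * 1 ^+ 2 != 0.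
  by apply/andP; rewrite -negb_or -mulf_eq0.
field; rewrite g0 w0 four0 /= andbT.
by move: q0; rewrite !mulr1 expr1n mulr1.
Qed.
(** Its product with [x + 2 t g] is [y^2], so away from [T] it has the class of the usual descent
    map [x - x(T)]; unlike that map, it does not vanish at [T]. *)
Definition kappa (R : ec_point K) : K :=
  if R is Some (x, _) then quad (x + 2%:R * t * g) g else 1.

Lemma kappa_neq0 R : kappa R != 0.
Proof.
by case: R => [[x y]|]; rewrite ?oner_neq0 //= quad_neq0 // g0 orbT.
Qed.

Lemma kappa_wc x y : kappa (Some (x, y)) = g ^+ 2 * quad (wc x) 1.
Proof. by rewrite /kappa /quad {1}[x]wcE; ring. Qed.

(* The line [y = l x + m] cuts the curve [y^2 = x q(x)], where [q] is the quadratic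
   form defining [kappa], at three points whose values [q(x_i)] multiply to the square of
   the norm of [l r + m] for [r] a root of [q]. *)
Lemma kappa_line x1 y1 x2 y2 l : on (Some (x1, y1)) -> slope A x1 y1 x2 y2 l ->
  exists s, kappa (third x1 y1 x2 l) * kappa (Some (x1, y1)) * kappa (Some (x2, y2))
    = s ^+ 2.
Proof.
move=> /onE o1 s1; have [_ eA] := slopeA s1; clear s1.
pose m := y1 - l * (x1 + 2%:R * t * g).
exists (m ^+ 2 + 6%:R * t * g * l * m + beta * g ^+ 2 * l ^+ 2).
have e1 : y1 = m + l * (x1 + 2%:R * t * g) by rewrite /m; ring.
pose a1 := x1 + 2%:R * t * g; pose a2 := x2 + 2%:R * t * g.
pose a3 := l ^+ 2 - x1 - x2 + 2%:R * t * g.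
have s1 : a1 + a2 + a3 = l ^+ 2 + 6%:R * t * g by rewrite /a1 /a2 /a3; ring.
have s2 : a1 * a2 + a2 * a3 + a3 * a1 = beta * g ^+ 2 - 2%:R * l * m.
  apply/eqP; rewrite -subr_eq0; apply/eqP.
  transitivity (l * (2%:R * y1 + l * (x2 - x1)) - (x1 ^+ 2 + x1 * x2 + x2 ^+ 2) - A).
    by rewrite /a1 /a2 /a3 /m; ring.
  by rewrite -eA subrr.
have s3 : a1 * a2 * a3 = m ^+ 2.
  have : y1 ^+ 2 = a1 * (a1 ^+ 2 - 6%:R * t * g * a1 + beta * g ^+ 2).
    by rewrite o1 /a1; ring.
  rewrite e1 -/a1 => e.
  have -> : m ^+ 2 = (m + l * a1) ^+ 2 - l ^+ 2 * a1 ^+ 2 - 2%:R * l * m * a1 by ring.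
  rewrite e.
  have -> : beta * g ^+ 2 = a1 * a2 + a2 * a3 + a3 * a1 + 2%:R * l * m.
    by rewrite s2; ring.
  have -> : 6%:R * t * g = a1 + a2 + a3 - l ^+ 2 by rewrite s1; ring.
  by ring.
rewrite /kappa /third /quad -/a1 -/a2 -/a3.
have q x : (x - tau * g) ^+ 2 + 5%:R * g ^+ 2
    = x ^+ 2 - 6%:R * t * g * x + beta * g ^+ 2 by ring.
rewrite !q.
have -> : beta * g ^+ 2 = a1 * a2 + a2 * a3 + a3 * a1 + 2%:R * l * m.
  by rewrite s2; ring.
have -> : 6%:R * t * g = a1 + a2 + a3 - l ^+ 2 by rewrite s1; ring.
(* Only the relation [m ^+ 2 = a1 * a2 * a3] is left; [k], [e2] and [c] write out the cofactor of
   this relation in the difference of the two sides. *)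
pose p := a1 + a2 + a3 - l ^+ 2; pose k := p * l + 2%:R * l ^+ 3.
pose e2 := a1 * a2 + a2 * a3 + a3 * a1.
pose c := a1 ^+ 2 + a2 ^+ 2 + a3 ^+ 2 - p * (a1 + a2 + a3) + 3%:R * e2.
apply/eqP; rewrite -subr_eq0; apply/eqP.
transitivity ((m ^+ 2 - a1 * a2 * a3) * (- m ^+ 2 + (8%:R * l ^+ 3 - 2%:R * k) * m +
    (4%:R * l ^+ 2 * c - k ^+ 2 - 2%:R * e2 * l ^+ 2 - a1 * a2 * a3))).
  by rewrite /c /e2 /k /p; ring.
by rewrite s3 subrr mul0r.
Qed.

Lemma kappa_add (R S : cpoint twist) :
  exists s, kappa (val (R + S)) * kappa (val R) * kappa (val S) = s ^+ 2.
Proof.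
case: R S => [[[x1 y1]|] oR] [[[x2 y2]|] oS]; rewrite val_add /=; last 3 first.
- by exists (kappa (Some (x1, y1))); rewrite /= mulr1 expr2.
- by exists (kappa (Some (x2, y2))); rewrite /= mulr1 expr2.
- by exists 1; rewrite /= !mulr1 expr1n.
have [h|h] := boolP ((x1 == x2) && (y1 == - y2)).
  rewrite [X in kappa X * _]add_oppb //; exists (kappa (Some (x1, y1))).
  by case/andP: h => /eqP -> _; rewrite mul1r expr2.
have [l sl e] := slope_exists two0 oR oS h.
by rewrite [X in kappa X * _]e; apply: kappa_line oR sl.
Qed.

(* The two successive 2-isogenies are inverted by the two square roots [S] and [s]. *)
Lemma halving (x y S s : K) : on (Some (x, y)) -> y != 0 ->
  quad (wc x) 1 = S ^+ 2 -> wc x * (2%:R * wc x - 2%:R * tau + 2%:R * S) = s ^+ 2 ->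
  exists x2 y2 l, [/\ on (Some (x2, y2)), y2 != 0, slope A x2 y2 x2 y2 l &
    l ^+ 2 - x2 - x2 = x].
Proof.
move=> o y0 eS es; have e := on_wc o; move: es; set w := wc x in e eS *.
set X := 2%:R * w - _ + _ => es.
have w0 : w != 0 by apply: contraNneq y0 => h; rewrite -sqrf_eq0 e h mul0r mulr0.
have S0 : S != 0 by apply: contraNneq y0 => h; rewrite -sqrf_eq0 e eS h expr0n !mulr0.
have wS : (w + S) ^+ 2 = s ^+ 2 + beta.
  rewrite -es /X; transitivity (w ^+ 2 + 2%:R * w * S + quad w 1); first by rewrite eS; ring.
  by rewrite /quad; ring.
(* [v] is a root of [z^2 - 2 (w + S) z + beta], with conjugate [w + S - s]. Hence
   [v^2 - beta = 2 v s], and the doubling formula at [v] yields [s^2 / X = w]. *)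
pose v := w + S + s.
have vv : v * (w + S - s) = beta.
  by transitivity ((w + S) ^+ 2 - s ^+ 2); [rewrite /v; ring | rewrite wS; ring].
have v0 : v != 0 by apply: contraNneq beta0 => h; rewrite -vv h mul0r.
have q2 : quad v 1 = v * X.
  transitivity (v ^+ 2 - 2%:R * tau * v + v * (w + S - s)).
    by rewrite vv /quad; ring.
  by rewrite /X /v; ring.
have X0 : X != 0.
  have := @quad_neq0 v 1; rewrite oner_neq0 orbT => /(_ isT).
  by rewrite q2 mulf_eq0 negb_or => /andP [].
have s0 : s != 0 by rewrite -sqrf_eq0 -es mulf_neq0.
(* The ordinate must be a square root of [g^3 v^2 X]; it is found from [X = s^2 / w] and
   [y^2 = g^3 w S^2]. *)
pose x2 := g * (v - 2%:R * t); pose y2 := g ^+ 3 * v * s * S / y.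
have y20 : y2 != 0 by rewrite /y2 !mulf_neq0 ?invr_neq0 ?expf_neq0.
have o2 : on (Some (x2, y2)).
  apply: on_wcP; rewrite q2 /y2 exprMn exprVn e eS.
  have -> : X = s ^+ 2 / w by rewrite -es; field.
  by field; rewrite g0 w0 S0.
have wx2 : wc x2 = v by rewrite /x2 /wc; field.
have h2 : ~~ ((x2 == x2) && (y2 == - y2)).
  rewrite eqxx /=; apply: contraNneq y20 => /(opp_eq0 two0) //.
  by move=> ->.
have [l sl _] := slope_exists two0 o2 o2 h2.
exists x2, y2, l; split=> //; apply: wc_inj.
have [_ ->] := dbl_wc o2 y20 sl; rewrite wx2 -/w q2.
have -> : v ^+ 2 - beta = 2%:R * v * s by rewrite -vv /v; ring.
have -> : w = s ^+ 2 / X by rewrite -es; field.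
have four0 : (4%:R : K) != 0.
  have -> : (4%:R : K) = 2%:R * 2%:R by ring.
  by rewrite mulf_neq0.
by field; rewrite v0 X0 four0.
Qed.
End Twist.

(** * Heights of rational functions *)

Section FracExists.
Local Open Scope quotient_scope.

(** The quotient construction is opened here once. What follows uses only this presentation and the
    injectivity of the embedding. *)
Lemma frac_exists (k : fieldType) (w : {fraction {poly k}}) : exists M N : {poly k},
  N != 0 /\ w = FracField.tofrac M / FracField.tofrac N.
Proof.
elim/quotW: w => r; exists \n_r, \d_r; have d0 := denom_ratioP r; split=> //.
apply: (mulIf (_ : FracField.tofrac (\d_r) != 0)); first by rewrite tofrac_eq0.
rewrite divfK ?tofrac_eq0 //.
rewrite -[_ * _]/(FracField.mul _ _) !piE.
apply/eqmodP => /=.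
rewrite /FracField.equivf /FracField.mulf !numden_Ratio ?mulf_neq0 ?oner_neq0 //.
by rewrite !mulr1 mulrC.
Qed.
End FracExists.

Lemma maxn_eqS (a b n : nat) : n.+1 = maxn a b -> a != n.+1 -> b = n.+1.
Proof. by lia. Qed.

Lemma leqS_neq (a n : nat) : (a <= n.+1)%N -> a != n.+1 -> (a <= n)%N.
Proof. by lia. Qed.

Section RationalFunctions.
Variables (k F : fieldType) (f : {rmorphism {poly k} -> F}).
Local Notation pk := {poly k}.
Local Notation "p %:F" := (f p).
Hypothesis f_inj : injective f.
Hypothesis f_frac : forall w, exists M N : pk, N != 0 /\ w = M%:F / N%:F.

Lemma f_eq0 p : (p%:F == 0) = (p == 0).
Proof. by rewrite -(inj_eq f_inj) rmorph0. Qed.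

Lemma frac_lowest (w : F) : exists MN : pk * pk,
  [&& coprimep MN.1 MN.2, MN.2 != 0 & w == MN.1%:F / MN.2%:F].
Proof.
have [M [N [N0 ->]]] := f_frac w; pose d := gcdp M N.
have d0 : d != 0 by rewrite gcdp_eq0 negb_and N0 orbT.
have eM : M = M %/ d * d by rewrite divpK // dvdp_gcdl.
have eN : N = N %/ d * d by rewrite divpK // dvdp_gcdr.
exists (M %/ d, N %/ d); rewrite /= coprimep_div_gcd ?N0 ?orbT //=.
have Nd0 : N %/ d != 0 by apply: contraNneq N0 => h; rewrite eN h mul0r.
by rewrite Nd0 /= {1}eM {1}eN !rmorphM -mulf_div divff ?mulr1 ?f_eq0.
Qed.

Definition fnum (w : F) : pk := (xchoose (frac_lowest w)).1.
Definition fden (w : F) : pk := (xchoose (frac_lowest w)).2.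

Lemma fden_neq0 w : fden w != 0.
Proof. by case/and3P: (xchooseP (frac_lowest w)). Qed.
Lemma coprime_fnum_fden w : coprimep (fnum w) (fden w).
Proof. by case/and3P: (xchooseP (frac_lowest w)). Qed.
Lemma frac_num_den w : w = (fnum w)%:F / (fden w)%:F.
Proof. by case/and3P: (xchooseP (frac_lowest w)) => _ _ /eqP. Qed.

Lemma frac_eqP (M N M' N' : pk) : N != 0 -> N' != 0 ->
  M%:F / N%:F = M'%:F / N'%:F -> M * N' = M' * N.
Proof.
move=> N0 N0' /eqP e; apply/eqP; rewrite -(inj_eq f_inj) !rmorphM -eqr_div //;
  by rewrite f_eq0.
Qed.

Lemma lowest_unique w (M N : pk) : N != 0 -> w = M%:F / N%:F ->
  exists2 c : pk, c != 0 & M = c * fnum w /\ N = c * fden w.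
Proof.
move=> N0; rewrite {1}[w]frac_num_den => /(frac_eqP (fden_neq0 w) N0) e.
have : fden w %| N.
  rewrite -(Gauss_dvdpr _ (_ : coprimep (fden w) (fnum w))).
    by rewrite e dvdp_mull.
  by rewrite coprimep_sym coprime_fnum_fden.
case/dvdpP => c ec; exists c; first by apply: contraNneq N0 => h; rewrite ec h mul0r.
split=> //; apply: (mulIf (fden_neq0 w)); rewrite -e ec; ring.
Qed.

(** The degree of [w] as a self-map of the projective line; sizes exceed degrees by one. *)
Definition hq (w : F) : nat := (maxn (size (fnum w)) (size (fden w))).-1.

Lemma hqE w : (hq w).+1 = maxn (size (fnum w)) (size (fden w)).
Proof.
rewrite /hq prednK // leq_max [X in _ || X]lt0n size_poly_eq0 fden_neq0 orbT //.
Qed.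

Lemma hq_le w (M N : pk) n : N != 0 -> w = M%:F / N%:F ->
  (size M <= n.+1)%N -> (size N <= n.+1)%N -> (hq w <= n)%N.
Proof.
move=> N0 e sM sN; have [c c0 [eM eN]] := lowest_unique N0 e.
have mono (q : pk) : (size q <= size (c * q)%R)%N.
  have [->|q0] := eqVneq q 0; first by rewrite size_poly0.
  rewrite size_mul //; move: c0; rewrite -size_poly_eq0 => c0.
  by move: c0; case: (size c) => // m _; rewrite addSn /= leq_addl.
rewrite -ltnS hqE geq_max (leq_trans (mono _)) -?eM ?(leq_trans sM) //=.
by rewrite (leq_trans (mono _)) -?eN.
Qed.

Lemma hq_lowest w (M N : pk) : coprimep M N -> N != 0 -> w = M%:F / N%:F ->
  (hq w).+1 = maxn (size M) (size N).
Proof.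
move=> co N0 e; have [c c0 [eM eN]] := lowest_unique N0 e.
have c1 : size c = 1%N.
  apply/eqP; rewrite size_poly_eq1; move/coprimepP: co; apply.
    by rewrite eM dvdp_mulr.
  by rewrite eN dvdp_mulr.
have sz (q : pk) : size (c * q) = size q.
  by case/size_poly1P: (introT eqP c1) => a a0 ->; rewrite mul_polyC size_scale.
by rewrite hqE eM eN !sz.
Qed.

Lemma size_mulS (p q : pk) m n : (size p <= m.+1)%N -> (size q <= n.+1)%N ->
  (size (p * q)%R <= (m + n).+1)%N.
Proof.
move=> sp sq; apply: leq_trans (size_polyMleq _ _) _.
have : (size p + size q <= m.+1 + n.+1)%N by apply: leq_add.
by rewrite addSn addnS; case: (size p + size q)%N.
Qed.

Lemma size_addS (p q : pk) m : (size p <= m.+1)%N -> (size q <= m.+1)%N ->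
  (size (p + q)%R <= m.+1)%N.
Proof. by move=> sp sq; apply: leq_trans (size_polyD _ _) _; rewrite geq_max sp sq. Qed.

(** Gauss's lemma: the coefficients [q3 q4], [p3 q4 + p4 q3], [p3 p4] of a product of two primitive
    linear forms have no common factor, so [F0], [F1], [F2] are a common multiple of them. It
    remains to see that the largest of their degrees is the sum of the two heights. *)
Lemma hq_sum_prod w3 w4 (F0 F1 F2 : pk) D : F0 != 0 ->
  w3 + w4 = F1%:F / F0%:F -> w3 * w4 = F2%:F / F0%:F ->
  (size F0 <= D.+1)%N -> (size F1 <= D.+1)%N -> (size F2 <= D.+1)%N ->
  (hq w3 + hq w4 <= D)%N.
Proof.
move=> F00 es ep s0 s1 s2.
have := frac_num_den w3; have := frac_num_den w4.
have := hqE w3; have := hqE w4.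
have := fden_neq0 w3; have := fden_neq0 w4.
have := coprime_fnum_fden w3; have := coprime_fnum_fden w4.
move: (fnum w3) (fnum w4) (fden w3) (fden w4) (hq w3) (hq w4)
  => p3 p4 q3 q4 n3 n4 co4 co3 q40 q30 h4 h3 e4 e3.
have f3 : q3%:F != 0 by rewrite f_eq0.
have f4 : q4%:F != 0 by rewrite f_eq0.
have e1 : (p3 * q4 + p4 * q3) * F0 = F1 * (q3 * q4).
  by apply: frac_eqP; rewrite ?mulf_neq0 // -es e3 e4 rmorphD !rmorphM addf_div.
have e2 : (p3 * p4) * F0 = F2 * (q3 * q4).
  by apply: frac_eqP; rewrite ?mulf_neq0 // -ep e3 e4 !rmorphM mulf_div.
have cop (p p' q q' : pk) : coprimep p q -> coprimep p' q' ->
    coprimep q (gcdp (p * q' + p' * q) (p * p')).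
  move=> c c'; apply/coprimepP => d dq; rewrite dvdp_gcd => /andP [ds dp].
  have cdp : coprimep d p by apply: coprimep_dvdr dq _ ; rewrite coprimep_sym.
  have dp' : d %| p' by rewrite -(Gauss_dvdpr _ cdp).
  have dq' : d %| q'.
    rewrite -(Gauss_dvdpr _ cdp).
    by rewrite -(dvdp_addl _ (_ : d %| p' * q)) // dvdp_mull.
  by move/coprimepP: c'; apply.
have cq : coprimep (q3 * q4) (gcdp (p3 * q4 + p4 * q3) (p3 * p4)).
  rewrite coprimepMl cop //= addrC [p3 * p4]mulrC; exact: cop.
have /dvdpP [c ec] : q3 * q4 %| F0.
  rewrite -(Gauss_dvdpr _ cq) (eqp_dvdr _ (mulp_gcdl _ _ _)) dvdp_gcd e1 e2.
  by rewrite !dvdp_mulIr.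
have c0 : c != 0 by apply: contraNneq F00 => h; rewrite ec h mul0r.
have q340 : q3 * q4 != 0 by rewrite mulf_neq0.
have E1 : F1 = c * (p3 * q4 + p4 * q3) by apply: (mulIf q340); rewrite -e1 ec; ring.
have E2 : F2 = c * (p3 * p4) by apply: (mulIf q340); rewrite -e2 ec; ring.
have mono (q : pk) : (size q <= size (c * q)%R)%N.
  have [->|q0] := eqVneq q 0; first by rewrite size_poly0.
  rewrite size_mul //; move: c0; rewrite -size_poly_eq0.
  by case: (size c) => // m _; rewrite addSn /= leq_addl.
have {}s0 : (size (q3 * q4)%R <= D.+1)%N by apply: leq_trans (mono _) _; rewrite -ec.
have {}s1 : (size (p3 * q4 + p4 * q3)%R <= D.+1)%N by apply: leq_trans (mono _) _; rewrite -E1.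
have {}s2 : (size (p3 * p4)%R <= D.+1)%N by apply: leq_trans (mono _) _; rewrite -E2.
have szM (p q : pk) m n : size p = m.+1 -> size q = n.+1 -> size (p * q) = (m + n).+1.
  move=> ep' eq'; rewrite size_mul -?size_poly_eq0 ?ep' ?eq' //.
  by rewrite addSn addnS.
have szm (p q : pk) m n : (size p <= m)%N -> (size q <= n)%N -> (size (p * q)%R <= m + n)%N.
  move=> ep' eq'; apply: leq_trans (size_polyMleq _ _) _.
  by apply: leq_trans (leq_pred _) _; apply: leq_add.
have [a3 a4 b3 b4] : [/\ (size p3 <= n3.+1)%N, (size p4 <= n4.+1)%N,
    (size q3 <= n3.+1)%N & (size q4 <= n4.+1)%N].
  by rewrite h3 h4 !leq_max !leqnn !orbT.
(* This is Gauss's lemma at infinity: either an outer coefficient attains degree [n3 + n4], or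
   exactly one of the two terms of the middle one does and cannot cancel. *)
case: (eqVneq (size p3) n3.+1) => [E3|N3]; case: (eqVneq (size p4) n4.+1) => [E4|N4].
- by move: s2; rewrite (szM _ _ _ _ E3 E4).
- have E4' := maxn_eqS h4 N4.
  case: (eqVneq (size q3) n3.+1) => [E3'|N3'].
    by move: s0; rewrite (szM _ _ _ _ E3' E4').
  move: s1; rewrite size_polyDl ?(szM _ _ _ _ E3 E4') //.
  have l4 := leqS_neq a4 N4.
  have l3 := leqS_neq b3 N3'.
  by rewrite ltnS addnC; apply: szm.
- have E3' := maxn_eqS h3 N3.
  case: (eqVneq (size q4) n4.+1) => [E4'|N4'].
    by move: s0; rewrite (szM _ _ _ _ E3' E4').
  move: s1; rewrite addrC size_polyDl ?(szM _ _ _ _ E4 E3') ?[(n4 + _)%N]addnC //.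
  have l4 := leqS_neq b4 N4'.
  have l3 := leqS_neq a3 N3.
  by rewrite ltnS; apply: szm.
- have E3' := maxn_eqS h3 N3.
  have E4' := maxn_eqS h4 N4.
  by move: s0; rewrite (szM _ _ _ _ E3' E4').
Qed.
End RationalFunctions.

Lemma maxn_top (M N : pQ) n : maxn (size M) (size N) = n.+1 ->
  (M`_n != 0) || (N`_n != 0).
Proof.
move=> sn; rewrite -negb_and; apply/negP => /andP [/eqP m0 /eqP n0].
have shr (p : pQ) : (size p <= n.+1)%N -> p`_n = 0 -> (size p <= n)%N.
  move=> sp p0; rewrite leqNgt; apply/negP => lt.
  have ep : size p = n.+1 by apply/eqP; rewrite eqn_leq sp lt.
  have : lead_coef p = 0 by rewrite lead_coefE ep.
  by move/eqP; rewrite lead_coef_eq0 => /eqP p00; move: ep; rewrite p00 size_poly0.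
have : (maxn (size M) (size N) <= n)%N.
  by rewrite geq_max !shr // -sn ?leq_maxl ?leq_maxr.
by rewrite sn ltnn.
Qed.

(** * The height on the twisted curve over Q(u) *)

Section TwistQu.
Variables (F : fieldType) (f : {rmorphism {poly rat} -> F}).
Local Notation "p %:F" := (f p).
Hypothesis f_inj : injective f.
Hypothesis f_frac : forall w, exists M N : pQ, N != 0 /\ w = M%:F / N%:F.
Local Notation fnum := (fnum f_inj f_frac).
Local Notation fden := (fden f_inj f_frac).
Local Notation hq := (hq f_inj f_frac).

(** Q[u] is integrally closed: the denominator of [s] divides the square of a numerator prime to it,
    so it is constant. *)
Lemma frac_sqr_poly (s : F) (p : pQ) : s ^+ 2 = p%:F -> exists V, p = V ^+ 2.
Proof.
move=> e; have co := coprime_fnum_fden f_inj f_frac s; have d0 := fden_neq0 f_inj f_frac s.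
have e2 : fnum s ^+ 2 = p * fden s ^+ 2.
  rewrite -[LHS]mulr1; apply: (frac_eqP f_inj (expf_neq0 2 d0) (oner_neq0 _)).
  by rewrite rmorph1 divr1 !rmorphXn -expr_div_n -(frac_num_den f_inj f_frac s).
have : fden s %| fnum s ^+ 2 by rewrite e2 expr2 mulrA dvdp_mull.
have c2 : coprimep (fden s) (fnum s ^+ 2).
  by rewrite coprimep_expr // coprimep_sym.
move=> dv; have : size (fden s) == 1%N.
  rewrite size_poly_eq1; move/coprimepP: c2; apply; rewrite ?dvdpp //.
case/size_poly1P => c c0 ec; exists (c^-1 *: fnum s).
rewrite exprZn e2 ec -polyC_exp [p * _]mulrC mul_polyC scalerA -exprMn mulVf //.
by rewrite expr1n scale1r.
Qed.

Lemma frac_sqr_const (s : F) (c : rat) : s ^+ 2 = (c%:P)%:F -> exists r, c = r ^+ 2.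
Proof.
case/frac_sqr_poly => V e; exists (lead_coef V).
by rewrite -lead_coef_exp -e lead_coefC.
Qed.

Lemma coefM_top (p q : pQ) m n : (size p <= m.+1)%N -> (size q <= n.+1)%N ->
  (p * q)`_(m + n) = p`_m * q`_n.
Proof.
move=> sp sq; rewrite coefM.
have lt : (m < (m + n).+1)%N by rewrite ltnS leq_addr.
rewrite (bigD1 (Ordinal lt)) //= addKn big1 ?addr0 // => i ne.
case: (ltngtP i m) => [lim|lmi|eim].
- by rewrite [q`_ _]nth_default ?mulr0 //; apply: leq_trans sq _; lia.
- by rewrite nth_default ?mul0r //; apply: leq_trans sp _.
- by case/eqP: ne; apply: val_inj.
Qed.

Variables (t : rat) (G : pQ).
Hypothesis G0 : G != 0.
Local Notation tau := (3%:R * t).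
Local Notation beta := (9%:R * t ^+ 2 + 5%:R).
Hypothesis beta_nsq : forall s : rat, s ^+ 2 != beta.

Definition twist_t : F := (t%:P)%:F.
Definition twist_g : F := G%:F.

Lemma betaK : 9%:R * twist_t ^+ 2 + 5%:R = (beta%:P)%:F.
Proof. by rewrite /twist_t; ring. Qed.

Fact twoK : (2%:R : F) != 0.
Proof. by rewrite -(rmorph_nat f) (f_eq0 f_inj) -(rmorph_nat (@polyC rat)) polyC_eq0. Qed.
Fact gK0 : twist_g != 0.
Proof. by rewrite (f_eq0 f_inj). Qed.
Fact m5K (s : F) : s ^+ 2 != - 5%:R.
Proof.
apply/eqP => e; have [r] : exists r, (- 5%:R : rat) = r ^+ 2.
  by apply: (@frac_sqr_const s); rewrite e; ring.
by have := sqr_ge0 r; lra.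
Qed.
Fact beta_nsqK (s : F) : s ^+ 2 != 9%:R * twist_t ^+ 2 + 5%:R.
Proof.
by apply/eqP; rewrite betaK => /frac_sqr_const [r] /esym/eqP; apply/negP/beta_nsq.
Qed.

Definition EK : smooth_curve F := twist twoK gK0 m5K beta_nsqK.

Local Notation wc := (wc twist_t twist_g).

(** The point at infinity corresponds to the constant map [W = 1 / 0], hence has height 0. *)
Definition ph (R : cpoint EK) : nat := if val R is Some (x, _) then hq (wc x) else 0.

(** The coefficients of degree [n] in [M] and [N] do not both vanish, so an anisotropic form does
    not vanish on them and no leading term is lost. *)
Lemma form_top (a b c : rat) (M N : pQ) n :
  maxn (size M) (size N) = n.+1 ->
  (forall x y : rat, (x != 0) || (y != 0) -> a * x ^+ 2 + b * (x * y) + c * y ^+ 2 != 0) ->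
  let Fm : pQ := a%:P * M ^+ 2 + b%:P * (M * N) + c%:P * N ^+ 2 in
  size Fm = (n + n).+1 /\ lead_coef Fm = a * M`_n ^+ 2 + b * (M`_n * N`_n) + c * N`_n ^+ 2.
Proof.
move=> sn pos Fm.
have sM : (size M <= n.+1)%N by rewrite -sn leq_maxl.
have sN : (size N <= n.+1)%N by rewrite -sn leq_maxr.
have cF : Fm`_(n + n) = a * M`_n ^+ 2 + b * (M`_n * N`_n) + c * N`_n ^+ 2.
  by rewrite /Fm !coefD !coefCM !expr2 !coefM_top.
have szc (x : rat) (p : pQ) : (size p <= (n + n).+1)%N -> (size (x%:P * p)%R <= (n + n).+1)%N.
  by rewrite mul_polyC => h; apply: leq_trans (size_scale_leq _ _) h.
have sF : (size Fm <= (n + n).+1)%N.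
  by rewrite /Fm; do ?[apply: size_addS]; apply: szc; rewrite ?expr2 size_mulS.
have cF0 : Fm`_(n + n) != 0.
  by rewrite cF; apply: pos; apply: maxn_top.
have e : size Fm = (n + n).+1.
  apply/eqP; rewrite eqn_leq sF ltnNge; apply/negP => h.
  by case/eqP: cF0; apply: nth_default.
by rewrite e lead_coefE e.
Qed.

(** For [W = M / N], doubling leads to [Bpol^2 / (4 M N Apol)], with [Apol] the polynomial version
    of [quad]. Both forms are anisotropic over Q: [Apol] is positive definite, and for [Bpol] this
    says that [beta] is not a square. *)
Definition Apol (M N : pQ) : pQ := (M - tau%:P * N) ^+ 2 + 5%:R * N ^+ 2.
Definition Bpol (M N : pQ) : pQ := M ^+ 2 - beta%:P * N ^+ 2.

Lemma Bpol_size (M N : pQ) n : maxn (size M) (size N) = n.+1 -> size (Bpol M N) = (n + n).+1.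
Proof.
move=> sn; have [|s _] := @form_top 1 0 (- beta) M N n sn.
  move=> x y; have [->|y0 _] := eqVneq y 0.
    by rewrite orbF mul1r mul0r expr0n mulr0 !addr0 sqrf_eq0.
  have := beta_nsq (x / y); apply: contraNneq => e.
  have -> : (x / y) ^+ 2 = beta + (1 * x ^+ 2 + 0 * (x * y) + - beta * y ^+ 2) / y ^+ 2.
    by field.
  by rewrite e mul0r addr0.
by rewrite -s; congr (size (polyseq _)); rewrite /Bpol; ring.
Qed.

Lemma Apol_size (M N : pQ) n : maxn (size M) (size N) = n.+1 ->
  size (Apol M N) = (n + n).+1 /\ 0 < lead_coef (Apol M N).
Proof.
have -> : Apol M N = 1%:P * M ^+ 2 + (- 2%:R * tau)%:P * (M * N) + beta%:P * N ^+ 2.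
  by rewrite /Apol; ring.
have pos x y : (x != 0) || (y != 0) ->
    0 < 1 * x ^+ 2 + (- 2%:R * tau) * (x * y) + beta * y ^+ 2.
  have -> : 1 * x ^+ 2 + (- 2%:R * tau) * (x * y) + beta * y ^+ 2
     = (x - tau * y) ^+ 2 + 5%:R * y ^+ 2 by ring.
  have [->|y0 _] := eqVneq y 0.
    have -> : (x - tau * 0) ^+ 2 + 5%:R * 0 ^+ 2 = x ^+ 2 by ring.
    by rewrite orbF => x0; rewrite exprn_even_gt0.
  by apply: ltr_wpDl; rewrite ?sqr_ge0 // mulr_gt0 // exprn_even_gt0.
move=> sn; have [|s lc] := @form_top 1 (- 2%:R * tau) beta M N n sn.
  by move=> x y /pos h; apply: lt0r_neq0.
by rewrite s lc; split=> //; apply: pos; apply: maxn_top.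
Qed.

Lemma size_constM (c : rat) (p : pQ) : c != 0 -> size (c%:P * p) = size p.
Proof. by move=> c0; rewrite mul_polyC size_scale. Qed.

Lemma coprimep_of_dvd (p q : pQ) :
  (forall d, d %| p -> d %| q -> size d = 1%N) -> coprimep p q.
Proof.
by move=> H; apply/coprimepP => d dp dq; rewrite -size_poly_eq1 (H d dp dq).
Qed.

Lemma coprimep_dvd_unit (d p : pQ) : coprimep d p -> d %| p -> size d = 1%N.
Proof. by move=> co dp; apply/eqP; rewrite size_poly_eq1; move/coprimepP: co; apply. Qed.

Lemma beta_neq0 : beta != 0.
Proof. by apply: contraNneq (beta_nsq 0) => ->; rewrite expr0n. Qed.

Lemma dvdp_constM (c : rat) (d p : pQ) : c != 0 -> (d %| c%:P * p) = (d %| p).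
Proof. by move=> c0; rewrite mul_polyC dvdpZr. Qed.

Lemma Apol_coprime_M M N : coprimep M N -> coprimep M (Apol M N).
Proof.
move=> co; apply: coprimep_of_dvd => d dM dA.
apply: (@coprimep_dvd_unit _ (N ^+ 2)).
  by apply: coprimep_dvdr dM _; apply: coprimep_expr.
rewrite -(dvdp_constM _ _ beta_neq0).
have -> : beta%:P * N ^+ 2 = Apol M N - M * (M - 2%:R%:P * tau%:P * N).
  by rewrite /Apol; ring.
by rewrite dvdp_sub // dvdp_mulr.
Qed.

Lemma Apol_coprime_N M N : coprimep M N -> coprimep N (Apol M N).
Proof.
move=> co; apply: coprimep_of_dvd => d dN dA.
apply: (@coprimep_dvd_unit _ (M ^+ 2)).
  by apply: coprimep_dvdr dN _; apply: coprimep_expr; rewrite coprimep_sym.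
have -> : M ^+ 2 = Apol M N - N * (- 2%:R%:P * tau%:P * M + beta%:P * N).
  by rewrite /Apol; ring.
by rewrite dvdp_sub // dvdp_mulr.
Qed.

Lemma Bpol_coprime_M M N : coprimep M N -> coprimep M (Bpol M N).
Proof.
move=> co; apply: coprimep_of_dvd => d dM dA.
apply: (@coprimep_dvd_unit _ (N ^+ 2)).
  by apply: coprimep_dvdr dM _; apply: coprimep_expr.
rewrite -(dvdp_constM _ _ beta_neq0).
have -> : beta%:P * N ^+ 2 = M * M - Bpol M N by rewrite /Bpol; ring.
by rewrite dvdp_sub // dvdp_mulr.
Qed.

Lemma Bpol_coprime_N M N : coprimep M N -> coprimep N (Bpol M N).
Proof.
move=> co; apply: coprimep_of_dvd => d dN dA.
apply: (@coprimep_dvd_unit _ (M ^+ 2)).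
  by apply: coprimep_dvdr dN _; apply: coprimep_expr; rewrite coprimep_sym.
have -> : M ^+ 2 = Bpol M N + N * (beta%:P * N) by rewrite /Bpol; ring.
by rewrite dvdp_add // dvdp_mulr.
Qed.

(** A common divisor is prime to [M] and [N]. The sum of the two forms is [2 M (M - tau N)], so it
    divides [M - tau N] and then [5 N^2]. *)
Lemma Bpol_coprime_A M N : coprimep M N -> coprimep (Apol M N) (Bpol M N).
Proof.
move=> co; apply: coprimep_of_dvd => d dA dB.
have cM : coprimep d M by apply: coprimep_dvdr dA _; rewrite coprimep_sym Apol_coprime_M.
have cN : coprimep d N by apply: coprimep_dvdr dA _; rewrite coprimep_sym Apol_coprime_N.
have : d %| M * (2%:R%:P * (M - tau%:P * N)).
  have -> : M * (2%:R%:P * (M - tau%:P * N)) = Apol M N + Bpol M N.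
    by rewrite /Apol /Bpol; ring.
  by rewrite dvdp_add.
rewrite Gauss_dvdpr // dvdp_constM // => d2.
apply: (@coprimep_dvd_unit _ (N ^+ 2)); first exact: coprimep_expr.
rewrite -(@dvdp_constM 5%:R) //.
have -> : 5%:R%:P * N ^+ 2 = Apol M N - (M - tau%:P * N) * (M - tau%:P * N).
  by rewrite /Apol; ring.
by rewrite dvdp_sub // dvdp_mulr.
Qed.

Lemma Bpol_coprime M N : coprimep M N ->
  coprimep (Bpol M N ^+ 2) (4%:R%:P * (M * (N * Apol M N))).
Proof.
move=> co; apply: coprimep_expl; rewrite coprimep_sym mul_polyC coprimepZl //.
by rewrite !coprimepMl Bpol_coprime_M ?Bpol_coprime_N ?Bpol_coprime_A.
Qed.

Local Notation T := (pt_T twoK gK0 m5K beta_nsqK : cpoint EK).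

Lemma ph0 : ph 0 = 0%N.
Proof. by []. Qed.

Lemma hq0 : hq 0 = 0%N.
Proof.
apply/eqP; rewrite -leqn0; apply: (@hq_le _ _ _ f_inj f_frac _ 0 1).
- exact: oner_neq0.
- by rewrite rmorph0 mul0r.
- by rewrite size_poly0.
- by rewrite size_poly1.
Qed.

Lemma phT : ph T = 0%N.
Proof.
rewrite /ph /=; suff -> : wc (- (2%:R * twist_t * twist_g)) = 0 by exact: hq0.
by rewrite /wc mulNr mulfK ?gK0 // addNr.
Qed.

Lemma phN R : ph (- R) = ph R.
Proof. by case: R => [[[x y]|] o]. Qed.

Lemma w_lowest w : exists (M N : pQ) n, [/\ coprimep M N, N != 0, w = M%:F / N%:F,
  maxn (size M) (size N) = n.+1 & hq w = n].
Proof.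
exists (fnum w), (fden w), (hq w); split=> //.
- exact: coprime_fnum_fden.
- exact: fden_neq0.
- exact: frac_num_den.
- by rewrite -hqE.
Qed.

Local Notation A := ((5%:R - 3%:R * twist_t ^+ 2) * twist_g ^+ 2).
Local Notation B := (2%:R * twist_t * (twist_t ^+ 2 + 5%:R) * twist_g ^+ 3).

Lemma AMF M N : quad twist_t M%:F N%:F = (Apol M N)%:F.
Proof. by rewrite /quad /Apol /twist_t; ring. Qed.

Lemma quad_div M N : N != 0 -> quad twist_t (M%:F / N%:F) 1 = (Apol M N)%:F / N%:F ^+ 2.
Proof.
move=> N0; have fN : N%:F != 0 by rewrite (f_eq0 f_inj).
by rewrite -AMF /quad; field.
Qed.

Lemma dbl_frac x y l : on_curve A B (Some (x, y)) -> y != 0 -> slope A x y x y l ->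
  exists (M N : pQ) n, [/\ hq (wc x) = n, maxn (size M) (size N) = n.+1, coprimep M N,
    4%:R%:P * (M * (N * Apol M N)) != 0 &
    wc (l ^+ 2 - x - x) = (Bpol M N ^+ 2)%:F / (4%:R%:P * (M * (N * Apol M N)))%:F].
Proof.
move=> o y0 s; have [nz e] := dbl_wc twoK gK0 o y0 s.
have [M [N [n [co N0 ew sn hn]]]] := w_lowest (wc x).
have fN : N%:F != 0 by rewrite (f_eq0 f_inj).
exists M, N, n.
have ed : (4%:R%:P * (M * (N * Apol M N)))%:F = N%:F ^+ 4 * (4%:R * wc x * quad twist_t (wc x) 1).
  rewrite ew quad_div //.
  have -> : (4%:R%:P * (M * (N * Apol M N)))%:F = 4%:R * (M%:F * (N%:F * (Apol M N)%:F)).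
    by ring.
  by field.
split=> //; first by rewrite -(f_eq0 f_inj) ed mulf_neq0 // expf_neq0.
rewrite e ed betaK.
have -> : (Bpol M N ^+ 2)%:F = N%:F ^+ 4 * (wc x ^+ 2 - (beta%:P)%:F) ^+ 2.
  rewrite ew /Bpol.
  have -> : ((M ^+ 2 - beta%:P * N ^+ 2) ^+ 2)%:F
     = (M%:F ^+ 2 - (beta%:P)%:F * N%:F ^+ 2) ^+ 2 by ring.
  by field.
move: nz; set z := 4%:R * _ * _ => nz.
by field; rewrite fN nz.
Qed.

Lemma val_dbl (R : cpoint EK) x y : val R = Some (x, y) -> y != 0 ->
  exists2 l, slope A x y x y l & val (R *+ 2) = third x y x l.
Proof.
case: R => [P o] /= e y0; subst P.
have h : ~~ ((x == x) && (y == - y)).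
  by rewrite eqxx /=; apply: contraNneq y0 => /(opp_eq0 twoK) ->.
have [l sl el] := slope_exists twoK o o h; exists l => //.
Qed.

Lemma y0_torsion (R : cpoint EK) x : val R = Some (x, 0) -> R = T.
Proof.
case: R => [P o] /= e; subst P; apply: val_inj => /=.
by rewrite (pt_y0 gK0 m5K o).
Qed.

Lemma T_dbl : T *+ 2 = 0.
Proof.
rewrite mulr2n; apply: val_inj; rewrite val_add /=.
by rewrite eqxx oppr0 eqxx.
Qed.

Lemma ph_dbl_le (R : cpoint EK) : (ph (R *+ 2)%R <= 4 * ph R)%N.
Proof.
case eR : (val R) => [[x y]|]; last first.
  have -> : R = 0 by apply: val_inj.
  by rewrite mul0rn ph0.
have [y0|y0] := eqVneq y 0.
  by rewrite y0 in eR; rewrite (y0_torsion eR) T_dbl ph0.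
have [l sl el] := val_dbl eR y0.
have o := valP R; rewrite eR in o.
have [M [N [n [hn sn co nz e]]]] := dbl_frac o y0 sl.
rewrite /ph eR el /third hn.
have sM : (size M <= n.+1)%N by rewrite -sn leq_maxl.
have sN : (size N <= n.+1)%N by rewrite -sn leq_maxr.
apply: (hq_le f_inj f_frac nz e); last first.
  rewrite size_constM //.
  have -> : (4 * n = n + (n + (n + n)))%N by lia.
  by do 2![apply: size_mulS => //]; rewrite (Apol_size sn).1.
have -> : (4 * n = (n + n) + (n + n))%N by lia.
by rewrite expr2; apply: size_mulS; rewrite (Bpol_size sn).
Qed.

(** By [Bpol_coprime] the doubling fraction is in lowest terms, and its numerator has degree exactly
    [4 n], so no height is lost. *)
Lemma ph_dbl_ge (R : cpoint EK) : (4 * ph R <= ph (R *+ 2)%R)%N.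
Proof.
case eR : (val R) => [[x y]|]; last first.
  have -> : R = 0 by apply: val_inj.
  by rewrite mul0rn ph0.
have [y0|y0] := eqVneq y 0.
  by rewrite y0 in eR; rewrite (y0_torsion eR) T_dbl phT.
have [l sl el] := val_dbl eR y0.
have o := valP R; rewrite eR in o.
have [M [N [n [hn sn co nz e]]]] := dbl_frac o y0 sl.
rewrite /ph eR el /third hn.
rewrite -ltnS (hq_lowest f_inj f_frac (Bpol_coprime co) nz e) leq_max; apply/orP; left.
rewrite expr2 size_mul -?size_poly_eq0 (Bpol_size sn) //.
by lia.
Qed.

(** For distinct abscissas [hq_sum_prod] applies to the formulas of [chord_sum_diff], homogenised to
    degree [2 (n + n')]. Otherwise [S] is [R] or [- R], and the upper bound for a double
    suffices. *)
Lemma ph_par (R S : cpoint EK) :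
  (ph (R + S)%R + ph (R - S)%R <= 2 * ph R + 2 * ph S)%N.
Proof.
case eR : (val R) => [[x1 y1]|]; last first.
  have -> : R = 0 by apply: val_inj.
  by rewrite add0r sub0r phN ph0 addnn -mul2n.
case eS : (val S) => [[x2 y2]|]; last first.
  have -> : S = 0 by apply: val_inj.
  by rewrite addr0 subr0 ph0 addnn -mul2n muln0 addn0.
have oR := valP R; rewrite eR in oR; have oS := valP S; rewrite eS in oS.
have [ex|nx] := eqVneq x1 x2.
  have [ES|ES] : S = R \/ S = - R.
    subst x2; have [ey|ny] := eqVneq y1 (- y2); last first.
      by left; apply: val_inj; rewrite eR eS (same_x oR oS ny).
    by right; apply: val_inj; rewrite /= eR eS /= ey opprK.
  - rewrite ES subrr ph0 addn0 -mulr2n; apply: leq_trans (ph_dbl_le R) _.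
    by rewrite -mulnDl.
  - rewrite ES opprK subrr ph0 add0n -mulr2n phN; apply: leq_trans (ph_dbl_le R) _.
    by rewrite -mulnDl.
have h1 : ~~ ((x1 == x2) && (y1 == - y2)) by rewrite (negPf nx).
have h2 : ~~ ((x1 == x2) && (y1 == - - y2)) by rewrite (negPf nx).
have [l sl el] := slope_exists twoK oR oS h1.
have [m sm em] := slope_exists twoK oR (on_neg oS) h2.
have [e1 e2] := chord_sum_diff gK0 oR oS nx sl sm.
have [M [N [n [co N0 ew sn hn]]]] := w_lowest (wc x1).
have [M' [N' [n' [co' N0' ew' sn' hn']]]] := w_lowest (wc x2).
have eRS : val (R + S) = third x1 y1 x2 l by rewrite val_add eR eS -el.
have eRS' : val (R - S) = third x1 y1 x2 m by rewrite val_add eR /= eS -em.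
rewrite /ph eR eS eRS eRS' /third hn hn'.
have fN : N%:F != 0 by rewrite (f_eq0 f_inj).
have fN' : N'%:F != 0 by rewrite (f_eq0 f_inj).
pose F0 := (M * N' - M' * N) ^+ 2.
pose F1 := 2%:R%:P * ((M * N' + M' * N) * (M * M' + beta%:P * (N * N'))
   - (4%:R * tau)%:P * ((M * M') * (N * N'))).
pose F2 := (M * M' - beta%:P * (N * N')) ^+ 2.
have dw : wc x1 - wc x2 != 0.
  by rewrite subr_eq0; apply: contra nx => /eqP/(wc_inj gK0) ->.
have E0 : F0%:F = (N%:F * N'%:F) ^+ 2 * (wc x1 - wc x2) ^+ 2.
  rewrite ew ew' /F0.
  have -> : ((M * N' - M' * N) ^+ 2)%:F = (M%:F * N'%:F - M'%:F * N%:F) ^+ 2 by ring.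
  by field; rewrite fN fN'.
have F00 : F0 != 0 by rewrite -(f_eq0 f_inj) E0 !mulf_neq0 ?expf_neq0 ?mulf_neq0.
have sM : (size M <= n.+1)%N by rewrite -sn leq_maxl.
have sN : (size N <= n.+1)%N by rewrite -sn leq_maxr.
have sM' : (size M' <= n'.+1)%N by rewrite -sn' leq_maxl.
have sN' : (size N' <= n'.+1)%N by rewrite -sn' leq_maxr.
have szc (c : rat) (p : pQ) m0 : (size p <= m0)%N -> (size (c%:P * p)%R <= m0)%N.
  by rewrite mul_polyC => h; apply: leq_trans (size_scale_leq _ _) h.
have sub (p p' : pQ) m0 : (size p <= m0.+1)%N -> (size p' <= m0.+1)%N ->
    (size (p - p')%R <= m0.+1)%N.
  by move=> a b; apply: size_addS => //; rewrite size_polyN.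
rewrite -mulnDr mul2n -addnn.
have sA : (size (M * N')%R <= (n + n').+1)%N by apply: size_mulS.
have sB : (size (M' * N)%R <= (n + n').+1)%N by rewrite mulrC; apply: size_mulS.
have sC : (size (M * M')%R <= (n + n').+1)%N by apply: size_mulS.
have sD : (size (N * N')%R <= (n + n').+1)%N by apply: size_mulS.
have d20 : (wc x1 - wc x2) ^+ 2 != 0 by rewrite expf_neq0.
apply: (@hq_sum_prod _ _ _ f_inj f_frac _ _ F0 F1 F2) => //.
- apply: (mulIf d20); rewrite e1 betaK E0.
  have -> : F1%:F = (N%:F * N'%:F) ^+ 2 * (2%:R * ((wc x1 + wc x2) *
      (wc x1 * wc x2 + (beta%:P)%:F) - 4%:R * (3%:R * twist_t) * wc x1 * wc x2)).
    rewrite ew ew' /F1.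
    transitivity (2%:R * ((M%:F * N'%:F + M'%:F * N%:F) *
       (M%:F * M'%:F + (beta%:P)%:F * (N%:F * N'%:F))
       - 4%:R * (3%:R * twist_t) * ((M%:F * M'%:F) * (N%:F * N'%:F)))).
      by rewrite /twist_t; ring.
    by field; rewrite fN fN'.
  by field; rewrite fN fN' dw.
- apply: (mulIf d20); rewrite e2 betaK E0.
  have -> : F2%:F = (N%:F * N'%:F) ^+ 2 * (wc x1 * wc x2 - (beta%:P)%:F) ^+ 2.
    rewrite ew ew' /F2.
    transitivity ((M%:F * M'%:F - (beta%:P)%:F * (N%:F * N'%:F)) ^+ 2); first by ring.
    by field; rewrite fN fN'.
  by field; rewrite fN fN' dw.
- by rewrite /F0 expr2; apply: size_mulS; apply: (sub).
- rewrite /F1; apply: (szc); apply: (sub).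
    by apply: size_mulS; apply: size_addS => //; exact: (szc _ _ _ sD).
  by apply: (szc); apply: size_mulS.
- by rewrite /F2 expr2; apply: size_mulS; apply: (sub) => //; apply: (szc).
Qed.
End TwistQu.

(** * The 2-descent *)

Section PolySquares.
Implicit Types p X Y M N V w : pQ.

Lemma irr_coprime p X : irreducible_poly p -> ~~ (p %| X) -> coprimep p X.
Proof.
move=> irr nX; apply: coprimep_of_dvd => d dp dX; apply/eqP.
by apply: contraNT nX => sd; rewrite -(eqp_dvdl X (irr.2 d sd dp)).
Qed.

Lemma irr_dvdM p X Y : irreducible_poly p -> (p %| X * Y) = (p %| X) || (p %| Y).
Proof.
move=> irr; have [dX|nX] := boolP (p %| X); first by rewrite dvdp_mulr.
by rewrite Gauss_dvdpr ?irr_coprime.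
Qed.

Lemma irr_dvdX2 p X : irreducible_poly p -> (p %| X ^+ 2) = (p %| X).
Proof. by move=> irr; rewrite expr2 irr_dvdM // orbb. Qed.

Lemma irr_inv p X : irreducible_poly p -> ~~ (p %| X) -> exists Y, p %| X * Y - 1.
Proof.
move=> irr /(irr_coprime irr) /Bezout_eq1_coprimepP [[u v] /= e].
by exists v; rewrite -e; apply/dvdpP; exists (- u); ring.
Qed.

(** The valuation at [p] is odd on the left and even on the right; the induction on [w] replaces a
    valuation. *)
Lemma odd_val p X w V : irreducible_poly p -> ~~ (p %| X) -> w != 0 ->
  p * X * w ^+ 2 != V ^+ 2.
Proof.
move=> irr nX; have p0 := irredp_neq0 irr.
have [n] := ubnP (size w); elim: n w V => // n IH w V; rewrite ltnS => sw w0.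
apply/eqP => e.
have /dvdpP [V' eV] : p %| V by rewrite -irr_dvdX2 // -e -mulrA dvdp_mulr.
have e1 : X * w ^+ 2 = p * V' ^+ 2.
  by apply: (mulfI p0); rewrite mulrA e eV; ring.
have /dvdpP [w' ew] : p %| w.
  have : p %| X * w ^+ 2 by rewrite e1 dvdp_mulr.
  by rewrite irr_dvdM // irr_dvdX2 // (negPf nX).
have w0' : w' != 0 by apply: contraNneq w0 => h; rewrite ew h mul0r.
have lt : (size w' < n)%N.
  apply: leq_trans sw; rewrite ew size_mul //.
  by move: (irr.1); case: (size p) => [|[|m]] // _; rewrite addnS /= addnS ltnS leq_addr.
by case/eqP: (IH w' V' lt w0'); apply: (mulfI p0); rewrite -e1 ew; ring.
Qed.

(** Unique factorisation. The constant [r] must stay, since the units of Q[u] need not be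
    squares. *)
Lemma coprime_sqr_factor X Y V : coprimep X Y -> X * Y = V ^+ 2 ->
  exists (r : rat) w, r != 0 /\ X = r%:P * w ^+ 2.
Proof.
move=> co e.
have unit_case (Z : pQ) : size Z = 1%N -> exists (r : rat) w, r != 0 /\ Z = r%:P * w ^+ 2.
  by move=> /eqP/size_poly1P [r r0 ->]; exists r, 1; rewrite expr1n mulr1.
have [X0|X0] := eqVneq X 0.
  by move: co; rewrite X0 coprime0p => /eqP Y1; exists 1, 0; rewrite expr0n mulr0.
have [V0|V0] := eqVneq V 0.
  move/eqP: e; rewrite V0 expr0n mulf_eq0 (negPf X0) /= => /eqP Y0.
  by apply: unit_case; move: co; rewrite Y0 coprimep0 -size_poly_eq1 => /eqP.
pose w := gcdp X V; have w0 : w != 0 by rewrite gcdp_eq0 negb_and X0.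
have eX : X = X %/ w * w by rewrite divpK // dvdp_gcdl.
have eV : V = V %/ w * w by rewrite divpK // dvdp_gcdr.
have c' : coprimep (X %/ w) (V %/ w) by apply: coprimep_div_gcd; rewrite X0.
move: (X %/ w) (V %/ w) eX eV c' => X' V' eX eV c'.
have e1 : X' * Y = w * V' ^+ 2.
  by apply: (mulfI w0); rewrite mulrA [w * X']mulrC -eX e eV; ring.
have d1 : X' %| w.
  by rewrite -(Gauss_dvdpl _ (coprimep_expr 2 c')) -e1 dvdp_mulr.
have cw : coprimep w Y by apply: coprimep_dvdr co; rewrite eX dvdp_mull.
have d2 : w %| X' by rewrite -(Gauss_dvdpl _ cw) e1 dvdp_mulr.
have /eqpP [[c1 c2] /= /andP [c10 c20] ec] : X' %= w by rewrite /eqp d1 d2.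
exists (c2 / c1), w; split; first by rewrite mulf_neq0 ?invr_neq0.
have eX' : X' = (c2 / c1)%:P * w.
  by rewrite -[X']scale1r -(mulVf c10) -scalerA ec scalerA [_^-1 * _]mulrC mul_polyC.
by rewrite eX eX'; ring.
Qed.

Lemma sqmod_of p (c e : rat) D M w : irreducible_poly p -> ~~ (p %| w) -> e != 0 ->
  p %| c%:P * D * w ^+ 2 - e%:P * M ^+ 2 -> exists X, p %| X ^+ 2 - (c / e)%:P * D.
Proof.
move=> irr nw e0 dv; have [Y dY] := irr_inv irr nw; exists (M * Y).
have e1 : e%:P * (c / e)%:P = c%:P :> pQ by rewrite -polyCM mulrC divfK.
rewrite -(dvdp_constM _ _ e0).
have -> : e%:P * ((M * Y) ^+ 2 - (c / e)%:P * D) =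
   (w * Y - 1) * (w * Y + 1) * (c%:P * D)
   - (c%:P * D * w ^+ 2 - e%:P * M ^+ 2) * Y ^+ 2.
  by rewrite mulrBr [e%:P * (_ * D)]mulrA e1; ring.
by rewrite dvdp_sub ?dvdp_mulr.
Qed.
End PolySquares.

(** The neighbouring squares are a certificate checked by computation; coprimality of numerator and
    denominator reduces the claim to integers. *)
Lemma rat_nonsq (n k : nat) : (k ^ 2 < n < k.+1 ^ 2)%N ->
  forall s : rat, s ^+ 2 != n%:R.
Proof.
move=> /andP [h1 h2] s; apply/eqP => e.
have e1 : (numq s) ^+ 2 = n%:Z * (denq s) ^+ 2.
  apply/eqP; rewrite -(eqr_int rat) !expr2 !rmorphM /= !numqE -pmulrn -e expr2.
  by rewrite mulrACA.
have e2 : (`|numq s| ^ 2 = n * `|denq s| ^ 2)%N by rewrite -!abszX e1 abszM.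
have co : coprime `|denq s| (`|numq s| ^ 2).
  by rewrite coprimeXr // coprime_sym coprime_num_den.
have : (`|denq s| %| `|numq s| ^ 2)%N by rewrite e2 expnS mulnCA dvdn_mulr.
move=> d1; have b1 : `|denq s|%N = 1%N.
  by apply/eqP; move: co; rewrite /coprime (gcdn_idPl d1).
move: e2; rewrite b1 muln1 => e2.
move: h1 h2; rewrite -e2 !ltn_sqr; lia.
Qed.

(** * Local analysis at the places dividing g *)

Section TwoDescent.
Variables (F : fieldType) (f : {rmorphism {poly rat} -> F}).
Local Notation "p %:F" := (f p).
Hypothesis f_inj : injective f.
Hypothesis f_frac : forall w, exists M N : pQ, N != 0 /\ w = M%:F / N%:F.
Variables (t : rat) (G : pQ).
Hypothesis G0 : G != 0.
Local Notation tau := (3%:R * t).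
Local Notation beta := (9%:R * t ^+ 2 + 5%:R).
Hypothesis beta_nsq : forall s : rat, s ^+ 2 != beta.

Local Notation tK := (twist_t f t).
Local Notation gK := (twist_g f G).
Local Notation E := (EK f_inj f_frac G0 beta_nsq).
Local Notation T := (pt_T (twoK f_inj) (gK0 f_inj G0) (m5K f_inj f_frac)
  (beta_nsqK f_inj f_frac beta_nsq) : cpoint E).
Local Notation wc := (wc tK gK).
Local Notation kap R := (kappa tK gK (val (R : cpoint E))).
Local Notation Ap := (Apol t).
Let g0 : gK != 0 := gK0 f_inj G0.
Let fN0 (N : pQ) : N != 0 -> N%:F != 0.
Proof. by rewrite (f_eq0 f_inj). Qed.
Let beta0 : beta != 0 := beta_neq0 beta_nsq.

(** Equality in the multiplicative group modulo squares, where the values of [kappa] are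
    compared. *)
Definition sim (x y : F) := exists2 s, s != 0 & x = y * s ^+ 2.

Lemma sim_refl x : sim x x.
Proof. by exists 1; rewrite ?oner_neq0 // expr1n mulr1. Qed.

Lemma sim_sym x y : sim x y -> sim y x.
Proof.
by case=> s s0 ->; exists s^-1; rewrite ?invr_neq0 //; field.
Qed.

Lemma sim_trans y x z : sim x y -> sim y z -> sim x z.
Proof.
case=> s s0 -> [r r0 ->]; exists (r * s); first by rewrite mulf_neq0.
by ring.
Qed.

Lemma sim_mul x y x' y' : sim x y -> sim x' y' -> sim (x * x') (y * y').
Proof.
case=> s s0 -> [r r0 ->]; exists (s * r); first by rewrite mulf_neq0.
by ring.
Qed.

Lemma sim_poly_sqr (p q : pQ) : sim p%:F q%:F -> exists V, p * q = V ^+ 2.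
Proof.
case=> s s0 e; apply: (frac_sqr_poly f_inj f_frac (s := q%:F * s)).
by rewrite rmorphM e; ring.
Qed.

Lemma kap_neq0 (R : cpoint E) : kap R != 0.
Proof. exact: kappa_neq0 g0 (m5K f_inj f_frac) _. Qed.

Lemma kap_add (R S : cpoint E) : sim (kap (R + S)) (kap R * kap S).
Proof.
have [s e] := kappa_add R S; have n0 := kap_neq0.
have n1 : kap R * kap S != 0 by rewrite mulf_neq0.
have s0 : s != 0.
  by rewrite -sqrf_eq0 -e -mulrA mulf_neq0.
exists (s / (kap R * kap S)); first by rewrite mulf_neq0 ?invr_neq0.
have gen (a b c : F) : a != 0 -> b != 0 -> c * a * b = s ^+ 2 ->
    c = a * b * (s / (a * b)) ^+ 2.
  by move=> a0 b0 h; rewrite expr_div_n -h; field; rewrite a0 b0.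
exact: gen.
Qed.

Lemma kap_dbl (R : cpoint E) : sim (kap (R *+ 2)) 1.
Proof.
rewrite mulr2n; apply: sim_trans (kap_add R R) _.
by exists (kap R); rewrite ?kap_neq0 // mul1r expr2.
Qed.

Lemma kap_T : sim (kap T) (beta%:P)%:F.
Proof.
exists gK; first exact: g0.
by rewrite /kappa /= /quad -betaK; ring.
Qed.

Lemma coprime_maxn (M N : pQ) : coprimep M N -> exists n, maxn (size M) (size N) = n.+1.
Proof.
move=> co; have : (0 < maxn (size M) (size N))%N.
  rewrite leq_max !lt0n !size_poly_eq0 -negb_and; apply/negP => /andP [/eqP m0 /eqP n0].
  by move: co; rewrite m0 n0 coprime0p -size_poly_eq1 size_poly0.
by case: (maxn _ _) => // n _; exists n.
Qed.

Lemma Ap_neq0 (M N : pQ) : coprimep M N -> Ap M N != 0.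
Proof.
by move/coprime_maxn => [n /(Apol_size t) [s _]]; rewrite -size_poly_eq0 s.
Qed.

(** Multiplying the curve equation by the square of [N ^+ 2 / gK] clears the denominators and leaves
    a single factor [G]. *)
Lemma curve_square x y M N : on_curve (cA E) (cB E) (Some (x, y)) -> N != 0 ->
  wc x = M%:F / N%:F -> exists V, G * (M * (N * Ap M N)) = V ^+ 2.
Proof.
move=> o N0 e; have e2 := on_wc g0 o.
apply: (frac_sqr_poly f_inj f_frac (s := y * N%:F ^+ 2 / gK)).
have fN := fN0 N0.
rewrite expr_div_n exprMn e2 e quad_div //.
have -> : (G * (M * (N * Ap M N)))%:F = gK * (M%:F * (N%:F * (Ap M N)%:F)).
  by rewrite /twist_g; ring.
by field; rewrite g0 fN.
Qed.

(* The point at infinity is represented by [M / N = 1 / 0]. *)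
Lemma point_data (R : cpoint E) : exists M N V : pQ,
  [/\ coprimep M N, G * (M * (N * Ap M N)) = V ^+ 2 & sim (kap R) (Ap M N)%:F].
Proof.
case: R => [[[x y]|] o]; last first.
  exists 1, 0, 0; split; first exact: coprime1p.
    by rewrite mul0r !mulr0 expr0n.
  by rewrite /kappa /= /Apol; exists 1; rewrite ?oner_neq0 //; ring.
have [M [N [n [co N0 ew sn hn]]]] := w_lowest f_inj f_frac (wc x).
have [V eV] := curve_square o N0 ew; exists M, N, V; split=> //.
have fN := fN0 N0.
rewrite [kappa _ _ _](kappa_wc _ g0) ew quad_div //.
exists (gK / N%:F); first by rewrite mulf_neq0 ?invr_neq0.
by field.
Qed.

Variables (q H1 H2 H3 : pQ) (pl3 : seq pQ) (cG : rat).
(** [pl3] holds the irreducible factors of [H3], two of them when [t = 2], so that every member of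
    [pls] is a place. *)
Let pls := [:: q, H1, H2 & pl3].
Hypothesis cG0 : cG != 0.
Hypothesis GE : G = cG%:P * \prod_(p <- pls) p.
Hypothesis H3E : H3 = \prod_(p <- pl3) p.
Hypothesis pls_irr : forall p, p \in pls -> irreducible_poly p.
Hypothesis pls_uniq : uniq pls.
Hypothesis pls_coprime : {in pls &, forall p p', p != p' -> coprimep p p'}.
Hypothesis size_G : size G = 15%N.
Hypothesis beta_nsq_mod : forall p, p \in pls -> forall X, ~~ (p %| X ^+ 2 - beta%:P).
Hypothesis q_sqr : forall (r : rat) X, q %| X ^+ 2 - r%:P ->
  (exists s, r = s ^+ 2) \/ (exists s, r = - s ^+ 2).
Hypothesis H1_m1 : forall X : pQ, ~~ (H1 %| X ^+ 2 + 1).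
Hypothesis H1_m5 : exists X : pQ, H1 %| X ^+ 2 + 5%:R.
Hypothesis H1_excl : forall (D X : pQ) (r : rat), r != 0 -> D %| H3 -> size D != 1%N ->
  ~~ (H1 %| X ^+ 2 - r%:P * D).

Let q_in : q \in pls. Proof. by rewrite inE eqxx. Qed.
Let H1_in : H1 \in pls. Proof. by rewrite !inE eqxx orbT. Qed.
Let H2_in : H2 \in pls. Proof. by rewrite !inE eqxx !orbT. Qed.

Lemma coprime_prod (p : pQ) (s : seq pQ) : (forall p', p' \in s -> coprimep p p') ->
  coprimep p (\prod_(p' <- s) p').
Proof.
elim: s => [|x s IH] H; first by rewrite big_nil coprimep1.
rewrite big_cons coprimepMr H ?inE ?eqxx //= IH // => p' i; apply: H.
by rewrite inE i orbT.
Qed.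

Lemma G_split p : p \in pls -> exists2 Gp, G = p * Gp & coprimep p Gp.
Proof.
move=> pin; exists (cG%:P * \prod_(p' <- rem p pls) p').
  by rewrite GE (big_rem p pin) /=; ring.
rewrite mul_polyC coprimepZr //; apply: coprime_prod => p'.
by rewrite mem_rem_uniq // inE => /andP [ne i]; apply: pls_coprime; rewrite // eq_sym.
Qed.

Lemma prod_dvd (s : seq pQ) (X : pQ) : uniq s -> {subset s <= pls} ->
  (forall p, p \in s -> p %| X) -> \prod_(p <- s) p %| X.
Proof.
elim: s => [|p s IH] /=; first by rewrite big_nil dvd1p.
case/andP => np us sub H; rewrite big_cons Gauss_dvdp.
  rewrite H ?inE ?eqxx //= IH // => [x xi|x xi]; first by apply: sub; rewrite inE xi orbT.
  by apply: H; rewrite inE xi orbT.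
apply: coprime_prod => p' i; apply: pls_coprime.
- by apply: sub; rewrite inE eqxx.
- by apply: sub; rewrite inE i orbT.
- by apply: contraNneq np => ->.
Qed.

Lemma G_dvd X : (forall p, p \in pls -> p %| X) -> G %| X.
Proof. by move=> H; rewrite GE mul_polyC dvdpZl // prod_dvd. Qed.

Lemma irr_notboth p (M N : pQ) : irreducible_poly p -> coprimep M N ->
  p %| M -> p %| N -> False.
Proof.
move=> irr co dM dN; have : coprimep p p.
  by apply: coprimep_dvdr dM _; apply: coprimep_dvdl dN _.
by rewrite coprimepp => /eqP s1; move: irr.1; rewrite s1.
Qed.

Lemma coprime_ndvd p (X : pQ) : irreducible_poly p -> coprimep p X -> ~~ (p %| X).
Proof.
move=> irr co; apply/negP => d; have := coprimep_dvd_unit co d.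
by move=> s1; move: irr.1; rewrite s1.
Qed.

(** [p] divides [G] exactly once, so in a square it must divide the cofactor too. *)
Lemma place_dvd p M N V : p \in pls -> coprimep M N ->
  G * (M * (N * Ap M N)) = V ^+ 2 -> ~~ (p %| Ap M N) -> (p %| M) || (p %| N).
Proof.
move=> pin co e nA; have irr := pls_irr pin; have [Gp eG cp] := G_split pin.
apply: contraTT isT; rewrite negb_or => /andP [nM nN].
have nX : ~~ (p %| Gp * (M * (N * Ap M N))).
  by rewrite !irr_dvdM // !negb_or nM nN nA ?orbT ?andbT; apply: coprime_ndvd cp.
by case/eqP: (odd_val V irr nX (oner_neq0 _)); rewrite -e eG; ring.
Qed.
(** [M] and [N] are prime to [Ap M N], so the equation says that a place dividing [Ap M N] does so
    to an odd power. *)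
Lemma place_odd p M N V : p \in pls -> coprimep M N ->
  G * (M * (N * Ap M N)) = V ^+ 2 -> p %| Ap M N ->
  exists2 X, ~~ (p %| X) & p * X * Ap M N = V ^+ 2.
Proof.
move=> pin co e dA; have irr := pls_irr pin; have [Gp eG cp] := G_split pin.
exists (Gp * (M * N)); last by rewrite -e eG; ring.
rewrite !irr_dvdM // !negb_or (coprime_ndvd irr cp) /=; apply/andP; split.
  apply/negP => d; exact: (irr_notboth irr (Apol_coprime_M beta_nsq co) d dA).
apply/negP => d; exact: (irr_notboth irr (Apol_coprime_N t co) d dA).
Qed.

Lemma small_height (R : cpoint E) : (ph R <= 3)%N -> R = 0 \/ R = T.
Proof.
case eR : (val R) => [[x y]|]; last by left; apply: val_inj.
move=> hR; have o := valP R; rewrite eR in o.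
have [M [N [n [co N0 ew sn hn]]]] := w_lowest f_inj f_frac (wc x).
have [V eV] := curve_square o N0 ew.
right; apply: (@y0_torsion _ _ _ _ _ _ _ _ _ x); rewrite eR; congr (Some (_, _)).
have [M0|M0] := eqVneq M 0.
  apply/eqP; rewrite -sqrf_eq0 (on_wc g0 o) ew M0 rmorph0 !mul0r.
  by rewrite mulr0.
have A0 := Ap_neq0 co.
have : G %| M * (N * Ap M N).
  apply: G_dvd => p pin; have irr := pls_irr pin; rewrite !irr_dvdM //.
  have [dA|nA] := boolP (p %| Ap M N); first by rewrite !orbT.
  by case/orP: (place_dvd pin co eV nA) => ->; rewrite ?orbT.
have P0 : M * (N * Ap M N) != 0 by rewrite !mulf_neq0.
move/(dvdp_leq P0); rewrite size_G.
have sM : (size M <= n.+1)%N by rewrite -sn leq_maxl.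
have sN : (size N <= n.+1)%N by rewrite -sn leq_maxr.
have sz : (size (M * (N * Ap M N))%R <= (n + (n + (n + n))).+1)%N.
  by do 2![apply: size_mulS => //]; rewrite (Apol_size t sn).1.
move/leq_trans => /(_ _ sz); move: hR; rewrite /ph eR hn.
by clear; lia.
Qed.

Lemma Ap_mod_N p M N : p %| N -> p %| Ap M N - M ^+ 2.
Proof.
move=> d; have -> : Ap M N - M ^+ 2 = N * (- 2%:R%:P * tau%:P * M + beta%:P * N).
  by rewrite /Apol; ring.
by rewrite dvdp_mulr.
Qed.

Lemma Ap_mod_M p M N : p %| M -> p %| Ap M N - beta%:P * N ^+ 2.
Proof.
move=> d; have -> : Ap M N - beta%:P * N ^+ 2 = M * (M - 2%:R%:P * tau%:P * N).
  by rewrite /Apol; ring.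
by rewrite dvdp_mulr.
Qed.

(** [Ap M N] reduces to [M^2] at a place dividing [N] and to [beta N^2] at one dividing [M]. Locally
    the class is therefore trivial or that of [T]. *)
Lemma place_class p M N V D w (r : rat) : p \in pls -> coprimep M N ->
  G * (M * (N * Ap M N)) = V ^+ 2 -> ~~ (p %| Ap M N) -> Ap M N = r%:P * D * w ^+ 2 ->
  (exists X, p %| X ^+ 2 - r%:P * D) \/ (exists X, p %| X ^+ 2 - (r / beta)%:P * D).
Proof.
move=> pin co e nA eA; have irr := pls_irr pin.
have nw : ~~ (p %| w).
  by apply: contra nA => d; rewrite eA dvdp_mull // expr2 dvdp_mulr.
case/orP: (place_dvd pin co e nA) => d; [right | left].
  apply: (@sqmod_of _ r beta D N w) => //.
  by rewrite -eA; apply: Ap_mod_M.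
rewrite -[r]divr1; apply: (@sqmod_of _ r 1 D M w); rewrite ?oner_neq0 //.
by rewrite -eA mul1r; apply: Ap_mod_N.
Qed.

(** With the gcd [D] of [Ap M N] and [G] removed from both, the cofactor of [Ap M N] is prime to the
    remaining factors, and the whole product is still a square. *)
Lemma Ap_factor M N V : coprimep M N -> G * (M * (N * Ap M N)) = V ^+ 2 ->
  exists (r : rat) D w, [/\ r != 0, D %| G, D %| Ap M N & Ap M N = r%:P * D * w ^+ 2].
Proof.
move=> co e; pose D := gcdp (Ap M N) G.
have D0 : D != 0 by rewrite gcdp_eq0 negb_and G0 orbT.
have eA : Ap M N = Ap M N %/ D * D by rewrite divpK // dvdp_gcdl.
have eG : G = G %/ D * D by rewrite divpK // dvdp_gcdr.
have cAG : coprimep (Ap M N %/ D) (G %/ D) by apply: coprimep_div_gcd; rewrite G0 orbT.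
have dG : D %| G by apply: dvdp_gcdr.
have dA : D %| Ap M N by apply: dvdp_gcdl.
move: (Ap M N %/ D) (G %/ D) eA eG cAG => A' G' eA eG cAG.
have /dvdpP [V' eV] : D %| V.
  rewrite -(dvdp_pexp2r _ _ (isT : 0 < 2)%N) -e eG eA.
  by apply/dvdpP; exists (G' * (M * (N * A'))); ring.
have e' : A' * (G' * (M * N)) = V' ^+ 2.
  have D20 : D ^+ 2 != 0 by rewrite expf_neq0.
  by apply: (mulfI D20); move: e; rewrite eG eA eV => h; transitivity ((V' * D) ^+ 2);
     [rewrite -h; ring | ring].
have dA' : A' %| Ap M N by rewrite eA dvdp_mulr.
have c' : coprimep A' (G' * (M * N)).
  rewrite !coprimepMr cAG /=; apply/andP; split.
    by apply: coprimep_dvdr dA' _; rewrite coprimep_sym (Apol_coprime_M beta_nsq).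
  by apply: coprimep_dvdr dA' _; rewrite coprimep_sym (Apol_coprime_N t).
have [r [w [r0 ew]]] := coprime_sqr_factor c' e'.
exists r, D, w; split=> //; rewrite {1}eA ew; ring.
Qed.

Lemma H1H2_notin (p : pQ) : p \in [:: H1; H2] -> coprimep p H3.
Proof.
move=> pin; rewrite H3E; apply: coprime_prod => p' i; apply: pls_coprime.
- by move: pin; rewrite !inE => /orP [] ->; rewrite !orbT.
- by rewrite !inE i !orbT.
- apply: contraTneq i => <-; move: pls_uniq => /= /and4P [_ a b _].
  by move: pin a; rewrite !inE => /orP [] /eqP -> //; rewrite negb_or => /andP [].
Qed.

Lemma H1H2_coprime : coprimep H1 H2.
Proof.
apply: pls_coprime => //; move: pls_uniq => /= /and4P [_ a _ _].
by move: a; rewrite inE negb_or => /andP [].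
Qed.

(** Otherwise [(M - tau N)^2 = - 5 N^2] modulo [q] would make -5 a square in Q(i). *)
Lemma q_ndvd M N : coprimep M N -> ~~ (q %| Ap M N).
Proof.
move=> co; apply/negP => dA; have irr := pls_irr q_in.
have [dN|nN] := boolP (q %| N).
  exact: (irr_notboth irr (Apol_coprime_N t co) dN dA).
have [X dX] : exists X, q %| X ^+ 2 - (- 5%:R / 1)%:P * 1.
  apply: (@sqmod_of q (- 5%:R) 1 1 (M - tau%:P * N) N) => //; rewrite ?oner_neq0 //.
  have -> : (- 5%:R)%:P * 1 * N ^+ 2 - 1%:P * (M - tau%:P * N) ^+ 2 = - Ap M N.
    by rewrite /Apol; ring.
  by rewrite dvdpNr.
rewrite mulr1 divr1 in dX.
case: (q_sqr dX) => -[s es]; first by have := sqr_ge0 s; rewrite -es; lra.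
by case/eqP: (@rat_nonsq 5 2 isT s); lra.
Qed.
(** The boolean exponent corrects the valuation of [Ap M N], which by [place_odd] is odd as soon as
    it is positive, to an even one. So [Ap M' N'] has even valuation, and again by [place_odd] it
    has valuation 0. *)
Lemma parity (p M N V M' N' V' c v : pQ) : p \in pls -> coprimep M N -> coprimep M' N' ->
  G * (M * (N * Ap M N)) = V ^+ 2 -> G * (M' * (N' * Ap M' N')) = V' ^+ 2 ->
  ~~ (p %| c) -> Ap M' N' * (Ap M N * (p ^+ (p %| Ap M N)%R * c)) = v ^+ 2 ->
  ~~ (p %| Ap M' N').
Proof.
move=> pin co co' e e' nc ev; apply/negP => dA'; have irr := pls_irr pin.
have A0 := Ap_neq0 co; have A0' := Ap_neq0 co'; have p0 := irredp_neq0 irr.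
have [X' nX' eX'] := place_odd pin co' e' dA'.
case dA : (p %| Ap M N) ev => ev.
  have [X nX eX] := place_odd pin co e dA.
  have nXX : ~~ (p %| X * (X' * c)) by rewrite !irr_dvdM // !negb_or nX nX' nc.
  have w0 : p * (Ap M N * Ap M' N') != 0 by rewrite !mulf_neq0.
  case/eqP: (odd_val (V * V' * v) irr nXX w0).
  by rewrite !exprMn -eX -eX' -ev; ring.
have nXX : ~~ (p %| X' * (Ap M N * c)) by rewrite !irr_dvdM // !negb_or nX' dA nc.
case/eqP: (odd_val (V' * v) irr nXX A0').
by rewrite !exprMn -eX' -ev; ring.
Qed.

(** If [p] divided [M], then [Ap M N] would reduce to [beta N^2], and [beta] would be a square in
    the residue field. *)
Lemma square_divides (M N w V : pQ) p : p \in pls -> coprimep M N ->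
  G * (M * (N * Ap M N)) = V ^+ 2 -> Ap M N = w ^+ 2 -> ~~ (p %| M) /\ p %| N.
Proof.
move=> pin co e eA; have irr := pls_irr pin; have A0 := Ap_neq0 co.
have w0 : w != 0 by apply: contraNneq A0 => w0; rewrite eA w0 expr0n.
have nA : ~~ (p %| Ap M N).
  apply/negP => dA; have [X nX eX] := place_odd pin co e dA.
  by case/eqP: (odd_val V irr nX w0); rewrite -eA.
have nw : ~~ (p %| w) by rewrite -irr_dvdX2 // -eA.
have nM : ~~ (p %| M).
  apply/negP => dM.
  have nN : ~~ (p %| N).
    by apply/negP => dN; apply: (irr_notboth irr co dM dN).
  have [X dX] : exists X, p %| X ^+ 2 - (beta / 1)%:P * 1.
    apply: (@sqmod_of p beta 1 1 w N) => //; rewrite ?oner_neq0 //.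
    by rewrite mulr1 mul1r -eA -opprB dvdpNr; apply: Ap_mod_M.
  by move: dX; rewrite mulr1 divr1; apply/negP; apply: beta_nsq_mod pin _.
by split=> //; move: (place_dvd pin co e nA); rewrite (negPf nM).
Qed.

Lemma U_sqmod (p M N w n m : pQ) (mu la : rat) : irreducible_poly p -> mu != 0 ->
  ~~ (p %| M) -> p %| N -> p %| w - M -> M = mu%:P * m ^+ 2 ->
  2%:R * M - 2%:R * tau%:P * N + 2%:R * w = la%:P * n ^+ 2 ->
  exists X, p %| X ^+ 2 - (mu * la)%:P.
Proof.
move=> irr mu0 nM dN dw eM eU.
have dU : p %| la%:P * n ^+ 2 - 4%:R%:P * M.
  have -> : la%:P * n ^+ 2 - 4%:R%:P * M = 2%:R%:P * (w - M) - N * (2%:R%:P * tau%:P).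
    by rewrite -eU; ring.
  by apply: dvdp_sub; [apply: dvdp_mull | apply: dvdp_mulr].
have nn : ~~ (p %| n).
  apply: contra nM => dn; rewrite -(@dvdp_constM 4%:R) //.
  have -> : 4%:R%:P * M = la%:P * n ^+ 2 - (la%:P * n ^+ 2 - 4%:R%:P * M) by ring.
  by apply: dvdp_sub => //; apply: dvdp_mull; rewrite expr2 dvdp_mulr.
have [X dX] : exists X, p %| X ^+ 2 - (la / mu)%:P * 1.
  apply: (@sqmod_of p la mu 1 (2%:R%:P * m) n) => //.
  have -> : la%:P * 1 * n ^+ 2 - mu%:P * (2%:R%:P * m) ^+ 2 = la%:P * n ^+ 2 - 4%:R%:P * M.
    by rewrite eM; ring.
  exact: dU.
exists (mu%:P * X).
have ela : la = mu * (la / mu) by rewrite mulrC divfK.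
move: (la / mu) dX ela => k dX ->.
have -> : (mu%:P * X) ^+ 2 - (mu * (mu * k))%:P = mu%:P ^+ 2 * (X ^+ 2 - k%:P * 1).
  by ring.
by rewrite dvdp_mull.
Qed.

(** [s'] is then 5 times a square. As -5 is a square modulo [H1], either alternative makes -1 a
    square there, against [H1_m1]. *)
Lemma class_conflict (s s' r z : rat) : r != 0 -> z != 0 -> s * s' = - 5%:R * r ^+ 2 ->
  s = - z ^+ 2 -> (exists X, H1 %| X ^+ 2 - s%:P) \/ (exists X, H1 %| X ^+ 2 - s'%:P) ->
  False.
Proof.
move=> r0 z0 ss es [[X dX]|[X dX]].
  move/negP: (H1_m1 (z^-1%:P * X)); apply.
  rewrite -(@dvdp_constM (z ^+ 2)) ?expf_neq0 //.
  have -> : (z ^+ 2)%:P * ((z^-1%:P * X) ^+ 2 + 1) = X ^+ 2 - s%:P.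
    rewrite es mulrDr mulr1 exprMn -polyC_exp mulrA -polyCM -exprMn mulfV // expr1n.
    by ring.
  exact: dX.
have [Y dY] := H1_m5.
have es' : s' = 5%:R * (r / z) ^+ 2.
  have s0 : s != 0 by rewrite es oppr_eq0 expf_neq0.
  by apply: (mulfI s0); rewrite ss es; field.
have rz : r / z != 0 by rewrite mulf_neq0 ?invr_neq0.
move: (r / z) rz es' => k k0 es'.
move/negP: (H1_m1 ((5%:R^-1 * k^-1)%:P * (X * Y))); apply.
rewrite -(@dvdp_constM (25%:R * k ^+ 2)) ?mulf_neq0 ?expf_neq0 //.
have -> : (25%:R * k ^+ 2)%:P * (((5%:R^-1 * k^-1)%:P * (X * Y)) ^+ 2 + 1)
   = (X * Y) ^+ 2 + (25%:R * k ^+ 2)%:P.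
  rewrite mulrDr mulr1 [(_%:P * _) ^+ 2]exprMn -polyC_exp mulrA -polyCM.
  have -> : 25%:R * k ^+ 2 * (5%:R^-1 * k^-1) ^+ 2 = 1 by field.
  by rewrite mul1r.
have -> : (X * Y) ^+ 2 + (25%:R * k ^+ 2)%:P =
   (X ^+ 2 - s'%:P) * Y ^+ 2 + s'%:P * (Y ^+ 2 + 5%:R).
  by rewrite es'; ring.
by apply: dvdp_add; [apply: dvdp_mulr | apply: dvdp_mull].
Qed.

(** The two values [U w] and [U (- w)] are coprime with product [- 20 N^2], hence constants [la],
    [la'] times squares. [halving] applies with the root [w] or [- w] once [mu * la] or [mu * la']
    is a square; [q] makes one of them plus or minus a square, and [class_conflict] rules out the
    minus sign. *)
Lemma halve (R : cpoint E) : sim (kap R) 1 -> exists X, R = X *+ 2.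
Proof.
move=> kR; case eR : (val R) => [[x y]|]; last by exists 0; apply: val_inj.
have o := valP R; rewrite eR in o.
have [y0|y0] := eqVneq y 0.
  rewrite y0 in eR; have eT := y0_torsion eR; rewrite eT in kR.
  have k1 := sim_trans (sim_sym kR) kap_T; rewrite -(rmorph1 f) in k1.
  have [v] := sim_poly_sqr k1; rewrite mul1r => ev.
  have : lead_coef v ^+ 2 = beta by rewrite -lead_coef_exp -ev lead_coefC.
  by move/eqP; rewrite (negPf (beta_nsq _)).
have [M [N [n [co N0 ew sn hn]]]] := w_lowest f_inj f_frac (wc x).
have fN := fN0 N0.
have [V eV] := curve_square o N0 ew.
have [w eA] : exists w, Ap M N = w ^+ 2.
  have [s s0 es] := kR; rewrite mul1r eR in es.
  apply: (frac_sqr_poly f_inj f_frac (s := s * N%:F / gK)).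
  rewrite expr_div_n exprMn -es [kappa _ _ _](kappa_wc _ g0) ew quad_div //.
  by field; rewrite g0 fN.
have A0 := Ap_neq0 co.
have w0 : w != 0 by apply: contraNneq A0 => w0; rewrite eA w0 expr0n.
(* Every place divides [N] and none divides [M], so [N] absorbs all of [G] and the cofactor [N1] is
   such that [M * N1] is a square. *)
have /dvdpP [N1 eN] : G %| N.
  by apply: G_dvd => p pin; case: (square_divides pin co eV eA).
have /dvdpP [V1 eV1] : G * w %| V.
  rewrite -(dvdp_pexp2r _ _ (isT : 0 < 2)%N) -eV eA eN.
  by apply/dvdpP; exists (M * N1); ring.
have eMN : M * N1 = V1 ^+ 2.
  have Gw : (G * w) ^+ 2 != 0 by rewrite expf_neq0 // mulf_neq0.
  apply: (mulfI Gw); transitivity (V ^+ 2); last by rewrite eV1; ring.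
  by rewrite -eV eA eN; ring.
have coN1 : coprimep M N1 by apply: coprimep_dvdl co; rewrite eN dvdp_mulr.
have [mu [m [mu0 eM]]] := coprime_sqr_factor coN1 eMN.
pose U (e : pQ) := 2%:R * M - 2%:R * tau%:P * N + 2%:R * e.
have UU : U w * U (- w) = (- 20%:R)%:P * N ^+ 2.
  have -> : U w * U (- w) = (2%:R * M - 2%:R * tau%:P * N) ^+ 2 - 4%:R * w ^+ 2.
    by rewrite /U; ring.
  by rewrite -eA /Apol; ring.
have cU : coprimep (U w) (U (- w)).
  apply: coprimep_of_dvd => d d1 d2.
  have dN2 : d %| N ^+ 2.
    by rewrite -(@dvdp_constM (- 20%:R)) // -UU dvdp_mulr.
  have dM : d %| M - tau%:P * N.
    rewrite -(@dvdp_constM 4%:R) //.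
    have -> : 4%:R%:P * (M - tau%:P * N) = U w + U (- w) by rewrite /U; ring.
    by rewrite dvdp_add.
  apply: (@coprimep_dvd_unit _ (N ^+ 2)) => //; apply: coprimep_expr.
  apply: coprimep_dvdr dM _.
  have -> : M - tau%:P * N = - tau%:P * N + M by ring.
  by rewrite coprimep_sym coprimep_addl_mul coprimep_sym.
have [la [n1 [la0 eU]]] : exists (r : rat) k, r != 0 /\ U w = r%:P * k ^+ 2.
  apply: (@coprime_sqr_factor _ ((- 20%:R)^-1%:P * U (- w)) N).
    by rewrite mul_polyC coprimepZr.
  by rewrite mulrCA UU mulrA -polyCM mulVf // mul1r.
have [la' [n2 [la0' eU']]] : exists (r : rat) k, r != 0 /\ U (- w) = r%:P * k ^+ 2.
  apply: (@coprime_sqr_factor _ ((- 20%:R)^-1%:P * U w) N).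
    by rewrite mul_polyC coprimepZr // coprimep_sym.
  by rewrite mulrCA [U (- w) * _]mulrC UU mulrA -polyCM mulVf // mul1r.
have UU0 : U w * U (- w) != 0 by rewrite UU mulf_neq0 ?expf_neq0 ?polyC_eq0.
have [n10 n20] : n1 != 0 /\ n2 != 0.
  split; apply: contraNneq UU0 => h; rewrite ?eU ?eU' h expr0n /=.
    by rewrite mulr0 mul0r.
  by rewrite !mulr0.
have finish (e : pQ) (l : rat) k : e ^+ 2 = w ^+ 2 -> U e = l%:P * k ^+ 2 ->
    (exists s, mu * l = s ^+ 2) -> exists X, R = X *+ 2.
  move=> ee eUe [s es].
  have q1 : quad tK (wc x) 1 = (e%:F / N%:F) ^+ 2.
    by rewrite ew quad_div // eA -ee expr_div_n rmorphXn.
  have q2 : wc x * (2%:R * wc x - 2%:R * (3%:R * tK) + 2%:R * (e%:F / N%:F))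
      = ((s%:P * m * k)%:F / N%:F) ^+ 2.
    have -> : wc x * (2%:R * wc x - 2%:R * (3%:R * tK) + 2%:R * (e%:F / N%:F))
      = (M * U e)%:F / N%:F ^+ 2.
      have -> : (M * U e)%:F
        = M%:F * (2%:R * M%:F - 2%:R * (3%:R * tK) * N%:F + 2%:R * e%:F).
        by rewrite /U /twist_t; ring.
      by rewrite ew; field.
    have -> : M * U e = (s%:P * m * k) ^+ 2.
      transitivity ((mu * l)%:P * (m * k) ^+ 2); first by rewrite {1}eM eUe; ring.
      by rewrite es; ring.
    by rewrite expr_div_n rmorphXn.
  have [x2 [y2 [l2 [o2 y20 sl ex]]]] := halving (twoK f_inj) g0 (m5K f_inj f_frac)
     (beta_nsqK f_inj f_frac beta_nsq) o y0 q1 q2.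
  pose R2 : cpoint E := exist _ (Some (x2, y2)) o2.
  have [l3 sl3 e3] := @val_dbl _ _ f_inj f_frac _ _ G0 beta_nsq R2 x2 y2 erefl y20.
  have h22 : ~~ ((x2 == x2) && (y2 == - y2)).
    by rewrite eqxx /=; apply: contraNneq y20 => /(opp_eq0 (twoK f_inj)) ->.
  have el := slope_uniq h22 sl3 sl; rewrite el /third ex in e3.
  have o3 := valP (R2 *+ 2); rewrite e3 in o3.
  (* [halving] controls the abscissa only, so the double found is [R] or [- R]. *)
  have [ey|ny] := eqVneq y (- (l2 * (x2 - x) - y2)).
    exists (- R2); rewrite mulNrn; apply: val_inj.
    by transitivity (ec_neg (val (R2 *+ 2))); rewrite // e3 eR /= -ey.
  by exists R2; apply: val_inj; rewrite e3 eR (same_x o o3 ny).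
have rel : exists2 r, r != 0 & (mu * la) * (mu * la') = - 5%:R * r ^+ 2.
  have := congr1 (fun p : pQ => lead_coef p) UU.
  rewrite /= eU eU' !expr2 !lead_coefM !lead_coefC.
  have a0 : lead_coef n1 != 0 by rewrite lead_coef_eq0.
  have b0 : lead_coef n2 != 0 by rewrite lead_coef_eq0.
  have c0 : lead_coef N != 0 by rewrite lead_coef_eq0.
  move: (lead_coef n1) (lead_coef n2) (lead_coef N) a0 b0 c0 => a b c a0 b0 c0 e.
  exists (2%:R * mu * c / (a * b)); first by rewrite !mulf_neq0 ?invr_neq0 ?mulf_neq0.
  have ab0 : (a * b) ^+ 2 != 0 by rewrite expf_neq0 ?mulf_neq0.
  apply: (mulIf ab0); transitivity (mu ^+ 2 * (la * (a * a) * (la' * (b * b)))); first by ring.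
  by rewrite e; field; rewrite a0 b0.
have place p : p \in pls -> (exists X, p %| X ^+ 2 - (mu * la)%:P) \/
    (exists X, p %| X ^+ 2 - (mu * la')%:P).
  move=> pin; have irr := pls_irr pin.
  have [nM dN] := square_divides pin co eV eA.
  have : p %| (w - M) * (- w - M).
    have -> : (w - M) * (- w - M) = - (Ap M N - M ^+ 2) by rewrite eA; ring.
    by rewrite dvdpNr Ap_mod_N.
  rewrite irr_dvdM // => /orP [d|d]; [left | right].
    exact: (U_sqmod irr mu0 nM dN d eM eU).
  exact: (U_sqmod irr mu0 nM dN d eM eU').
have [r r0 er] := rel.
have p1 := place _ H1_in.
have nz (l z : rat) : l != 0 -> mu * l = - z ^+ 2 -> z != 0.
  move=> l0 e; apply: contraNneq (mulf_neq0 mu0 l0) => h.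
  by rewrite e h expr0n oppr0.
case: (place _ q_in) => -[X /q_sqr [sq|[z ez]]].
- exact: (finish w la n1).
- by case: (class_conflict r0 (nz _ _ la0 ez) er ez p1).
- by apply: (finish (- w) la' n2) => //; rewrite sqrrN.
- rewrite mulrC in er; case: (class_conflict r0 (nz _ _ la0' ez) er ez).
  by case: p1; [right | left].
Qed.

Variables P Q : cpoint E.
Variable kc : rat.
Hypothesis kc0 : kc != 0.
Let J3 := kc%:P * H3.
Hypothesis kapP : sim (kap P) (H2 * J3)%:F.
Hypothesis kapQ : sim (kap Q) (H1 * J3)%:F.

Lemma kap_bool (R : cpoint E) (Z : pQ) (e : bool) :
  sim (kap R) Z%:F -> sim (kap (R *+ e)) (Z ^+ e)%:F.
Proof. by case: e => // _; rewrite expr0 rmorph1; apply: sim_refl. Qed.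

(** [e1] and [e2] remove the odd powers of [H2] and [H1]. What is left is a constant times a divisor
    of [H3], and [H1_excl] leaves only the constant; [e3] records whether it is a square or [beta]
    times a square. *)
Lemma span_class (R : cpoint E) : exists e1 e2 e3 : bool,
  sim (kap (R + P *+ e1 + Q *+ e2 + T *+ e3)) 1.
Proof.
have [M [N [V [co e kR]]]] := point_data R.
pose e2 := H1 %| Ap M N; pose e1 := H2 %| Ap M N.
pose R' := R + P *+ e1 + Q *+ e2.
have irr1 := pls_irr H1_in; have irr2 := pls_irr H2_in; have irrq := pls_irr q_in.
have c13 : ~~ (H1 %| J3).
  by rewrite dvdp_constM //; apply: coprime_ndvd irr1 (H1H2_notin _); rewrite !inE eqxx.
have c23 : ~~ (H2 %| J3).
  by rewrite dvdp_constM //; apply: coprime_ndvd irr2 (H1H2_notin _); rewrite !inE eqxx orbT.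
have c12 : ~~ (H1 %| H2) by apply: coprime_ndvd irr1 H1H2_coprime.
have c21 : ~~ (H2 %| H1).
  by apply: coprime_ndvd irr2 _; rewrite coprimep_sym H1H2_coprime.
have kR' : sim (kap R') (Ap M N * (H2 * J3) ^+ e1 * (H1 * J3) ^+ e2)%:F.
  rewrite !(rmorphM f (Ap M N * _)) (rmorphM f (Ap M N)).
  apply: sim_trans (kap_add _ _) _; apply: sim_mul; last exact: kap_bool kapQ.
  by apply: sim_trans (kap_add _ _) _; apply: sim_mul => //; apply: kap_bool kapP.
have [M' [N' [V' [co' e' kR1]]]] := point_data R'.
have [v ev] := sim_poly_sqr (sim_trans (sim_sym kR1) kR').
have ndX (p : pQ) (X : pQ) (b : bool) : irreducible_poly p -> ~~ (p %| X) -> ~~ (p %| X ^+ b).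
  move=> irr nX; case: b => //; rewrite expr0; apply/negP => /dvdp_leq.
  by rewrite oner_neq0 size_poly1 => /(_ isT); rewrite leqNgt irr.1.
have aux1 (x y z b d : pQ) : x * (y * (b * (z * d))) = x * (y * z * (b * d)) by ring.
have aux2 (x y z b d : pQ) : x * (y * (b * (z * d))) = x * (y * (b * d) * z) by ring.
have n1 : ~~ (H1 %| Ap M' N').
  apply: (@parity _ M N V M' N' V' ((H2 * J3) ^+ e1 * J3 ^+ e2) v) => //.
    by rewrite irr_dvdM // negb_or !ndX // irr_dvdM // negb_or c12 c13.
  by rewrite -ev -/e2 (exprMn e2 H1 J3) aux1.
have n2 : ~~ (H2 %| Ap M' N').
  apply: (@parity _ M N V M' N' V' ((H1 * J3) ^+ e2 * J3 ^+ e1) v) => //.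
    by rewrite irr_dvdM // negb_or !ndX // irr_dvdM // negb_or c21 c23.
  by rewrite -ev -/e1 (exprMn e1 H2 J3) aux2.
have nq := q_ndvd co'.
have [r [D [w [r0 dG dA eA]]]] := Ap_factor co' e'.
have cD (p : pQ) : irreducible_poly p -> ~~ (p %| Ap M' N') -> coprimep D p.
  by move=> irr n; apply: coprimep_dvdr dA _; rewrite coprimep_sym irr_coprime.
have dH3 : D %| H3.
  move: dG; rewrite GE !big_cons -H3E mul_polyC dvdpZr //.
  by rewrite !Gauss_dvdpr ?cD.
have sD : size D = 1%N.
  apply/eqP/negPn/negP => sD.
  have [[X dX]|[X dX]] := place_class H1_in co' e' n1 eA.
    by move/negP: (@H1_excl D X r r0 dH3 sD).
  have rb : r / beta != 0 by rewrite mulf_neq0 ?invr_neq0.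
  by move/negP: (@H1_excl D X _ rb dH3 sD).
have /size_poly1P [d d0 eD] : size D == 1%N by rewrite sD.
have {}eA : Ap M' N' = (r * d)%:P * 1 * w ^+ 2 by rewrite eA eD; ring.
have w0 : w != 0.
  by apply: contraNneq (Ap_neq0 co') => w0; rewrite eA w0 expr0n mulr0.
(* Positive definiteness of [Ap] gives the sign of the constant and so excludes minus a square at
   [q]. *)
have rd0 : 0 < r * d.
  have [n sn] := coprime_maxn co'; have [_] := Apol_size t sn.
  rewrite eA mulr1 mul_polyC lead_coefZ lead_coef_exp pmulr_lgt0 //.
  by rewrite exprn_even_gt0 //= lead_coef_eq0.
have kR2 : sim (kap R') ((r * d)%:P)%:F.
  apply: sim_trans kR1 _; exists (w%:F); first exact: fN0.
  by rewrite eA mulr1; ring.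
have bpos : 0 < beta by apply: ltr_wpDl; rewrite // mulr_ge0 // sqr_ge0.
have [[X dX]|[X dX]] := place_class q_in co' e' nq eA; rewrite mulr1 in dX.
  case: (q_sqr dX) => -[s es]; last by have := sqr_ge0 s; lra.
  exists e1, e2, false; rewrite mulr0n addr0 -/R'; apply: sim_trans kR2 _.
  exists ((s%:P)%:F); last by rewrite es; ring.
  by rewrite fN0 // polyC_eq0 -sqrf_eq0 -es lt0r_neq0.
have rdb : 0 < r * d / beta by rewrite divr_gt0.
case: (q_sqr dX) => -[s es]; last by have := sqr_ge0 s; lra.
exists e1, e2, true; rewrite mulr1n -/R'; apply: sim_trans (kap_add _ _) _.
apply: sim_trans (sim_mul kR2 kap_T) _.
exists ((s%:P)%:F * (beta%:P)%:F).
  by rewrite mulf_neq0 // fN0 // polyC_eq0 // -sqrf_eq0 -es lt0r_neq0.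
have -> : r * d = s ^+ 2 * beta by rewrite -es divfK.
by ring.
Qed.

(** The exponent of [H2] in the class is odd exactly when [e1] holds, that of [H1] exactly when [e2]
    does; with both false, [beta] is left. *)
Lemma indep_class (e1 e2 e3 : bool) (X : cpoint E) :
  P *+ e1 + Q *+ e2 + T *+ e3 = X *+ 2 -> [/\ e1 = false, e2 = false & e3 = false].
Proof.
move=> eX.
have irr1 := pls_irr H1_in; have irr2 := pls_irr H2_in.
have c13 : ~~ (H1 %| J3).
  by rewrite dvdp_constM //; apply: coprime_ndvd irr1 (H1H2_notin _); rewrite !inE eqxx.
have c23 : ~~ (H2 %| J3).
  by rewrite dvdp_constM //; apply: coprime_ndvd irr2 (H1H2_notin _); rewrite !inE eqxx orbT.
have c12 : ~~ (H1 %| H2) by apply: coprime_ndvd irr1 H1H2_coprime.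
have c21 : ~~ (H2 %| H1).
  by apply: coprime_ndvd irr2 _; rewrite coprimep_sym H1H2_coprime.
have k1 : sim ((H2 * J3) ^+ e1 * (H1 * J3) ^+ e2 * beta%:P ^+ e3)%:F 1%:F.
  rewrite rmorph1; apply: sim_trans (kap_dbl X); rewrite -eX; apply: sim_sym.
  rewrite (rmorphM f (_ * _)) (rmorphM f (_ ^+ e1)).
  apply: sim_trans (kap_add _ _) _; apply: sim_mul; last exact: kap_bool kap_T.
  apply: sim_trans (kap_add _ _) _; apply: sim_mul; last exact: kap_bool kapQ.
  exact: kap_bool kapP.
have [v] := sim_poly_sqr k1; rewrite mulr1 => ev.
have nd1 (p : pQ) : irreducible_poly p -> ~~ (p %| 1).
  move=> irr; apply/negP => /dvdp_leq; rewrite oner_neq0 size_poly1 => /(_ isT).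
  by rewrite leqNgt irr.1.
have ndX (p : pQ) (Z : pQ) (b : bool) : irreducible_poly p -> ~~ (p %| Z) -> ~~ (p %| Z ^+ b).
  by move=> irr nX; case: b => //; rewrite expr0 nd1.
have ndb (p : pQ) : irreducible_poly p -> ~~ (p %| beta%:P).
  by move=> irr; rewrite -[beta%:P]mulr1 dvdp_constM // nd1.
have h30 : J3 != 0 by apply: contraNneq c13 => ->; rewrite dvdp0.
case: e1 ev {k1 eX} => ev; last case: e2 ev => ev; last case: e3 ev => ev //.
- case: e2 ev => ev.
    have nX : ~~ (H2 %| H1 * beta%:P ^+ e3) by rewrite irr_dvdM // negb_or c21 ndX ?ndb.
    by case/eqP: (odd_val v irr2 nX h30); rewrite -ev !expr1; ring.
  have nX : ~~ (H2 %| J3 * beta%:P ^+ e3) by rewrite irr_dvdM // negb_or c23 ndX ?ndb.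
  by case/eqP: (odd_val v irr2 nX (oner_neq0 _)); rewrite -ev expr1 expr0; ring.
- have nX : ~~ (H1 %| J3 * beta%:P ^+ e3) by rewrite irr_dvdM // negb_or c13 ndX ?ndb.
  by case/eqP: (odd_val v irr1 nX (oner_neq0 _)); rewrite -ev expr1 expr0; ring.
- move: ev; rewrite !expr0 expr1 !mul1r => ev.
  have : lead_coef v ^+ 2 = beta by rewrite -lead_coef_exp -ev lead_coefC.
  by move/eqP; rewrite (negPf (beta_nsq _)).
Qed.
Hypothesis hP : (ph P <= 4)%N.
Hypothesis hQ : (ph Q <= 4)%N.

Theorem descent_main :
  (forall (m n : int) (N : nat), (0 < N)%N -> (P *~ m + Q *~ n) *+ N = 0 ->
     m = 0 /\ n = 0) /\
  (forall R : cpoint E, exists (m n : int) (e : bool), R = P *~ m + Q *~ n + T *+ e).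
Proof.
have span R : exists (e1 e2 e3 : bool) X, R + P *+ e1 + Q *+ e2 + T *+ e3 = X *+ 2.
  have [e1 [e2 [e3 s]]] := span_class R; have [X eX] := halve s.
  by exists e1, e2, e3, X.
have T2 := T_dbl f_inj f_frac G0 beta_nsq.
have h0 := ph0 f_inj f_frac G0 beta_nsq; have hT := phT f_inj f_frac G0 beta_nsq.
split=> [m n N N0 e|R].
  exact: (descent_independence h0 hT (@ph_dbl_ge _ _ _ _ _ _ _ _) small_height indep_class N0 e).
exact: (descent_generation h0 hT (@ph_dbl_ge _ _ _ _ _ _ _ _) small_height T2 hP hQ
  (@ph_par _ _ _ _ _ _ _ _) span R).
Qed.
End TwoDescent.

(** * Residue fields at the bad places *)

Section Places.
Variable L : numFieldType.
Local Notation "r %:L" := (ratr r : L) (at level 2, left associativity, format "r %:L").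

Definition ev (th : L) : {rmorphism pQ -> L} := horner_eval th \o map_poly ratr.

Lemma evC th (c : rat) : ev th c%:P = c%:L.
Proof. by rewrite /= map_polyC /horner_eval hornerC. Qed.

Lemma evX th : ev th 'X = th.
Proof. by rewrite /= map_polyX /horner_eval hornerX. Qed.

Lemma ratrL_eq0 (r : rat) : (r%:L == 0) = (r == 0).
Proof. exact: fmorph_eq0. Qed.

Lemma ratrL_inj (r s : rat) : r%:L = s%:L -> r = s.
Proof. exact: fmorph_inj. Qed.

(** The ideal of [p] is the kernel of evaluation at [th], whose image realises the residue field
    inside [L]. *)
Definition is_place (p : pQ) (th : L) :=
  (1 < size p)%N /\ forall P, (ev th P == 0) = (p %| P).

Lemma place_irr p th : is_place p th -> irreducible_poly p.
Proof.
move=> [sp ker]; split=> // d sd dp; rewrite /eqp dp /=.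
have p0 : p != 0 by rewrite -size_poly_eq0; case: (size p) sp.
have [d' ep] := dvdpP _ _ dp.
have : ev th d' * ev th d == 0 by rewrite -rmorphM -ep ker dvdpp.
rewrite mulf_eq0 !ker => /orP [pd'|//].
have d0' : d' != 0 by apply: contraNneq p0 => h; rewrite ep h mul0r.
have d0 : d != 0 by apply: contraNneq p0 => h; rewrite ep h mulr0.
have := dvdp_leq d0' pd'; rewrite {1}ep size_mul //.
move: sd; rewrite -size_poly_eq0 in d0; rewrite -size_poly_eq0 in d0'.
by move: (size d) (size d') d0 d0' => m n; clear; lia.
Qed.

Lemma place_coprime p p' th : is_place p th -> ev th p' != 0 -> coprimep p p'.
Proof. by move=> pl n; apply: irr_coprime (place_irr pl) _; rewrite -pl.2. Qed.

Lemma place_nsq p th (x : pQ) : is_place p th -> (forall P, ev th P ^+ 2 <> ev th x) ->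
  forall X, ~~ (p %| X ^+ 2 - x).
Proof.
by move=> pl H X; rewrite -pl.2 rmorphB rmorphXn subr_eq0; apply/eqP.
Qed.

Lemma poly_size2 (P : pQ) : (size P <= 2)%N -> P = (P`_0)%:P + (P`_1)%:P * 'X.
Proof.
move=> s; apply/polyP => i; rewrite coefD coefCM coefC coefX.
case: i => [|[|i]] /=; rewrite ?mulr0 ?mulr1 ?addr0 ?add0r //.
by rewrite nth_default ?(leq_trans s).
Qed.

Lemma poly_size4 (P : pQ) : (size P <= 4)%N ->
  P = (P`_0)%:P + (P`_1)%:P * 'X + (P`_2)%:P * 'X^2 + (P`_3)%:P * 'X^3.
Proof.
move=> s; apply/polyP => i; rewrite !coefD !coefCM coefC coefX !coefXn.
case: i => [|[|[|[|i]]]] /=; rewrite ?mulr0 ?mulr1 ?addr0 ?add0r //.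
by rewrite nth_default ?(leq_trans s).
Qed.

Lemma place_of_rem (p : pQ) th : (1 < size p)%N -> ev th p = 0 ->
  (forall P : pQ, (size P < size p)%N -> ev th P = 0 -> P = 0) -> is_place p th.
Proof.
move=> sp p0 H; split=> // P.
have eP : ev th P = ev th (P %% p).
  by rewrite {1}(divp_eq P p) rmorphD rmorphM p0 mulr0 add0r.
apply/eqP/idP => [e|/dvdpP [d ->]]; last by rewrite rmorphM p0 mulr0.
apply/eqP; apply: H; last by rewrite -eP.
by rewrite ltn_modp -size_poly_eq0; case: (size p) sp.
Qed.

Section Quadratic.
Variable th : L.
Hypothesis th_irr : forall r : rat, th <> r%:L.

Lemma lin_indep (r s : rat) : r%:L + s%:L * th = 0 -> r = 0 /\ s = 0.
Proof.
move=> e; have s0 : s = 0.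
  apply/eqP; apply/negPn/negP => s0; apply: (th_irr (r := - r / s)).
  have s0' : s%:L != 0 by rewrite ratrL_eq0.
  apply: (mulfI s0'); rewrite [RHS]mulrC rmorphM fmorphV rmorphN divfK //.
  by apply/eqP; rewrite -addr_eq0 addrC e.
split=> //; apply/eqP; rewrite -ratrL_eq0; apply/eqP.
by rewrite -e s0 rmorph0 mul0r addr0.
Qed.

Lemma quad_place (p : pQ) : size p = 3%N -> ev th p = 0 -> is_place p th.
Proof.
move=> sp e; apply: place_of_rem; rewrite ?sp // => P sP.
rewrite (poly_size2 (P := P)) // rmorphD rmorphM !evC evX.
by move/lin_indep => [-> ->]; rewrite !polyC0 mul0r addr0.
Qed.

Lemma quad_ev (b c : rat) P : th ^+ 2 = b%:L + c%:L * th ->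
  exists r s : rat, ev th P = r%:L + s%:L * th.
Proof.
move=> e; elim/poly_ind: P => [|P k [r [s IH]]].
  by exists 0, 0; rewrite !rmorph0 mul0r addr0.
exists (s * b + k), (r + s * c); rewrite rmorphD rmorphM evC evX IH.
transitivity (r%:L * th + s%:L * th ^+ 2 + k%:L); first by ring.
by rewrite e; ring.
Qed.
End Quadratic.

Section Sqrt5.
Variable om : L.
Hypothesis om2 : om ^+ 2 = - 5%:R.
Local Notation k2 r0 r1 := (r0%:L + r1%:L * om).

Lemma om_irr (r : rat) : om <> r%:L.
Proof.
move=> e; have : (r ^+ 2)%:L = (- 5%:R)%:L.
  by transitivity (om ^+ 2); [rewrite e; ring | rewrite om2; ring].
by move/ratrL_inj => h; have := sqr_ge0 r; rewrite h; lra.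
Qed.

Lemma k2_inj r0 r1 s0 s1 : k2 r0 r1 = k2 s0 s1 -> r0 = s0 /\ r1 = s1.
Proof.
move=> e; have [a b] : r0 - s0 = 0 /\ r1 - s1 = 0.
  apply: (lin_indep om_irr); rewrite !rmorphB.
  transitivity (k2 r0 r1 - k2 s0 s1); first by ring.
  by rewrite e subrr.
by split; apply/eqP; rewrite -subr_eq0 ?a ?b.
Qed.

Lemma k2M r0 r1 s0 s1 :
  k2 r0 r1 * k2 s0 s1 = k2 (r0 * s0 - 5%:R * (r1 * s1)) (r0 * s1 + r1 * s0).
Proof.
transitivity (r0%:L * s0%:L + (r0%:L * s1%:L + r1%:L * s0%:L) * om + r1%:L * s1%:L * om ^+ 2).
  by ring.
by rewrite om2; ring.
Qed.

Lemma k2_norm r0 r1 s0 s1 m0 m1 : k2 r0 r1 * k2 s0 s1 = k2 m0 m1 ->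
  (r0 ^+ 2 + 5%:R * r1 ^+ 2) * (s0 ^+ 2 + 5%:R * s1 ^+ 2) = m0 ^+ 2 + 5%:R * m1 ^+ 2.
Proof. by rewrite k2M => /k2_inj [<- <-]; ring. Qed.

Lemma norm_neq0 (s0 s1 : rat) : k2 s0 s1 != 0 -> s0 ^+ 2 + 5%:R * s1 ^+ 2 != 0.
Proof.
apply: contraNneq => e.
have a := sqr_ge0 s0; have b := sqr_ge0 s1.
have a0 : s0 ^+ 2 = 0 by lra.
have b0 : s1 ^+ 2 = 0 by lra.
move/eqP: a0; move/eqP: b0; rewrite !sqrf_eq0 => /eqP -> /eqP ->.
by rewrite !rmorph0 mul0r addr0.
Qed.

Lemma k2_div r0 r1 s0 s1 : k2 s0 s1 != 0 -> exists m0 m1, k2 r0 r1 / k2 s0 s1 = k2 m0 m1.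
Proof.
move=> s0'; have n0 := norm_neq0 s0'; set n := s0 ^+ 2 + _ in n0.
exists ((r0 * s0 + 5%:R * (r1 * s1)) / n), ((r1 * s0 - r0 * s1) / n).
apply: (mulIf s0'); rewrite divfK // k2M.
have -> : (r0 * s0 + 5%:R * (r1 * s1)) / n * s0 - 5%:R * ((r1 * s0 - r0 * s1) / n * s1) = r0.
  by rewrite /n in n0 *; field.
by have -> : (r0 * s0 + 5%:R * (r1 * s1)) / n * s1 + (r1 * s0 - r0 * s1) / n * s0 = r1
  by rewrite /n in n0 *; field.
Qed.

Lemma k2_sqr_rat r0 r1 (x : rat) : k2 r0 r1 ^+ 2 = x%:L -> x = r0 ^+ 2 \/ x = - 5%:R * r1 ^+ 2.
Proof.
move=> e; have : k2 r0 r1 * k2 r0 r1 = k2 x 0 by rewrite -expr2 e rmorph0 mul0r addr0.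
rewrite k2M => /k2_inj [e1 e2].
have /eqP : r0 * r1 = 0 by lra.
rewrite mulf_eq0 => /orP [/eqP h|/eqP h]; rewrite -e1 h; [right | left]; ring.
Qed.

Lemma k2_sqr_pos r0 r1 (x : rat) : 0 < x -> (forall s : rat, s ^+ 2 != x) ->
  k2 r0 r1 ^+ 2 <> x%:L.
Proof.
move=> x0 nx /k2_sqr_rat [e|e]; first by case/eqP: (nx r0).
by have := sqr_ge0 r1; lra.
Qed.

Section Quartic.
Variables (z0 z1 : rat) (th : L).
Hypothesis z10 : z1 != 0.
Hypothesis th2 : th ^+ 2 = k2 z0 z1.
Hypothesis zeta_nsq : forall r0 r1, k2 r0 r1 ^+ 2 <> k2 z0 z1.

Lemma quartic_ev P : exists r0 r1 s0 s1, ev th P = k2 r0 r1 + k2 s0 s1 * th.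
Proof.
elim/poly_ind: P => [|P k [r0 [r1 [s0 [s1 IH]]]]].
  by exists 0, 0, 0, 0; rewrite (rmorph0 (ev th)); ring.
exists (s0 * z0 - 5%:R * (s1 * z1) + k), (s0 * z1 + s1 * z0), r0, r1.
rewrite rmorphD rmorphM evC evX IH.
transitivity (k2 r0 r1 * th + k2 s0 s1 * th ^+ 2 + k%:L); first by ring.
by rewrite th2 k2M; ring.
Qed.

Lemma quartic_indep r0 r1 s0 s1 : k2 r0 r1 + k2 s0 s1 * th = 0 ->
  k2 r0 r1 = 0 /\ k2 s0 s1 = 0.
Proof.
move=> e; have [s0'|s0'] := eqVneq (k2 s0 s1) 0.
  by split=> //; rewrite -e s0' mul0r addr0.
have [m0 [m1 em]] := k2_div (- r0) (- r1) s0'.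
case: (@zeta_nsq m0 m1); rewrite -em -th2; congr (_ ^+ 2).
apply: (mulIf s0'); rewrite divfK //; apply/eqP.
rewrite -subr_eq0 -oppr_eq0; apply/eqP; rewrite -e; ring.
Qed.

Lemma k2_eq0 r0 r1 : k2 r0 r1 = 0 -> r0 = 0 /\ r1 = 0.
Proof. by move=> e; apply: k2_inj; rewrite e !rmorph0 mul0r addr0. Qed.

(** [th] has degree 2 over Q(om) because its square is not a square there, and [z1 != 0] makes that
    square generate Q(om); so the powers of [th] below the fourth are independent over Q. *)
Lemma quartic_place (p : pQ) : size p = 5%N -> ev th p = 0 -> is_place p th.
Proof.
move=> sp e; apply: place_of_rem; rewrite ?sp // => P sP.
rewrite (poly_size4 (P := P)) //; move: (P`_0) (P`_1) (P`_2) (P`_3) => p0 p1 p2 p3.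
have -> : ev th (p0%:P + p1%:P * 'X + p2%:P * 'X^2 + p3%:P * 'X^3) =
    p0%:L + p1%:L * th + p2%:L * th ^+ 2 + p3%:L * th ^+ 3.
  transitivity (ev th p0%:P + ev th p1%:P * ev th 'X + ev th p2%:P * ev th 'X ^+ 2
     + ev th p3%:P * ev th 'X ^+ 3); first by ring.
  by rewrite !evC evX.
move=> h.
have [h1 h2] : k2 (p0 + p2 * z0) (p2 * z1) = 0 /\ k2 (p1 + p3 * z0) (p3 * z1) = 0.
  apply: quartic_indep; rewrite -h.
  transitivity (p0%:L + p1%:L * th + p2%:L * th ^+ 2 + p3%:L * (th * th ^+ 2)); last by ring.
  by rewrite th2; ring.
have [a1 a2] := k2_eq0 h1; have [b1 b2] := k2_eq0 h2.
have p20 : p2 = 0 by apply: (mulIf z10); rewrite a2 mul0r.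
have p30 : p3 = 0 by apply: (mulIf z10); rewrite b2 mul0r.
move: a1 b1; rewrite p20 p30 !mul0r !addr0 => -> ->.
by rewrite !polyC0 !mul0r !addr0.
Qed.

(** The cross term must vanish, so the root is in the base field or in [th] times it. *)
Lemma quartic_sqr P x0 x1 : ev th P ^+ 2 = k2 x0 x1 ->
  exists r0 r1, k2 r0 r1 ^+ 2 = k2 x0 x1 \/ k2 r0 r1 ^+ 2 * k2 z0 z1 = k2 x0 x1.
Proof.
have [r0 [r1 [s0 [s1 ->]]]] := quartic_ev P => e.
pose m0 := 2%:R * (r0 * s0 - 5%:R * (r1 * s1)); pose m1 := 2%:R * (r0 * s1 + r1 * s0).
have e2 : (k2 r0 r1 + k2 s0 s1 * th) ^+ 2 =
    k2 r0 r1 * k2 r0 r1 + k2 s0 s1 * k2 s0 s1 * k2 z0 z1 + 2%:R * (k2 r0 r1 * k2 s0 s1) * th.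
  by rewrite -th2; ring.
have [_ h] : k2 (r0 * r0 - 5%:R * (r1 * r1) + ((s0 * s0 - 5%:R * (s1 * s1)) * z0 -
     5%:R * ((s0 * s1 + s1 * s0) * z1)) - x0)
   (r0 * r1 + r1 * r0 + ((s0 * s0 - 5%:R * (s1 * s1)) * z1 + (s0 * s1 + s1 * s0) * z0) - x1)
   = 0 /\ k2 m0 m1 = 0.
  apply: quartic_indep.
  transitivity ((k2 r0 r1 + k2 s0 s1 * th) ^+ 2 - k2 x0 x1); last by rewrite e subrr.
  by rewrite e2 !k2M /m0 /m1; ring.
have /eqP : k2 r0 r1 * k2 s0 s1 = 0.
  apply: (mulfI (_ : 2%:R != 0)); first by rewrite pnatr_eq0.
  by rewrite mulr0 -h k2M /m0 /m1; ring.
rewrite mulf_eq0 => /orP [/eqP h0|/eqP h0].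
  by exists s0, s1; right; rewrite -e e2 h0; ring.
by exists r0, r1; left; rewrite -e e2 h0; ring.
Qed.
End Quartic.
End Sqrt5.
End Places.

Definition biq (x y z : rat) : pQ := x%:P * 'X^4 + y%:P * 'X^2 + z%:P.

Lemma size_biq x y z : x != 0 -> size (biq x y z) = 5%N.
Proof.
move=> x0; have s4 : size (x%:P * 'X^4) = 5%N by rewrite mul_polyC size_scale // size_polyXn.
have s2 : (size (y%:P * 'X^2 + z%:P)%R <= 3)%N.
  apply: leq_trans (size_polyD _ _) _; rewrite geq_max; apply/andP; split.
    by rewrite mul_polyC; apply: leq_trans (size_scale_leq _ _) _; rewrite size_polyXn.
  exact: leq_trans (size_polyC_leq1 _) _.
by rewrite /biq -addrA size_polyDl s4 // ltnS (leq_trans s2).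
Qed.

Section Concrete.
Variable t : rat.
Local Notation d := (t ^+ 2 + 5%:R).
Local Notation beta := (9%:R * t ^+ 2 + 5%:R).
Local Notation a := (5%:R - 3%:R * t ^+ 2).
Hypothesis t0 : 0 < t.
Hypothesis a0 : a != 0.
Hypothesis beta_nsq : forall s : rat, s ^+ 2 != beta.
Hypothesis betad_nsq : forall s : rat, s ^+ 2 != beta * d.

Definition qp : pQ := 'X^2 + 1.
(** [H1p] and [H2p] are the numerators of [W] at [P] and [Q] up to constants, reciprocal to each
    other. [H3p] is [d (X^2 + 1)^2 - 4 t^2 X^2], which factors when [d] is a square. *)
Definition H1p := biq d (4%:R * t ^+ 2) (4%:R * t ^+ 2).
Definition H2p := biq (4%:R * t ^+ 2) (4%:R * t ^+ 2) d.
Definition H3p := biq d (2%:R * d - 4%:R * t ^+ 2) d.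

Lemma t_neq0 : t != 0. Proof. exact: lt0r_neq0. Qed.
Lemma d_gt0 : 0 < d. Proof. by apply: ltr_wpDl; rewrite // sqr_ge0. Qed.
Lemma d_neq0 : d != 0. Proof. exact: lt0r_neq0 d_gt0. Qed.
Lemma beta_gt0 : 0 < beta. Proof. by apply: ltr_wpDl; rewrite // mulr_ge0 // sqr_ge0. Qed.

Variable L : numFieldType.
Variables im om th1 th2 : L.
Local Notation "r %:L" := (ratr r : L) (at level 2, left associativity, format "r %:L").
Local Notation k2 r0 r1 := (r0%:L + r1%:L * om).
Hypothesis im2 : im ^+ 2 = - 1.
Hypothesis om2 : om ^+ 2 = - 5%:R.
(* [u0 + u1 om] and its inverse [v0 + v1 om] are the squares of roots of [H1p] and [H2p]. *)
Local Notation u0 := (- (2%:R * t ^+ 2) / d).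
Local Notation u1 := (2%:R * t / d).
Local Notation v0 := (- 2%:R^-1 : rat).
Local Notation v1 := (- (2%:R * t)^-1).
Hypothesis th1E : th1 ^+ 2 = k2 u0 u1.
Hypothesis th2E : th2 ^+ 2 = k2 v0 v1.

Lemma ev_biq th x y z : ev th (biq x y z) = x%:L * (th ^+ 2) ^+ 2 + y%:L * th ^+ 2 + z%:L.
Proof.
transitivity (ev th x%:P * (ev th 'X ^+ 2) ^+ 2 + ev th y%:P * ev th 'X ^+ 2 + ev th z%:P).
  by rewrite /biq; ring.
by rewrite !evC evX.
Qed.

Lemma ev_biq2 th z0 z1 x y z : th ^+ 2 = k2 z0 z1 -> ev th (biq x y z) =
  k2 (x * (z0 ^+ 2 - 5%:R * z1 ^+ 2) + y * z0 + z) (x * (2%:R * z0 * z1) + y * z1).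
Proof. by move=> e; rewrite ev_biq e [(k2 _ _) ^+ 2]expr2 (k2M om2); ring. Qed.

(** By [quartic_sqr] this is the second of the two conditions for [x] to be a non-square in the
    quartic residue field, the first being that [x] is no square in Q(om). *)
Definition Zc (z0 z1 x : rat) := forall r0 r1, k2 r0 r1 ^+ 2 * k2 z0 z1 <> x%:L.

Lemma Zc_nsq z0 z1 : k2 z0 z1 != 0 -> Zc z0 z1 1 -> forall r0 r1, k2 r0 r1 ^+ 2 <> k2 z0 z1.
Proof.
move=> n0 Z r0 r1 e.
have r0' : k2 r0 r1 != 0 by rewrite -sqrf_eq0 e.
have [m0 [m1 em]] := k2_div om2 1 0 r0'.
apply: (Z m0 m1); rewrite -em -e rmorph1 rmorph0.
by move: (k2 r0 r1) r0' => k k0; field.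
Qed.

(** A number and its inverse differ by a square; this carries facts from [H1p] to [H2p]. *)
Lemma Zc_inv z0 z1 w0 w1 x : k2 z0 z1 * k2 w0 w1 = 1 -> Zc z0 z1 x -> Zc w0 w1 x.
Proof.
move=> e Z r0 r1 h.
have z0' : k2 z0 z1 != 0.
  by apply/eqP => h0; move/eqP: e; rewrite h0 mul0r eq_sym oner_eq0.
have [m0 [m1 em]] := k2_div om2 r0 r1 z0'.
apply: (Z m0 m1); rewrite -em -h.
have -> : k2 w0 w1 = (k2 z0 z1)^-1 by apply: (mulfI z0'); rewrite e mulfV.
by move: (k2 z0 z1) (k2 r0 r1) z0' => k l k0; field.
Qed.

Hypothesis Z1 : Zc u0 u1 1.
Hypothesis Zb : Zc u0 u1 beta.
Hypothesis Zm : Zc u0 u1 (- 1).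

Lemma k2_neq0 r0 r1 : r1 != 0 -> k2 r0 r1 != 0.
Proof. by apply: contra_neq => /(k2_eq0 om2) []. Qed.

Lemma u1_neq0 : u1 != 0.
Proof. by rewrite !mulf_neq0 ?invr_neq0 ?t_neq0 ?d_neq0. Qed.
Lemma v1_neq0 : v1 != 0.
Proof. by rewrite oppr_eq0 invr_neq0 // mulf_neq0 ?t_neq0. Qed.

Lemma uv_inv : k2 u0 u1 * k2 v0 v1 = 1.
Proof.
have tn := t_neq0; have dn := d_neq0.
rewrite (k2M om2).
have -> : u0 * v0 - 5%:R * (u1 * v1) = 1 by field; rewrite tn dn.
have -> : u0 * v1 + u1 * v0 = 0 by field; rewrite tn dn.
by rewrite rmorph1 rmorph0 mul0r addr0.
Qed.

Lemma zeta1_nsq r0 r1 : k2 r0 r1 ^+ 2 <> k2 u0 u1.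
Proof. exact: Zc_nsq (k2_neq0 _ u1_neq0) Z1 _ _. Qed.
Lemma zeta2_nsq r0 r1 : k2 r0 r1 ^+ 2 <> k2 v0 v1.
Proof. exact: Zc_nsq (k2_neq0 _ v1_neq0) (Zc_inv uv_inv Z1) _ _. Qed.

Lemma im_irr (r : rat) : im <> r%:L.
Proof.
move=> e; have : (r ^+ 2)%:L = (- 1)%:L.
  by transitivity (im ^+ 2); [rewrite e; ring | rewrite im2; ring].
by move/(@ratrL_inj L) => h; have := sqr_ge0 r; rewrite h; lra.
Qed.

Lemma place_q : is_place qp im.
Proof.
apply: (quad_place im_irr).
  by rewrite /qp size_polyDl size_polyXn // size_poly1.
transitivity (ev im 'X ^+ 2 + 1); first by rewrite /qp; ring.
by rewrite evX im2 addNr.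
Qed.

Lemma place_H1 : is_place H1p th1.
Proof.
apply: (quartic_place om2 u1_neq0 th1E zeta1_nsq); first exact: size_biq d_neq0.
rewrite (ev_biq2 _ _ _ th1E).
have dn := d_neq0.
have -> : d * (u0 ^+ 2 - 5%:R * u1 ^+ 2) + 4%:R * t ^+ 2 * u0 + 4%:R * t ^+ 2 = 0 by field.
have -> : d * (2%:R * u0 * u1) + 4%:R * t ^+ 2 * u1 = 0 by field.
by rewrite !rmorph0 mul0r addr0.
Qed.

Lemma place_H2 : is_place H2p th2.
Proof.
have tn := t_neq0.
apply: (quartic_place om2 v1_neq0 th2E zeta2_nsq).
  by apply: size_biq; rewrite mulf_neq0 // expf_neq0.
rewrite (ev_biq2 _ _ _ th2E).
have -> : 4%:R * t ^+ 2 * (v0 ^+ 2 - 5%:R * v1 ^+ 2) + 4%:R * t ^+ 2 * v0 + d = 0 by field.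
have -> : 4%:R * t ^+ 2 * (2%:R * v0 * v1) + 4%:R * t ^+ 2 * v1 = 0 by field.
by rewrite !rmorph0 mul0r addr0.
Qed.

Lemma q_sqrP (r : rat) X : qp %| X ^+ 2 - r%:P ->
  (exists s, r = s ^+ 2) \/ (exists s, r = - s ^+ 2).
Proof.
rewrite -place_q.2 rmorphB rmorphXn evC subr_eq0 => /eqP.
have [|r0 [r1 ->]] := @quad_ev L im (- 1) 0 X; first by rewrite im2; ring.
move=> e; have [e1 e2] : r0 ^+ 2 - r1 ^+ 2 - r = 0 /\ 2%:R * (r0 * r1) = 0.
  apply: (lin_indep im_irr).
  transitivity ((r0%:L + r1%:L * im) ^+ 2 - r%:L); last by rewrite e subrr.
  transitivity (r0%:L ^+ 2 + r1%:L ^+ 2 * im ^+ 2 + 2%:R * (r0%:L * r1%:L) * im - r%:L).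
    by rewrite im2; ring.
  by ring.
move/eqP: e2; rewrite !mulf_eq0 /= => /orP [/eqP h|/eqP h]; rewrite h in e1.
  by right; exists r1; lra.
by left; exists r0; lra.
Qed.

Lemma nsq_q X : ~~ (qp %| X ^+ 2 - beta%:P).
Proof.
apply/negP => /q_sqrP [[s e]|[s e]]; first by case/eqP: (beta_nsq s).
by have := sqr_ge0 s; have := beta_gt0; lra.
Qed.

Lemma quartic_nsq th z0 z1 p : z1 != 0 -> th ^+ 2 = k2 z0 z1 ->
  (forall r0 r1, k2 r0 r1 ^+ 2 <> k2 z0 z1) -> is_place p th ->
  forall x : rat, (forall r0 r1, k2 r0 r1 ^+ 2 <> x%:L) -> Zc z0 z1 x ->
  forall X, ~~ (p %| X ^+ 2 - x%:P).
Proof.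
move=> z10 thE nsq pl x h1 h2; apply: (place_nsq pl) => X; rewrite evC => e.
have [|r0 [r1 [h|h]]] := @quartic_sqr L om om2 z0 z1 th thE nsq X x 0.
- by rewrite e rmorph0 mul0r addr0.
- by apply: (h1 r0 r1); rewrite h rmorph0 mul0r addr0.
- by apply: (h2 r0 r1); rewrite h rmorph0 mul0r addr0.
Qed.

Lemma beta_k2 r0 r1 : k2 r0 r1 ^+ 2 <> beta%:L.
Proof. exact: (k2_sqr_pos om2 beta_gt0 beta_nsq). Qed.

Lemma nsq_H1 X : ~~ (H1p %| X ^+ 2 - beta%:P).
Proof. exact: (quartic_nsq u1_neq0 th1E zeta1_nsq place_H1 beta_k2 Zb). Qed.

Lemma nsq_H2 X : ~~ (H2p %| X ^+ 2 - beta%:P).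
Proof.
exact: (quartic_nsq v1_neq0 th2E zeta2_nsq place_H2 beta_k2 (Zc_inv uv_inv Zb)).
Qed.

Lemma H1_m1P X : ~~ (H1p %| X ^+ 2 + 1).
Proof.
have -> : X ^+ 2 + 1 = X ^+ 2 - (- 1)%:P by ring.
apply: (quartic_nsq u1_neq0 th1E zeta1_nsq place_H1 _ Zm) => r0 r1 /(k2_sqr_rat om2) [e|e].
  by have := sqr_ge0 r0; lra.
have : (5%:R * r1) ^+ 2 = 5%:R by rewrite exprMn; lra.
by apply/eqP; apply: (@rat_nonsq 5 2).
Qed.

Lemma H1_m5P : exists X : pQ, H1p %| X ^+ 2 + 5%:R.
Proof.
have tn := t_neq0; have dn := d_neq0.
(* The witness is [om], obtained by solving [th1 ^+ 2 = u0 + u1 om] for it. *)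
exists ((d / (2%:R * t))%:P * 'X^2 + t%:P); rewrite -place_H1.2.
have e : ev th1 ((d / (2%:R * t))%:P * 'X^2 + t%:P) = om.
  transitivity (ev th1 (d / (2%:R * t))%:P * ev th1 'X ^+ 2 + ev th1 t%:P); first by ring.
  rewrite !evC evX th1E.
  transitivity (k2 (d / (2%:R * t) * u0 + t) (d / (2%:R * t) * u1)); first by ring.
  have -> : d / (2%:R * t) * u0 + t = 0 by field; rewrite tn dn.
  have -> : d / (2%:R * t) * u1 = 1 by field; rewrite tn dn.
  by rewrite rmorph0 rmorph1 mul1r add0r.
by rewrite rmorphD rmorphXn e om2 rmorph_nat addNr.
Qed.

Lemma ev_H3_th1 : ev th1 H3p = k2 (a * (2%:R * u0 + 1)) (a * (2%:R * u1)).
Proof.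
have dn := d_neq0; rewrite (ev_biq2 _ _ _ th1E).
by congr (_%:L + _%:L * om); field.
Qed.

(* The norm of [H3(th1) = a (2 zeta + 1)] is [a^2 beta / d]. *)
Lemma H3_th1_class (X : pQ) (m : rat) : m != 0 -> ev th1 X ^+ 2 <> m%:L * ev th1 H3p.
Proof.
have dn := d_neq0; have tn := t_neq0.
move=> m0; rewrite ev_H3_th1.
have -> : m%:L * k2 (a * (2%:R * u0 + 1)) (a * (2%:R * u1)) =
   k2 (m * a * (2%:R * u0 + 1)) (m * a * (2%:R * u1)) by ring.
have ma0 : m * a != 0 by rewrite mulf_neq0.
move/(quartic_sqr om2 th1E zeta1_nsq) => [r0 [r1 [h|h]]].
  (* Taking norms, the first alternative makes [beta / d] a square; in the second the norm
     [4 t^2 / d] of [th1 ^+ 2] enters and [beta] itself becomes one. *)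
  rewrite expr2 in h; have := k2_norm om2 h; set n := r0 ^+ 2 + _ => e.
  case/eqP: (betad_nsq (d * n / (m * a))).
  rewrite !expr_div_n exprMn [n ^+ 2]expr2 e; field.
  by rewrite a0 m0 dn.
rewrite [_ ^+ 2]expr2 (k2M om2) in h; have := k2_norm om2 h.
set n := r0 ^+ 2 + 5%:R * r1 ^+ 2.
have -> : (r0 * r0 - 5%:R * (r1 * r1)) ^+ 2 + 5%:R * (r0 * r1 + r1 * r0) ^+ 2 = n ^+ 2.
  by rewrite /n; ring.
have -> : u0 ^+ 2 + 5%:R * u1 ^+ 2 = 4%:R * t ^+ 2 / d by field.
move=> e; case/eqP: (beta_nsq (2%:R * t * n / (m * a))).
have -> : (2%:R * t * n / (m * a)) ^+ 2 = d * (n ^+ 2 * (4%:R * t ^+ 2 / d)) / (m * a) ^+ 2.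
  by field; rewrite a0 m0 dn.
by rewrite e; field; rewrite a0 m0 dn.
Qed.

Lemma coprime_q_biq x y z : x - y + z != 0 -> coprimep qp (biq x y z).
Proof.
move=> n; apply: (place_coprime place_q); rewrite ev_biq im2.
have -> : x%:L * (- 1) ^+ 2 + y%:L * (- 1) + z%:L = (x - y + z)%:L by ring.
by rewrite ratrL_eq0.
Qed.

Lemma coprime_H1_H2 : coprimep H1p H2p.
Proof.
have dn := d_neq0; have tn := t_neq0.
apply: (place_coprime place_H1); rewrite (ev_biq2 _ _ _ th1E); apply: k2_neq0.
have -> : 4%:R * t ^+ 2 * (2%:R * u0 * u1) + 4%:R * t ^+ 2 * u1 = 8%:R * a * t ^+ 3 / d ^+ 2.
  by field.
by rewrite !mulf_neq0 ?invr_neq0 ?expf_neq0.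
Qed.

Lemma coprime_H1_H3 : coprimep H1p H3p.
Proof.
have dn := d_neq0; have tn := t_neq0.
apply: (place_coprime place_H1); rewrite ev_H3_th1; apply: k2_neq0.
by rewrite !mulf_neq0 ?invr_neq0.
Qed.

Lemma coprime_H2_H3 : coprimep H2p H3p.
Proof.
have dn := d_neq0; have tn := t_neq0.
apply: (place_coprime place_H2); rewrite (ev_biq2 _ _ _ th2E); apply: k2_neq0.
have -> : d * (2%:R * v0 * v1) + (2%:R * d - 4%:R * t ^+ 2) * v1 = - a / (2%:R * t).
  by field.
by rewrite !mulf_neq0 ?invr_neq0 ?oppr_eq0 ?mulf_neq0.
Qed.
End Concrete.

(** The local input of the descent, stated in Q[u] alone, so that no number field appears beyond
    this point. *)
Record place_facts (t : rat) (pl3 : seq pQ) : Prop := PlaceFacts {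
  pf_H3 : H3p t = \prod_(p <- pl3) p;
  pf_irr : forall p, p \in [:: qp, H1p t, H2p t & pl3] -> irreducible_poly p;
  pf_uniq : uniq [:: qp, H1p t, H2p t & pl3];
  pf_coprime : {in [:: qp, H1p t, H2p t & pl3] &, forall p p', p != p' -> coprimep p p'};
  pf_nsq : forall p, p \in [:: qp, H1p t, H2p t & pl3] ->
    forall X, ~~ (p %| X ^+ 2 - (9%:R * t ^+ 2 + 5%:R)%:P);
  pf_q : forall (r : rat) X, qp %| X ^+ 2 - r%:P ->
    (exists s, r = s ^+ 2) \/ (exists s, r = - s ^+ 2);
  pf_m1 : forall X : pQ, ~~ (H1p t %| X ^+ 2 + 1);
  pf_m5 : exists X : pQ, H1p t %| X ^+ 2 + 5%:R;
  pf_excl : forall (D X : pQ) (r : rat), r != 0 -> D %| H3p t -> size D != 1%N ->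
    ~~ (H1p t %| X ^+ 2 - r%:P * D) }.

Lemma irr_neq (p p' : pQ) : irreducible_poly p -> coprimep p p' -> p != p'.
Proof.
move=> irr co; apply: contraTneq co => <-; rewrite coprimepp.
by apply/negP => /eqP s1; move: irr.1; rewrite s1.
Qed.

Lemma uniq_of_coprime (s : seq pQ) : (forall p, p \in s -> irreducible_poly p) ->
  pairwise (fun p p' : pQ => coprimep p p') s ->
  uniq s /\ {in s &, forall p p', p != p' -> coprimep p p'}.
Proof.
elim: s => [|x s IH] //= irr /andP [/allP cx cs].
have [|u c] := IH _ cs; first by move=> p i; apply: irr; rewrite inE i orbT.
split.
  rewrite u andbT; apply/negP => xs.
  have := irr_neq (irr x _) (cx x xs); rewrite inE !eqxx => /(_ isT).
  by [].
move=> p p'; rewrite !inE => /orP [/eqP ->|pi] /orP [/eqP ->|pi'] n.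
- by rewrite eqxx in n.
- exact: cx.
- by rewrite coprimep_sym cx.
- exact: c.
Qed.

Lemma eqp_scale (p p' : pQ) : p %= p' -> exists2 c : rat, c != 0 & p = c%:P * p'.
Proof.
case/eqpP => -[c1 c2] /= /andP [c10 c20] ec; exists (c2 / c1).
  by rewrite mulf_neq0 ?invr_neq0.
by rewrite -[p]scale1r -(mulVf c10) -scalerA ec scalerA [_^-1 * _]mulrC mul_polyC.
Qed.

(** * Assembling the local facts; the cases where d is not a square *)

Section CaseA.
Variable t : rat.
Local Notation d := (t ^+ 2 + 5%:R).
Local Notation beta := (9%:R * t ^+ 2 + 5%:R).
Local Notation a := (5%:R - 3%:R * t ^+ 2).
Hypothesis t0 : 0 < t.
Hypothesis a0 : a != 0.
Hypothesis beta_nsq : forall s : rat, s ^+ 2 != beta.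
Hypothesis betad_nsq : forall s : rat, s ^+ 2 != beta * d.

Local Notation L := algC.
Local Notation "r %:L" := (ratr r : L) (at level 2, left associativity, format "r %:L").
Variables om th1 th2 : L.
Local Notation k2 r0 r1 := (r0%:L + r1%:L * om).
Hypothesis om2 : om ^+ 2 = - 5%:R.
Let im2 : ('i : L) ^+ 2 = - 1 := sqrCi _.
Local Notation u0 := (- (2%:R * t ^+ 2) / d).
Local Notation u1 := (2%:R * t / d).
Hypothesis th1E : th1 ^+ 2 = k2 u0 u1.
Hypothesis th2E : th2 ^+ 2 = k2 (- 2%:R^-1) (- (2%:R * t)^-1).

Section Common.
Hypothesis Z1 : Zc om u0 u1 1.
Hypothesis Zb : Zc om u0 u1 beta.
Hypothesis Zm : Zc om u0 u1 (- 1).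
Variables (pl3 : seq pQ) (ths : pQ -> L).
Hypothesis H3E : H3p t = \prod_(p <- pl3) p.
Hypothesis pl3P : forall p, p \in pl3 -> is_place p (ths p).
Hypothesis pl3_coprime : pairwise (fun p p' : pQ => coprimep p p') pl3.
Hypothesis pl3_nsq : forall p, p \in pl3 -> forall X, ~~ (p %| X ^+ 2 - beta%:P).
Hypothesis excl : forall (D X : pQ) (r : rat), r != 0 -> D %| H3p t -> size D != 1%N ->
  ev th1 X ^+ 2 <> r%:L * ev th1 D.

Lemma common_facts : place_facts t pl3.
Proof.
have plq := place_q im2.
have plH1 := place_H1 t0 om2 th1E Z1.
have plH2 := place_H2 t0 om2 th2E Z1.
have irr p : p \in [:: qp, H1p t, H2p t & pl3] -> irreducible_poly p.
  rewrite !inE => /or4P [/eqP ->|/eqP ->|/eqP ->|/pl3P pl]; apply: place_irr.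
  - exact: plq.
  - exact: plH1.
  - exact: plH2.
  - exact: pl.
have dv p : p \in pl3 -> p %| H3p t.
  by move=> i; rewrite H3E (big_rem p i) dvdp_mulr.
have dn := d_neq0 t; have tn := t_neq0 t0.
have co : pairwise (fun p p' : pQ => coprimep p p') [:: qp, H1p t, H2p t & pl3].
  rewrite /= pl3_coprime !andbT.
  have c1 : coprimep qp (H1p t) by apply: (coprime_q_biq im2); rewrite -addrA addNr addr0.
  have c2 : coprimep qp (H2p t) by apply: (coprime_q_biq im2); rewrite subrr add0r.
  have c3 : coprimep qp (H3p t).
    apply: (coprime_q_biq im2).
    have -> : d - (2%:R * d - 4%:R * t ^+ 2) + d = 4%:R * t ^+ 2 by ring.
    by rewrite mulf_neq0 ?expf_neq0.
  have c4 := coprime_H1_H2 t0 a0 om2 th1E Z1.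
  have c5 := coprime_H1_H3 t0 a0 om2 th1E Z1.
  have c6 := coprime_H2_H3 t0 a0 om2 th2E Z1.
  rewrite c1 c2 c4 /=; apply/and3P; split; apply/allP => p i;
    apply: coprimep_dvdl (dv p i) _ => //.
have [u c] := uniq_of_coprime irr co.
split=> //.
- move=> p; rewrite !inE => /or4P [/eqP ->|/eqP ->|/eqP ->|i] X.
  + exact: (nsq_q beta_nsq im2).
  + exact: (nsq_H1 t0 beta_nsq om2 th1E Z1 Zb).
  + exact: (nsq_H2 t0 beta_nsq om2 th2E Z1 Zb).
  + exact: pl3_nsq.
- by move=> r X; apply: (q_sqrP im2).
- by move=> X; apply: (H1_m1P t0 om2 th1E Z1 Zm).
- exact: (H1_m5P t0 om2 th1E Z1).
- move=> D X r r0 dD sD; rewrite -plH1.2 rmorphB rmorphXn rmorphM evC subr_eq0.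
  by apply/eqP; apply: excl.
Qed.
End Common.

Lemma facts_d_nonsquare : (forall s : rat, s ^+ 2 != d) -> place_facts t [:: H3p t].
Proof.
move=> d_nsq; have dn := d_neq0 t; have tn := t_neq0 t0; have dpos := d_gt0 t.
(* As the norm of [u0 + u1 om] is [4 t^2 / d], any exception would make [d] a square. *)
have Z x : x != 0 -> Zc om u0 u1 x.
  move=> x0 r0 r1; rewrite expr2 (k2M om2) => h.
  have {}h : k2 (r0 * r0 - 5%:R * (r1 * r1)) (r0 * r1 + r1 * r0) * k2 u0 u1 = k2 x 0.
    by rewrite h rmorph0 mul0r addr0.
  have := k2_norm om2 h; set n := r0 ^+ 2 + 5%:R * r1 ^+ 2.
  have -> : (r0 * r0 - 5%:R * (r1 * r1)) ^+ 2 + 5%:R * (r0 * r1 + r1 * r0) ^+ 2 = n ^+ 2.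
    by rewrite /n; ring.
  have -> : u0 ^+ 2 + 5%:R * u1 ^+ 2 = 4%:R * t ^+ 2 / d by field.
  have -> : x ^+ 2 + 5%:R * 0 ^+ 2 = x ^+ 2 by ring.
  move=> e; case/eqP: (d_nsq (2%:R * t * n / x)).
  have -> : (2%:R * t * n / x) ^+ 2 = d * (n ^+ 2 * (4%:R * t ^+ 2 / d)) / x ^+ 2.
    by field; rewrite x0 dn.
  by rewrite e; field.
have bpos := beta_gt0 t.
have Z1 := Z 1 (oner_neq0 _); have Zb := Z beta (lt0r_neq0 bpos).
have Zm : Zc om u0 u1 (- 1) by apply: Z; rewrite oppr_eq0 oner_neq0.
(* [(t + om)^2 / d], the square of a root of [H3p]. A rational [x] is this number times a square
   only if [x * d] is a square in Q(om). *)
pose w0 := (t ^+ 2 - 5%:R) / d; pose w1 := 2%:R * t / d.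
have w10 : w1 != 0 by rewrite !mulf_neq0 ?invr_neq0.
have ZZ x : 0 < x -> (forall s : rat, s ^+ 2 != x * d) -> Zc om w0 w1 x.
  move=> x0 nx r0 r1 h.
  have sq : (k2 r0 r1 * k2 t 1) ^+ 2 = (x * d)%:L.
    transitivity (k2 r0 r1 ^+ 2 * (k2 w0 w1 * d%:L)); last by rewrite mulrA h -rmorphM.
    have -> : k2 w0 w1 * d%:L = k2 t 1 ^+ 2.
      transitivity (k2 (w0 * d) (w1 * d)); first by ring.
      rewrite [(k2 t 1) ^+ 2]expr2 (k2M om2) /w0 /w1 !divfK //.
      by congr (_%:L + _%:L * om); ring.
    by ring.
  rewrite (k2M om2) in sq.
  by apply: (k2_sqr_pos om2 _ nx sq); rewrite mulr_gt0.
have ZZ1 : Zc om w0 w1 1 by apply: ZZ => // s; rewrite mul1r.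
have ZZb : Zc om w0 w1 beta by apply: ZZ.
pose th3 : L := sqrtC (k2 w0 w1).
have th3E : th3 ^+ 2 = k2 w0 w1 := sqrtCK _.
have nsq3 := Zc_nsq om2 (k2_neq0 om2 w0 w10) ZZ1.
have pl3 : is_place (H3p t) th3.
  apply: (quartic_place om2 w10 th3E nsq3); first exact: size_biq.
  rewrite (ev_biq2 om2 _ _ _ th3E) /w0 /w1.
  set x0 := (X in X%:L + _); set x1 := (X in _ + X%:L * _).
  have -> : x0 = 0 by rewrite /x0; field.
  have -> : x1 = 0 by rewrite /x1; field.
  by rewrite !rmorph0 mul0r addr0.
apply: (@common_facts Z1 Zb Zm _ (fun _ => th3)) => //.
- by rewrite big_seq1.
- by move=> p; rewrite inE => /eqP ->.
- move=> p; rewrite inE => /eqP -> X.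
  exact: (quartic_nsq om2 w10 th3E nsq3 pl3 (beta_k2 beta_nsq om2) ZZb).
- move=> D X r r0 dD sD; have irr := place_irr pl3.
  have [c c0 ->] := eqp_scale (irr.2 D sD dD).
  rewrite (rmorphM (ev th1)) evC mulrA -rmorphM.
  by apply: (H3_th1_class t0 a0 beta_nsq betad_nsq om2 th1E Z1); rewrite mulf_neq0.
Qed.
End CaseA.

(** * The case t = 2, where d = 9 is a square *)

Lemma Zc_two_arith (x b n0 r n : rat) : x != 0 ->
  (if 0 < x then n = 2%:R * x else n = - 10%:R * x) -> 0 <= n0 ->
  (n0 - 3%:R / 4%:R * x) * (n0 + 3%:R / 4%:R * x) = 0 -> b = - x / 2%:R ->
  r ^+ 2 = 8%:R * (n0 + b) -> r ^+ 2 = n.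
Proof.
move=> x0 en n00 /eqP e0 eb ->; move: e0; rewrite mulf_eq0 subr_eq0 addr_eq0.
by case: ltgtP x0 en => // xs _ en /orP [] /eqP e0; lra.
Qed.

Lemma biq_comp_oppX (x y z : rat) : biq x y z \Po - 'X = biq x y z.
Proof.
rewrite /biq !comp_polyD !comp_polyM !comp_polyC !comp_polyX; ring.
Qed.

(** The factors [3 (X^2 + 1) - 4 X] and [3 (X^2 + 1) + 4 X] of the difference of squares [H3p 2]; X
    -> -X exchanges them. *)
Definition H31 : pQ := 3%:R%:P * 'X^2 + (- 4%:R)%:P * 'X + 3%:R%:P.
Definition H32 : pQ := 3%:R%:P * 'X^2 + 4%:R%:P * 'X + 3%:R%:P.

Lemma size_quadpoly (x y z : rat) : x != 0 ->
  size (x%:P * 'X^2 + y%:P * 'X + z%:P) = 3%N.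
Proof.
move=> x0; have s2 : size (x%:P * 'X^2) = 3%N by rewrite mul_polyC size_scale // size_polyXn.
have s1 : (size (y%:P * 'X + z%:P)%R <= 2)%N.
  apply: leq_trans (size_polyD _ _) _; rewrite geq_max; apply/andP; split.
    by rewrite mul_polyC; apply: leq_trans (size_scale_leq _ _) _; rewrite size_polyX.
  exact: leq_trans (size_polyC_leq1 _) _.
by rewrite -addrA size_polyDl s2 // ltnS.
Qed.

Section CaseB.
Local Notation L := algC.
Local Notation t := (2%:R : rat).
Local Notation "r %:L" := (ratr r : L) (at level 2, left associativity, format "r %:L").
Variables om th1 th2 : L.
Local Notation k2 r0 r1 := (r0%:L + r1%:L * om).
Hypothesis om2 : om ^+ 2 = - 5%:R.
Local Notation u0 := (- (2%:R * t ^+ 2) / (t ^+ 2 + 5%:R)).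
Local Notation u1 := (2%:R * t / (t ^+ 2 + 5%:R)).
Hypothesis th1E : th1 ^+ 2 = k2 u0 u1.
Hypothesis th2E : th2 ^+ 2 = k2 (- 2%:R^-1) (- (2%:R * t)^-1).

(** A root [r0 + r1 om] of [x / (u0 + u1 om)] has [r0^2 - 5 r1^2 = - x / 2] and norm [3/4 |x|].
    Adding the two, [(4 r0)^2] is [2 x] or [- 10 x] according to the sign of [x]. *)
Lemma Zc_two (x : rat) (n : nat) : x != 0 -> 
  (if 0 < x then n%:R = 2%:R * x else n%:R = - 10%:R * x) ->
  (forall s : rat, s ^+ 2 != n%:R) -> Zc om u0 u1 x.
Proof.
move=> x0 en nn r0 r1; rewrite expr2 !(k2M om2) => h.
have := @k2_inj L om om2 _ _ x 0; rewrite rmorph0 mul0r addr0 => /(_ _ _ h) [e1 e2].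
pose c := r0 * r1; pose b := r0 ^+ 2 - 5%:R * r1 ^+ 2.
have eu0 : u0 = - 8%:R / 9%:R by [].
have eu1 : u1 = 4%:R / 9%:R by [].
have ec : c = - x / 8%:R.
  have f1 : b * u0 - 5%:R * (2%:R * c) * u1 = x by rewrite -e1 /b /c; ring.
  have f2 : b * u1 + 2%:R * c * u0 = 0 by rewrite -e2 /b /c; ring.
  by move: f1 f2; rewrite eu0 eu1; move: b c => b c; lra.
have eb : b = - x / 2%:R.
  have f2 : b * u1 + 2%:R * c * u0 = 0 by rewrite -e2 /b /c; ring.
  by move: f2; rewrite ec eu0 eu1; move: b => b; lra.
pose n0 := r0 ^+ 2 + 5%:R * r1 ^+ 2.
have n00 : 0 <= n0.
  by apply: addr_ge0; [apply: sqr_ge0 | apply: mulr_ge0; [apply: ler0n | apply: sqr_ge0]].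
have en0 : (n0 - 3%:R / 4%:R * x) * (n0 + 3%:R / 4%:R * x) = 0.
  have -> : (n0 - 3%:R / 4%:R * x) * (n0 + 3%:R / 4%:R * x)
     = b ^+ 2 + 20%:R * c ^+ 2 - 9%:R / 16%:R * x ^+ 2 by rewrite /n0 /b /c; field.
  by rewrite eb ec; field.
have r02 : (4%:R * r0) ^+ 2 = 8%:R * (n0 + b) by rewrite /n0 /b; ring.
by case/eqP: (nn (4%:R * r0)); apply: (Zc_two_arith x0 en n00 en0 eb r02).
Qed.

Lemma H3_two : H3p t = H31 * H32.
Proof.
have -> : H3p t = biq 9%:R 2%:R 9%:R by [].
by rewrite /biq /H31 /H32; ring.
Qed.

Lemma ev_quadpoly th (x y z : rat) : ev th (x%:P * 'X^2 + y%:P * 'X + z%:P)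
  = x%:L * th ^+ 2 + y%:L * th + z%:L.
Proof.
transitivity (ev th x%:P * ev th 'X ^+ 2 + ev th y%:P * ev th 'X + ev th z%:P).
  by ring.
by rewrite !evC evX.
Qed.

Lemma place_k2 (s0 y : rat) : y = - 2%:R * s0 * 3%:R -> 9%:R * s0 ^+ 2 = 4%:R ->
  is_place (3%:R%:P * 'X^2 + y%:P * 'X + 3%:R%:P) (k2 s0 3%:R^-1).
Proof.
move=> ey es; apply: quad_place; last 1 first.
- rewrite ev_quadpoly [(k2 _ _) ^+ 2]expr2 (k2M om2).
  transitivity (k2 (3%:R * (s0 * s0 - 5%:R * (3%:R^-1 * 3%:R^-1)) + y * s0 + 3%:R)
     (3%:R * (s0 * 3%:R^-1 + 3%:R^-1 * s0) + y * 3%:R^-1)); first by ring.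
  have -> : 3%:R * (s0 * s0 - 5%:R * (3%:R^-1 * 3%:R^-1)) + y * s0 + 3%:R = 0.
    by rewrite ey; lra.
  have -> : 3%:R * (s0 * 3%:R^-1 + 3%:R^-1 * s0) + y * 3%:R^-1 = 0 by rewrite ey; field.
  by rewrite rmorph0 mul0r addr0.
- move=> r e.
  have := @k2_inj L om om2 s0 3%:R^-1 r 0; rewrite e rmorph0 mul0r addr0 => /(_ erefl) [_].
  by [].
- by rewrite size_quadpoly.
Qed.

Lemma nsq_k2 p s0 : is_place p (k2 s0 3%:R^-1) -> 9%:R * s0 ^+ 2 = 4%:R ->
  forall X, ~~ (p %| X ^+ 2 - (9%:R * t ^+ 2 + 5%:R)%:P).
Proof.
move=> pl es; apply: (place_nsq pl) => X; rewrite evC.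
have [|r [s ->]] := @quad_ev L (k2 s0 3%:R^-1) (- 1) (2%:R * s0) X.
  rewrite expr2 (k2M om2).
  transitivity (k2 (- 1 + 2%:R * s0 * s0) (2%:R * s0 * 3%:R^-1)); last by ring.
  by congr (_%:L + _%:L * om); lra.
have -> : r%:L + s%:L * k2 s0 3%:R^-1 = k2 (r + s * s0) (s * 3%:R^-1) by ring.
apply: (k2_sqr_pos om2); first by [].
exact: (@rat_nonsq 41 6).
Qed.

Lemma facts_two : place_facts t [:: H31; H32].
Proof.
have nsq n k : (k ^ 2 < n < k.+1 ^ 2)%N -> forall s : rat, s ^+ 2 != n%:R by apply: rat_nonsq.
have Z1 : Zc om u0 u1 1 by apply: (@Zc_two 1 2) => //; apply: (nsq _ 1).
have Zb : Zc om u0 u1 (9%:R * t ^+ 2 + 5%:R).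
  by apply: (@Zc_two _ 82) => //; apply: (nsq _ 9).
have Zm : Zc om u0 u1 (- 1) by apply: (@Zc_two _ 10) => //; apply: (nsq _ 3).
have t0 : 0 < t by [].
have a0 : 5%:R - 3%:R * t ^+ 2 != 0 by [].
have bn : forall s : rat, s ^+ 2 != 9%:R * t ^+ 2 + 5%:R by apply: (nsq 41 6).
have bdn : forall s : rat, s ^+ 2 != (9%:R * t ^+ 2 + 5%:R) * (t ^+ 2 + 5%:R).
  by apply: (nsq 369 19).
have p31 : is_place H31 (k2 (2%:R / 3%:R) 3%:R^-1) by apply: place_k2.
have p32 : is_place H32 (k2 (- 2%:R / 3%:R) 3%:R^-1) by apply: place_k2.
have i31 := place_irr p31; have i32 := place_irr p32.
have c312 : coprimep H31 H32.
  apply: (place_coprime p31).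
  have -> : H32 = H31 + 8%:R%:P * 'X by rewrite /H31 /H32; ring.
  have -> : ev (k2 (2%:R / 3%:R) 3%:R^-1) (H31 + 8%:R%:P * 'X) =
     8%:R%:L * k2 (2%:R / 3%:R) 3%:R^-1.
    rewrite (rmorphD (ev _)) (rmorphM (ev _)) evC evX.
    have /eqP -> : ev (k2 (2%:R / 3%:R) 3%:R^-1) H31 == 0 by rewrite p31.2 dvdpp.
    by rewrite add0r.
  apply: mulf_neq0; first by rewrite ratrL_eq0.
  exact: (k2_neq0 om2).
have plH1 := place_H1 t0 om2 th1E Z1.
have cls := H3_th1_class t0 a0 bn bdn om2 th1E Z1.
(* [H1p] is even, so X -> -X turns a square value of one factor at the place into one of the other,
   with the same constant; their product would contradict [H3_th1_class]. *)
have conj (Y Y' : pQ) X (m : rat) : Y \Po - 'X = Y' -> H3p t = Y * Y' -> m != 0 ->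
    ev th1 X ^+ 2 <> m%:L * ev th1 Y.
  move=> eY eH m0 e.
  have dv : H1p t %| X ^+ 2 - m%:P * Y.
    by rewrite -plH1.2 rmorphB rmorphXn (rmorphM (ev th1)) evC e subrr.
  have := dvdp_comp_poly (- 'X) dv; rewrite biq_comp_oppX.
  rewrite rmorphB rmorphXn rmorphM /= comp_polyC eY -/(H1p t).
  rewrite -plH1.2 rmorphB rmorphXn (rmorphM (ev th1)) evC subr_eq0 => /eqP e'.
  apply: (cls (X * (X \Po - 'X)) (m ^+ 2)); first by rewrite expf_neq0.
  rewrite rmorphM exprMn e e' eH rmorphM; ring.
have o31 : H31 \Po - 'X = H32.
  rewrite /H31 /H32 !comp_polyD !comp_polyM !comp_polyC !comp_polyX; ring.
have o32 : H32 \Po - 'X = H31.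
  rewrite /H31 /H32 !comp_polyD !comp_polyM !comp_polyC !comp_polyX; ring.
pose ths p : L := if p == H31 then k2 (2%:R / 3%:R) 3%:R^-1 else k2 (- 2%:R / 3%:R) 3%:R^-1.
have n312 : H32 != H31 by rewrite eq_sym irr_neq.
apply: (@common_facts t t0 a0 bn om th1 th2 om2 th1E th2E Z1 Zb Zm _ ths).
- by rewrite big_cons big_seq1; exact: H3_two.
- move=> p; rewrite !inE /ths => /orP [] /eqP ->; first by rewrite eqxx; exact: p31.
  by rewrite (negPf n312); exact: p32.
- by rewrite /= c312.
- move=> p; rewrite !inE => /orP [] /eqP ->.
    exact: (nsq_k2 p31).
  exact: (nsq_k2 p32).
move=> D X r r0 dD sD.
(* A divisor containing one irreducible factor is, up to a constant, that factor or all of [H3p]. *)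
have irrD (Y Y' : pQ) : irreducible_poly Y' -> H3p t = Y * Y' -> Y != 0 ->
    Y %| D -> exists2 c : rat, c != 0 & D = c%:P * Y \/ D = c%:P * H3p t.
  move=> iY' eH Y0 /dvdpP [E eD].
  have dE : E %| Y'.
    by move: dD; rewrite eD eH mulrC dvdp_mul2l.
  have [sE|sE] := eqVneq (size E) 1%N.
    have /size_poly1P [c c0 eE] : size E == 1%N by rewrite sE.
    by exists c; [exact: c0 | left; rewrite eD eE; exact: erefl].
  have [c c0 eE] := eqp_scale (iY'.2 E sE dE).
  by exists c; [exact: c0 | right; rewrite eD eE eH; ring].
have fin (Y Y' : pQ) : irreducible_poly Y' -> Y \Po - 'X = Y' -> H3p t = Y * Y' -> Y != 0 ->
    Y %| D -> ev th1 X ^+ 2 <> r%:L * ev th1 D.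
  move=> iY' oY eH Y0 dY; have [c c0 [->|->]] := irrD _ _ iY' eH Y0 dY.
    rewrite (rmorphM (ev th1)) evC mulrA -rmorphM; apply: conj oY eH _.
    by rewrite mulf_neq0.
  rewrite (rmorphM (ev th1)) evC mulrA -rmorphM; apply: cls.
  by rewrite mulf_neq0.
have eH' : H3p t = H32 * H31 by rewrite H3_two mulrC.
have [d1|nd1] := boolP (H31 %| D).
  exact: fin i32 o31 H3_two (irredp_neq0 i31) d1.
have [d2|nd2] := boolP (H32 %| D).
  exact: fin i31 o32 eH' (irredp_neq0 i32) d2.
case/negP: sD; apply/eqP; apply: (@coprimep_dvd_unit _ (H3p t)); last exact: dD.
rewrite H3_two coprimepMr ![coprimep D _]coprimep_sym.
by rewrite (irr_coprime i31 nd1) (irr_coprime i32 nd2).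
Qed.
End CaseB.

(** * The theorem *)

(** [algC] supplies the square roots [om], [th1] and [th2]; the integers for [n = 1] and [n = 3] are
    the values of [beta], [beta * d] and [d]. *)
Lemma facts_algC (n : nat) : (n == 1) || (n == 2) || (n == 3) ->
  exists pl3, place_facts n%:R pl3.
Proof.
have om2 : (sqrtC (- 5%:R) : algC) ^+ 2 = - 5%:R by apply: sqrtCK.
have nsq m k : (k ^ 2 < m < k.+1 ^ 2)%N -> forall s : rat, s ^+ 2 != m%:R by apply: rat_nonsq.
case/orP => [/orP [/eqP ->|/eqP ->]|/eqP ->].
- exists [:: H3p 1]; apply: (facts_d_nonsquare _ _ _ _ om2 (sqrtCK _) (sqrtCK _)).
  + by [].
  + by [].
  + exact: (nsq 14 3).
  + exact: (nsq 84 9).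
  + exact: (nsq 6 2).
- exists [:: H31; H32]; exact: (facts_two om2 (sqrtCK _) (sqrtCK _)).
- exists [:: H3p 3]; apply: (facts_d_nonsquare _ _ _ _ om2 (sqrtCK _) (sqrtCK _)).
  + by [].
  + by [].
  + exact: (nsq 86 9).
  + exact: (nsq 1204 34).
  + exact: (nsq 14 3).
Qed.

Section Main.
Variables (F : fieldType) (f : {rmorphism {poly rat} -> F}).
Local Notation "p %:F" := (f p).
Hypothesis f_inj : injective f.
Hypothesis f_frac : forall w, exists M N : pQ, N != 0 /\ w = M%:F / N%:F.
Variables (n : nat) (a b : int).
Hypothesis n123 : (n == 1) || (n == 2) || (n == 3).
Hypothesis aE : a = 5%:R - 3%:R * n%:R ^+ 2.
Hypothesis bE : b = 2%:R * n%:R * (n%:R ^+ 2 + 5%:R).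
Local Notation u := ('X%:F).
Local Notation aK := (a%:~R : F).
Local Notation bK := (b%:~R : F).

(** The data of the theorem over an abstract field of fractions; for [F = Qu] they become those of
    the statement. *)
Definition gF : F :=
  - aK * bK * (u ^+ 2 + 1) *
    (bK ^+ 2 * (u ^+ 4 + u ^+ 2 + 1) ^+ 3 + aK ^+ 3 * u ^+ 4 * (u ^+ 2 + 1) ^+ 2).
Local Notation AF := (aK * gF ^+ 2).
Local Notation BF := (bK * gF ^+ 3).
Definition PF : ec_point F :=
  Some (- (bK * (u ^+ 2 + u + 1) * (u ^+ 2 - u + 1)) / (aK * (u ^+ 2 + 1)) * gF,
        gF ^+ 2 / (aK ^+ 2 * (u ^+ 2 + 1) ^+ 2)).
Definition QF : ec_point F :=
  Some (- (bK * (u ^+ 2 + u + 1) * (u ^+ 2 - u + 1)) / (aK * u ^+ 2 * (u ^+ 2 + 1)) * gF,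
        gF ^+ 2 / (aK ^+ 2 * u ^+ 3 * (u ^+ 2 + 1) ^+ 2)).

Local Notation t := (n%:R : rat).
Local Notation ar := (5%:R - 3%:R * t ^+ 2 : rat).
Local Notation tF := (n%:R : F).
Local Notation br := (2%:R * t * (t ^+ 2 + 5%:R) : rat).
Definition cG : rat := - ar * br.
Definition Gpol : pQ := cG%:P * (qp * (H1p t * (H2p t * H3p t))).

Lemma n_gt0 : (0 < n)%N.
Proof. by case: n n123. Qed.

Lemma ar_neq0 : ar != 0.
Proof. by case/orP: n123 => [/orP [/eqP ->|/eqP ->]|/eqP ->]. Qed.

Lemma beta_nsq : forall s : rat, s ^+ 2 != 9%:R * t ^+ 2 + 5%:R.
Proof.
have nsq m k : (k ^ 2 < m < k.+1 ^ 2)%N -> forall s : rat, s ^+ 2 != m%:R by apply: rat_nonsq.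
case/orP: n123 => [/orP [/eqP ->|/eqP ->]|/eqP ->].
- exact: (nsq 14 3).
- exact: (nsq 41 6).
- exact: (nsq 86 9).
Qed.

Lemma aKE : aK = 5%:R - 3%:R * tF ^+ 2. Proof. by rewrite aE; ring. Qed.
Lemma bKE : bK = 2%:R * tF * (tF ^+ 2 + 5%:R). Proof. by rewrite bE; ring. Qed.



Lemma natF (m : nat) : (m%:R%:P)%:F = m%:R :> F.
Proof. by rewrite !rmorph_nat. Qed.

Local Notation q1 := (u ^+ 2 + 1).
Local Notation dF := (tF ^+ 2 + 5%:R).
Local Notation h1 := (dF * u ^+ 4 + 4%:R * tF ^+ 2 * u ^+ 2 + 4%:R * tF ^+ 2).
Local Notation h2 := (4%:R * tF ^+ 2 * u ^+ 4 + 4%:R * tF ^+ 2 * u ^+ 2 + dF).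
Local Notation h3 := (dF * u ^+ 4 + (2%:R * dF - 4%:R * tF ^+ 2) * u ^+ 2 + dF).

Lemma qF : qp%:F = q1. Proof. by rewrite /qp; ring. Qed.
Lemma H1F : (H1p t)%:F = h1. Proof. by rewrite /H1p /biq; ring. Qed.
Lemma H2F : (H2p t)%:F = h2. Proof. by rewrite /H2p /biq; ring. Qed.
Lemma H3F : (H3p t)%:F = h3. Proof. by rewrite /H3p /biq; ring. Qed.
Lemma tKE : twist_t f t = tF. Proof. by rewrite /twist_t natF. Qed.

(** The factor of degree 12 in g is the numerator of the cubic at the abscissa of [P]; the rational
    root of the cubic contributes [H1p], its quadratic factor [d * H2p * H3p]. *)
Lemma gFE : gF = twist_g f Gpol.
Proof.
rewrite /twist_g /Gpol.
transitivity (- aK * bK * (q1 * (h1 * (h2 * h3)))).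
  by rewrite /gF aKE bKE; ring.
have -> : - aK * bK = (cG%:P)%:F by rewrite /cG aKE bKE; ring.
by rewrite -H1F -H2F -H3F -qF -!(rmorphM f).
Qed.

Lemma aK_neq0 : aK != 0.
Proof.
have -> : aK = (ar%:P)%:F by rewrite aKE; ring.
by rewrite (f_eq0 f_inj) polyC_eq0 ar_neq0.
Qed.

Lemma cG_neq0 : cG != 0.
Proof.
have tn : t != 0 by rewrite pnatr_eq0 -lt0n n_gt0.
have dn := d_neq0 t.
by rewrite /cG !mulf_neq0 ?oppr_eq0 ?ar_neq0.
Qed.

Lemma t_gt0 : 0 < t. Proof. by rewrite ltr0n n_gt0. Qed.

Lemma size_qp : size qp = 3%N.
Proof. by rewrite /qp size_polyDl size_polyXn // size_poly1. Qed.

Lemma q_neq0 : qp != 0. Proof. by rewrite -size_poly_eq0 size_qp. Qed.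
Lemma size_H1 : size (H1p t) = 5%N. Proof. exact: size_biq (d_neq0 t). Qed.
Lemma size_H2 : size (H2p t) = 5%N.
Proof. by apply: size_biq; rewrite mulf_neq0 // expf_neq0 // lt0r_neq0 ?t_gt0. Qed.
Lemma size_H3 : size (H3p t) = 5%N. Proof. exact: size_biq (d_neq0 t). Qed.

Lemma size_Gpol : size Gpol = 15%N.
Proof.
rewrite /Gpol mul_polyC size_scale ?cG_neq0 //.
have n1 : H1p t != 0 by rewrite -size_poly_eq0 size_H1.
have n2 : H2p t != 0 by rewrite -size_poly_eq0 size_H2.
have n3 : H3p t != 0 by rewrite -size_poly_eq0 size_H3.
rewrite size_mul ?q_neq0 ?mulf_neq0 // (size_mul n1) ?mulf_neq0 // (size_mul n2 n3).
by rewrite size_qp size_H1 size_H2 size_H3.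
Qed.

Lemma G_neq0 : Gpol != 0. Proof. by rewrite -size_poly_eq0 size_Gpol. Qed.

Local Notation E := (EK f_inj f_frac G_neq0 beta_nsq).

Lemma AE : AF = cA E.
Proof. by rewrite /= -gFE tKE aKE. Qed.
Lemma BE : BF = cB E.
Proof. by rewrite /= -gFE tKE bKE. Qed.

Local Notation wP := (- 2%:R * tF * h1 / (aK * q1)).
Local Notation wQ := (- 2%:R * tF * h2 / (aK * (u ^+ 2 * q1))).

Lemma q1_neq0 : q1 != 0. Proof. by rewrite -qF (f_eq0 f_inj) q_neq0. Qed.
Lemma u_neq0 : u != 0. Proof. by rewrite (f_eq0 f_inj) polyX_eq0. Qed.
Lemma gF_neq0 : gF != 0. Proof. by rewrite gFE (gK0 f_inj G_neq0). Qed.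

Lemma quadP : quad tF wP 1 = dF * (h2 * h3) / (aK * q1) ^+ 2.
Proof.
have an := aK_neq0; have qn := q1_neq0; move: an.
by rewrite /quad aKE => an; field; rewrite qn an.
Qed.

Lemma quadQ : quad tF wQ 1 = dF * (h1 * h3) / (aK * (u ^+ 2 * q1)) ^+ 2.
Proof.
have an := aK_neq0; have qn := q1_neq0; have un := u_neq0; move: an.
by rewrite /quad aKE => an; field; rewrite qn an un.
Qed.

Lemma gF_fact : gF = - aK * bK * (q1 * (h1 * (h2 * h3))).
Proof. by rewrite /gF aKE bKE; ring. Qed.

Lemma PFE : PF = Some (gF * (wP - 2%:R * tF), gF ^+ 2 / (aK * q1) ^+ 2).
Proof.
have an := aK_neq0; have qn := q1_neq0; congr (Some (_, _)).
  transitivity (gF * (- (bK * (u ^+ 2 + u + 1) * (u ^+ 2 - u + 1)) / (aK * q1))).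
    by field; rewrite qn an.
  congr (_ * _); move: an; rewrite aKE bKE => an.
  by field; rewrite qn an.
by field; rewrite qn an.
Qed.

Lemma QFE : QF = Some (gF * (wQ - 2%:R * tF), gF ^+ 2 / (u ^+ 3 * (aK * q1) ^+ 2)).
Proof.
have an := aK_neq0; have qn := q1_neq0; have un := u_neq0; congr (Some (_, _)).
  transitivity (gF * (- (bK * (u ^+ 2 + u + 1) * (u ^+ 2 - u + 1)) / (aK * (u ^+ 2 * q1)))).
    by field; rewrite qn an un.
  congr (_ * _); move: an; rewrite aKE bKE => an.
  by field; rewrite qn an un.
by field; rewrite qn an un.
Qed.

Lemma PF_on_curve : on_curve (cA E) (cB E) PF.
Proof.
have an := aK_neq0; have qn := q1_neq0.
have := @on_wcP F (twist_t f t) (twist_g f Gpol) wP (gF ^+ 2 / (aK * q1) ^+ 2).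
rewrite tKE -gFE -PFE /= -gFE tKE; apply; rewrite quadP.
transitivity (gF ^+ 3 * gF / (aK * q1) ^+ 4); first by field; rewrite qn an.
by rewrite {2}gF_fact bKE; field; rewrite qn an.
Qed.

Lemma QF_on_curve : on_curve (cA E) (cB E) QF.
Proof.
have an := aK_neq0; have qn := q1_neq0; have un := u_neq0.
have := @on_wcP F (twist_t f t) (twist_g f Gpol) wQ (gF ^+ 2 / (u ^+ 3 * (aK * q1) ^+ 2)).
rewrite tKE -gFE -QFE /= -gFE tKE; apply; rewrite quadQ.
transitivity (gF ^+ 3 * gF / (u ^+ 6 * (aK * q1) ^+ 4)); first by field; rewrite qn an un.
by rewrite {2}gF_fact bKE; field; rewrite qn an un.
Qed.

Definition Pp : cpoint E := exist _ PF PF_on_curve.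
Definition Qp : cpoint E := exist _ QF QF_on_curve.

Lemma wc_shift w : wc (twist_t f t) (twist_g f Gpol) (gF * (w - 2%:R * tF)) = w.
Proof. by rewrite /wc -gFE tKE; field; exact: gF_neq0. Qed.

Lemma constFM (c : rat) (p : pQ) : (c%:P * p)%:F = (c%:P)%:F * p%:F.
Proof. by rewrite rmorphM. Qed.

Lemma dFE : ((t ^+ 2 + 5%:R)%:P)%:F = dF. Proof. by ring. Qed.

Lemma kappa_Pp : sim (kappa (twist_t f t) (twist_g f Gpol) (val Pp))
  (H2p t * ((t ^+ 2 + 5%:R)%:P * H3p t))%:F.
Proof.
have an := aK_neq0; have qn := q1_neq0; have gn := gF_neq0.
rewrite [val Pp]PFE (kappa_wc _ (gK0 f_inj G_neq0)) wc_shift tKE -gFE quadP.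
exists (gF / (aK * q1)); first by rewrite mulf_neq0 // invr_neq0 // mulf_neq0.
rewrite (rmorphM f) constFM dFE H2F H3F.
by move: h2 h3 => x y; field; rewrite qn an.
Qed.

Lemma kappa_Qp : sim (kappa (twist_t f t) (twist_g f Gpol) (val Qp))
  (H1p t * ((t ^+ 2 + 5%:R)%:P * H3p t))%:F.
Proof.
have an := aK_neq0; have qn := q1_neq0; have gn := gF_neq0; have un := u_neq0.
rewrite [val Qp]QFE (kappa_wc _ (gK0 f_inj G_neq0)) wc_shift tKE -gFE quadQ.
exists (gF / (aK * (u ^+ 2 * q1))).
  have u2n : u ^+ 2 != 0 by rewrite expf_neq0.
  by rewrite mulf_neq0 // invr_neq0 // !mulf_neq0.
rewrite (rmorphM f) constFM dFE H1F H3F.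
by move: h1 h3 => x y; field; rewrite qn an un.
Qed.

Lemma aKP : aK = (ar%:P)%:F. Proof. by rewrite aKE; ring. Qed.

Lemma ph_Pp : (ph Pp <= 4)%N.
Proof.
have an := aK_neq0; have qn := q1_neq0.
rewrite /ph [val Pp]PFE wc_shift.
apply: (hq_le f_inj f_frac (M := (- 2%:R * t)%:P * H1p t) (N := ar%:P * qp)).
- by rewrite mulf_neq0 ?polyC_eq0 ?ar_neq0 ?q_neq0.
- by rewrite !constFM -aKP qF H1F; congr (_ * _ / _); ring.
- rewrite mul_polyC; apply: leq_trans (size_scale_leq _ _) _.
  by rewrite size_H1.
- rewrite mul_polyC; apply: leq_trans (size_scale_leq _ _) _.
  by rewrite size_qp.
Qed.

Lemma ph_Qp : (ph Qp <= 4)%N.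
Proof.
have an := aK_neq0; have qn := q1_neq0.
rewrite /ph [val Qp]QFE wc_shift.
apply: (hq_le f_inj f_frac (M := (- 2%:R * t)%:P * H2p t) (N := ar%:P * ('X^2 * qp))).
- by rewrite !mulf_neq0 ?polyC_eq0 ?ar_neq0 ?q_neq0 ?expf_neq0 ?polyX_eq0.
- rewrite !constFM -aKP (rmorphM f) qF H2F rmorphXn.
  by congr (_ * _ / _); ring.
- rewrite mul_polyC; apply: leq_trans (size_scale_leq _ _) _.
  by rewrite size_H2.
- rewrite mul_polyC; apply: leq_trans (size_scale_leq _ _) _.
  by rewrite mulrC size_mulXn ?q_neq0 // size_qp.
Qed.

Theorem rank_two :
  [/\ on_curve AF BF PF, on_curve AF BF QF,
      (forall m n : int,
          ec_torsion AF BF (ec_add AF BF (ec_mul AF BF m PF) (ec_mul AF BF n QF)) ->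
          m = 0 /\ n = 0) &
      (forall R : ec_point F, on_curve AF BF R ->
         exists m n : int, exists T : ec_point F,
           [/\ on_curve AF BF T, ec_torsion AF BF T &
               R = ec_add AF BF (ec_add AF BF (ec_mul AF BF m PF) (ec_mul AF BF n QF)) T])].
Proof.
rewrite AE BE.
have [pl3 [H3E irr un co nsq qs m1 m5 ex]] := facts_algC n123.
have GE : Gpol = cG%:P * \prod_(p <- [:: qp, H1p t, H2p t & pl3]) p.
  by rewrite !big_cons -H3E.
have [ind gen] := descent_main cG_neq0 GE H3E irr un co size_Gpol nsq qs m1 m5 ex
   (d_neq0 t) kappa_Pp kappa_Qp ph_Pp ph_Qp.
have vmn m k : val (Pp *~ m + Qp *~ k) =
    ec_add (cA E) (cB E) (ec_mul (cA E) (cB E) m PF) (ec_mul (cA E) (cB E) k QF).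
  by rewrite val_add !val_mulrz.
split; [exact: PF_on_curve | exact: QF_on_curve | move=> m k | move=> R oR].
  by rewrite -vmn => /torsion_mulrn [N N0 e]; apply: ind N0 e.
have [m [k [e eR]]] := gen (exist _ R oR); exists m, k.
set T := pt_T _ _ _ _ in eR; exists (val (T *+ e)); split.
- exact: valP.
- apply/torsion_mulrn; exists 2%N => //.
  by case: (e); rewrite ?mulr1n ?mul0rn //; apply: T_dbl.
- by rewrite -vmn -val_add -eR.
Qed.
End Main.

Theorem theorem6p3 (a b : int) :
  (a = 2 /\ b = 12) \/ (a = -7 /\ b = 36) \/ (a = -22 /\ b = 84) ->
  let A := A_ab a b in let B := B_ab a b in
  let P := P_ab a b in let Q := Q_ab a b in
  [/\ on_curve A B P, on_curve A B Q,
      (* independence: m P + n Q torsion only for m = n = 0 *)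
      (forall m n : int,
          ec_torsion A B (ec_add A B (ec_mul A B m P) (ec_mul A B n Q)) ->
          m = 0 /\ n = 0) &
      (* generation: every point is m P + n Q + T with T torsion *)
      (forall R : ec_point Qu, on_curve A B R ->
         exists m n : int, exists T : ec_point Qu,
           [/\ on_curve A B T, ec_torsion A B T &
               R = ec_add A B (ec_add A B (ec_mul A B m P) (ec_mul A B n Q)) T])].
Proof.
have f_inj : injective (@FracField.tofrac {poly rat}).
  by move=> p q /eqP; rewrite tofrac_eq => /eqP.
have main n := @rank_two Qu (@FracField.tofrac {poly rat}) f_inj (@frac_exists rat) n a b.
case=> [[ea eb]|[[ea eb]|[ea eb]]].
- by apply: (main 1%N); rewrite ?ea ?eb.
- by apply: (main 2%N); rewrite ?ea ?eb.
- by apply: (main 3%N); rewrite ?ea ?eb.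
Qed.
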